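(* Let $X$ be a compact Riemann surface of genus $g\geq 2$, let $L\to X$ be a holomorphic line bundle of degree $d_L$, and let $n\geq 1$ and $d$ be integers with $d\leq \frac n2 d_L$. Set \[ \alpha_m=d-\frac{n-1}{2}d_L,\qquad \alpha_M=\frac dn . \] If $\alpha_c$ is a critical value for $L$-quadric bundles of type $(n,d)$ over $X$, then $\alpha_m\leq\alpha_c\leq\alpha_M$.
   Context: An $L$-quadric bundle over $X$ is a pair $(V,\gamma)$ with $V$ a holomorphic vector bundle on $X$ and $\gamma$ a non-zero holomorphic section of $S^2V^*\otimes L$, viewed also as a symmetric map $\gamma:V\to V^*\otimes L$. Its type is $(n,d)$ if $n=\mathrm{rk}(V)$ and $d=\deg(V)$. For a subbundle $V'\subseteq V$, $V'^\perp$ denotes the kernel of $V^*\to V'^*$. Below, proper subbundles are non-zero and different from $V$, and $\alpha\in\mathbb{R}$. Semistability. $(V,\gamma)$ of type $(n,d)$ is $\alpha$-semistable if $\alpha\leq d/n$ and: (1) for any proper subbundle $V'\subsetneq V$: (a) if $\gamma(V')\not\subseteq V'^\perp\otimes L$, then $\deg(V')\leq d+\alpha(\mathrm{rk}(V')-n)$; (b) if $\gamma(V')\subseteq V'^\perp\otimes L$, then $\deg(V')\leq \frac d2+\alpha(\mathrm{rk}(V')-\frac n2)$; (c) if $\gamma(V')=0$, then $\deg(V')\leq\alpha\,\mathrm{rk}(V')$; (2) for any strict filtration $0\subsetneq V'\subsetneq V''\subsetneq V$ by subbundles with $\gamma(V')\subseteq V''^\perp\otimes L$ and $\gamma(V'')\not\subseteq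 V''^\perp\otimes L$, one has $\deg(V')+\deg(V'')\leq d+\alpha(\mathrm{rk}(V')+\mathrm{rk}(V'')-n)$. It is $\alpha$-stable if moreover all these inequalities in (1) and (2) are strict. Polystability. $(V,\gamma)$ is $\alpha$-polystable if it is $\alpha$-semistable and: (1) for any proper subbundle $V'\subsetneq V$: (a) if $\gamma(V')\not\subseteq V'^\perp\otimes L$ and equality holds in (1)(a), then there is a subbundle $V''\subsetneq V$ with $V\cong V'\oplus V''$ and $\gamma=\left(\begin{smallmatrix}\gamma'&0\\0&0\end{smallmatrix}\right)$ with $0\neq\gamma'\in H^0(X,S^2V'^*\otimes L)$; (b) if $\gamma(V')\subseteq V'^\perp\otimes L$ and equality holds in (1)(b), then there is a subbundle $V''\subsetneq V$ with $V\cong V'\oplus V''$ and $\gamma=\left(\begin{smallmatrix}0&\gamma'\\ \gamma'^t&0\end{smallmatrix}\right)$ with $0\neq\gamma'\in H^0(X,V'^*\otimes V''^*\otimes L)$; (c) if $\gamma(V')=0$ and equality holds in (1)(c), then there is a subbundle $V''\subsetneq V$ with $V\cong V'\oplus V''$ and $\gamma=\left(\begin{smallmatrix}0&0\\0&\gamma'\end{smallmatrix}\right)$ with $0\neq\gamma'\in H^0(X,S^2V''^*\otimes L)$; (2) if a filtration as in (2) of semistability attains equality, then $V\cong V'\oplus V''/V'\oplus V/V''$ and $\gamma=\left(\begin{smallmatrix}0&0&\gamma'^t\\0&\gamma''&0\\ \gamma'&0&0\end{smallmatrix}\right)$ with $\gamma'\in H^0(X,V'^*\otimes (V/V'')^*\otimes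 L)$ and $\gamma''\in H^0(X,S^2(V''/V')^*\otimes L)$, not both zero. It is strictly $\alpha$-polystable if it is $\alpha$-polystable but not $\alpha$-stable. A strictly $\alpha$-polystable $(V,\gamma)$ of type $(n,d)$ is $\alpha$-independently strictly polystable if one of the following occurs: (i) $n,d$ are even and there is a proper subbundle $V'\subsetneq V$ with $\deg(V')=d/2$, $\mathrm{rk}(V')=n/2$ and $\gamma(V')\subseteq V'^\perp\otimes L$ (with the corresponding splitting as in (1)(b) of polystability); (ii) there is a strict filtration $0\subsetneq V'\subsetneq V''\subsetneq V$ with $\mathrm{rk}(V')+\mathrm{rk}(V'')=n$, $\deg(V')+\deg(V'')=d$, $\gamma(V')\subseteq V''^\perp\otimes L$ and $\gamma(V'')\not\subseteq V''^\perp\otimes L$ (with the corresponding splitting as in (2) of polystability). Critical values. A real number $\alpha_c\leq d/n$ is a critical value (for type $(n,d)$) if $\alpha_c=d/n$, or if there exists a strictly $\alpha_c$-polystable $L$-quadric bundle of type $(n,d)$ which is not $\alpha$-independently strictly polystable. *)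

(* Defs.v *)
From HB Require Import structures.
From mathcomp Require Import all_boot all_order all_algebra.
From mathcomp Require Import complex.
From mathcomp Require Import boolp classical_sets functions cardinality fsbigop.
From mathcomp Require Import reals topology normedtype derive.
Import Order.TTheory GRing.Theory Num.Theory numFieldNormedType.Exports.

Set Implicit Arguments.
Unset Strict Implicit.
Unset Printing Implicit Defensive.

Local Open Scope ring_scope.
Local Open Scope classical_set_scope.

(* R[i] seen as an abstract numeric field, so that it receives the topology
   and the normed-module structure of its norm; [derivable f z 1] is then
   complex differentiability. *)
Definition Cx (R : realType) : numClosedFieldType := R[i].

(* [chart_inv i] is only meaningful on the open set [chart i @` chart_dom i].
   Second countability is not required: it is automatic for compact X. *)
Record riemann_surface (R : realType) := RiemannSurface {
  rs_space :> topologicalType;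
  chart_index : Type;
  chart_dom : chart_index -> set rs_space;
  chart : chart_index -> rs_space -> Cx R;
  chart_inv : chart_index -> Cx R -> rs_space;
  rs_hausdorff : hausdorff_space rs_space;
  rs_connected : connected [set: rs_space];
  chart_cover : forall x, exists i, chart_dom i x;
  chart_dom_open : forall i, open (chart_dom i);
  chart_img_open : forall i, open (chart i @` chart_dom i);
  chartK : forall i x, chart_dom i x -> chart_inv i (chart i x) = x;
  chart_continuous : forall i, {within chart_dom i, continuous (chart i)};
  chart_inv_continuous : forall i,
    {within chart i @` chart_dom i, continuous (chart_inv i)};
  chart_holo : forall i j x, chart_dom i x -> chart_dom j x ->
    derivable (chart j \o chart_inv i) (chart i x) 1
}.

Section RiemannSurface.
Context {R : realType} {X : riemann_surface R}.

(* U is meant to be open. *)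
Definition holo_on (U : set X) (f : X -> Cx R) : Prop :=
  forall (i : chart_index X) x, U x -> chart_dom i x ->
    derivable (f \o chart_inv i) (chart i x) 1.

(* f = (z - z(x))^m g on a punctured neighbourhood of x, with g holomorphic
   and g(x) <> 0, for every local coordinate z. *)
Definition has_order (f : X -> Cx R) (x : X) (m : int) : Prop :=
  forall i : chart_index X, chart_dom i x ->
    exists (U : set X) (g : X -> Cx R),
      [/\ open U, U x, holo_on U g, g x != 0 &
          forall y, U y -> chart_dom i y -> y <> x ->
            f y = (chart i y - chart i x) ^ m * g y].

(* The 1-form equal to w_i dz_i on the domain of the chart z_i. *)
Definition holo_form (w : chart_index X -> X -> Cx R) : Prop :=
  (forall i, holo_on (chart_dom i) (w i)) /\
  (forall i j x, chart_dom i x -> chart_dom j x ->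
     w i x = w j x * derive1 (chart j \o chart_inv i) (chart i x)).

End RiemannSurface.

(* dim H^0(X, K) = g: some g holomorphic 1-forms are a basis of the space of
   holomorphic 1-forms. *)
Definition has_genus {R : realType} (X : riemann_surface R) (g : nat) : Prop :=
  exists w : 'I_g -> chart_index X -> X -> Cx R,
    (forall a, holo_form (w a)) /\
    (forall eta, holo_form eta -> exists! c : 'rV[Cx R]_g,
       forall i x, chart_dom i x -> eta i x = \sum_(a < g) c 0 a * w a i x).

(* The holomorphic structure is given by local frames, indexed by
   [triv_index], whose changes of frame are holomorphic. *)
Record vbundle {R : realType} (X : riemann_surface R) := VBundle {
  rk : nat;
  fiber : X -> vectType (Cx R);
  triv_index : Type;
  triv_dom : triv_index -> set X;
  frame : triv_index -> forall x, rk.-tuple (fiber x);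
  triv_cover : forall x, exists j, triv_dom j x;
  triv_dom_open : forall j, open (triv_dom j);
  frame_basis : forall j x, triv_dom j x -> basis_of fullv (frame j x);
  frame_holo : forall j k (a b : 'I_rk),
    holo_on (triv_dom j `&` triv_dom k)
            (fun x => coord (frame k x) b (tnth (frame j x) a))
}.

Section VectorBundles.
Context {R : realType} {X : riemann_surface R}.

Definition holo_section (E : vbundle X) (U : set X)
    (s : forall x, fiber E x) : Prop :=
  forall (k : triv_index E) (b : 'I_(rk E)),
    holo_on (U `&` triv_dom k) (fun x => coord (frame k x) b (s x)).

Definition transition (E : vbundle X) (j k : triv_index E) (x : X) :
    'M[Cx R]_(rk E) :=
  \matrix_(a, b) coord (frame k x) b (tnth (frame j x) a).

(* A section of the line bundle det E is given by its coordinates s_j with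
   respect to e_1 /\ ... /\ e_n, for (e_1, ..., e_n) the j-th frame of E.
   Values at poles are junk
   ([has_order] ignores the value at the centre). *)
Definition det_section (E : vbundle X) (s : triv_index E -> X -> Cx R) : Prop :=
  forall j k x, triv_dom j x -> triv_dom k x ->
    s k x = \det (transition j k x) * s j x.

(* s is a meromorphic section of det E, not identically zero, with
   divisor nu. *)
Definition det_divisor (E : vbundle X) (s : triv_index E -> X -> Cx R)
    (nu : X -> int) : Prop :=
  det_section s /\
  forall x (j : triv_index E), triv_dom j x -> has_order (s j) x (nu x).

(* deg E = k: det E has non-zero meromorphic sections, and the divisor of each
   of them has degree k.  On a compact X the support of nu is finite, so that
   the sum is the actual degree of the divisor. *)
Definition has_degree (E : vbundle X) (k : int) : Prop :=
  (exists (s : triv_index E -> X -> Cx R) nu, det_divisor s nu) /\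
  (forall (s : triv_index E -> X -> Cx R) nu, det_divisor s nu ->
     \sum_(x \in [set: X]) nu x = k).

(* "deg E satisfies P": the degree is a relation here, but every bundle on a
   compact Riemann surface has exactly one. *)
Definition degP (E : vbundle X) (P : R -> Prop) : Prop :=
  exists2 k : int, has_degree E k & P k%:~R.

Definition has_type (V : vbundle X) (n : nat) (d : int) : Prop :=
  rk V = n /\ has_degree V d.

(* A subbundle is an injective morphism of holomorphic vector bundles. *)
Record subbundle (E : vbundle X) := Subbundle {
  sub_bundle :> vbundle X;
  incl : forall x, 'Hom(fiber sub_bundle x, fiber E x);
  incl_holo : forall j (a : 'I_(rk sub_bundle)),
    holo_section (triv_dom j) (fun x => incl x (tnth (frame j x) a));
  incl_inj : forall x, lker (incl x) = 0%VS
}.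

Definition sub_fiber (E : vbundle X) (S : subbundle E) (x : X) :
    {vspace fiber E x} := limg (incl S x).

Definition proper (E : vbundle X) (S : subbundle E) : Prop :=
  (0 < rk S < rk E)%N.

(* An inclusion of subbundles is strict iff the ranks differ. *)
Definition strict_sub (E : vbundle X) (S T : subbundle E) : Prop :=
  (forall x, (sub_fiber S x <= sub_fiber T x)%VS) /\ (rk S < rk T)%N.

Definition strict_filtration (E : vbundle X) (S T : subbundle E) : Prop :=
  [/\ (0 < rk S)%N, strict_sub S T & (rk T < rk E)%N].

(* The form gamma is given as the map V -> V^* (x) L = Hom(V, L). *)
Record quadric_bundle (L : vbundle X) := QuadricBundle {
  qbundle :> vbundle X;
  qform : forall x, 'Hom(fiber qbundle x, 'Hom(fiber qbundle x, fiber L x));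
  qform_sym : forall x u v, qform x u v = qform x v u;
  qform_holo : forall j (a b : 'I_(rk qbundle)),
    holo_section (triv_dom j)
      (fun x => qform x (tnth (frame j x) a)
                        (tnth (frame j x) b));
  qform_neq0 : exists x, qform x != 0
}.

Section Stability.
Variables (L : vbundle X) (V : quadric_bundle L).
Implicit Types S T A B : subbundle V.

(* gamma(S) is contained in T^perp (x) L; the fibre of T^perp (x) L at x
   consists of the linear maps V_x -> L_x that vanish on T_x. *)
Definition in_perp S T : Prop :=
  forall x u v, u \in sub_fiber S x -> v \in sub_fiber T x -> qform V x u v = 0.

Definition in_kernel S : Prop :=
  forall x u, u \in sub_fiber S x -> qform V x u = 0.

Definition is_direct_sum S T : Prop :=
  forall x, (sub_fiber S x + sub_fiber T x = fullv)%VS /\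
            (sub_fiber S x :&: sub_fiber T x = 0)%VS.

(* gamma = ( g 0 ; 0 0 ) in V = S (+) T, with g <> 0 *)
Definition splitting_a S T : Prop :=
  [/\ is_direct_sum S T, in_perp S T, in_perp T T & ~ in_perp S S].

(* gamma = ( 0 g ; g^t 0 ) in V = S (+) T, with g <> 0 *)
Definition splitting_b S T : Prop :=
  [/\ is_direct_sum S T, in_perp S S, in_perp T T & ~ in_perp S T].

(* gamma = ( 0 0 ; 0 g ) in V = S (+) T, with g <> 0 *)
Definition splitting_c S T : Prop :=
  [/\ is_direct_sum S T, in_perp S S, in_perp S T & ~ in_perp T T].

(* V = S (+) A (+) B with T = S (+) A, so that A and B are isomorphic to T/S
   and V/T, and gamma = ( 0 0 g^t ; 0 h 0 ; g 0 0 ) with g, h not both 0. *)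
Definition splitting_filtration S T A B : Prop :=
  [/\ forall x, (sub_fiber S x + sub_fiber A x = sub_fiber T x)%VS /\
                (sub_fiber S x :&: sub_fiber A x = 0)%VS,
      is_direct_sum T B,
      [/\ in_perp S S, in_perp S A, in_perp A B & in_perp B B] &
      ~ (in_perp S B /\ in_perp A A)].

Variables (d : int) (alpha : R).
Let n : R := (rk V)%:R.
Let r S : R := (rk S)%:R.
Let dR : R := d%:~R.

(* The (in)equalities of conditions (1) and (2), d being the degree of V and
   cmp one of <=, <, =. *)
Definition ineq_a (cmp : R -> R -> Prop) S : Prop :=
  degP S (fun e => cmp e (dR + alpha * (r S - n))).
Definition ineq_b (cmp : R -> R -> Prop) S : Prop :=
  degP S (fun e => cmp e (dR / 2 + alpha * (r S - n / 2))).
Definition ineq_c (cmp : R -> R -> Prop) S : Prop :=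
  degP S (fun e => cmp e (alpha * r S)).
Definition ineq_filtration (cmp : R -> R -> Prop) S T : Prop :=
  degP S (fun e => degP T (fun e' =>
    cmp (e + e') (dR + alpha * (r S + r T - n)))).

Definition admissible_filtration S T : Prop :=
  [/\ strict_filtration S T, in_perp S T & ~ in_perp T T].

Definition ineqs (cmp : R -> R -> Prop) : Prop :=
  (forall S, proper S ->
     [/\ ~ in_perp S S -> ineq_a cmp S,
         in_perp S S -> ineq_b cmp S &
         in_kernel S -> ineq_c cmp S]) /\
  (forall S T, admissible_filtration S T -> ineq_filtration cmp S T).

Definition semistable : Prop :=
  alpha <= dR / n /\ ineqs (fun a b => a <= b).

Definition stable : Prop :=
  semistable /\ ineqs (fun a b => a < b).

Definition polystable : Prop :=
  [/\ semistable,
      forall S, proper S ->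
        [/\ ~ in_perp S S -> ineq_a eq S -> exists T, splitting_a S T,
            in_perp S S -> ineq_b eq S -> exists T, splitting_b S T &
            in_kernel S -> ineq_c eq S -> exists T, splitting_c S T] &
      forall S T, admissible_filtration S T -> ineq_filtration eq S T ->
        exists A B, splitting_filtration S T A B].

Definition strictly_polystable : Prop := polystable /\ ~ stable.

(* To be used for strictly polystable V only. *)
Definition independently_polystable : Prop :=
  ([/\ ~~ odd (rk V), (2 %| d)%Z &
       exists S, [/\ proper S, degP S (fun e => e = dR / 2),
                     r S = n / 2, in_perp S S & exists T, splitting_b S T]]) \/
  (exists S T, [/\ admissible_filtration S T, (rk S + rk T)%N = rk V,
                   degP S (fun e => degP T (fun e' => e + e' = dR)) &
                   exists A B, splitting_filtration S T A B]).

End Stability.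

Definition critical_value (L : vbundle X) (n : nat) (d : int) (alpha : R) :
    Prop :=
  alpha <= d%:~R / n%:R /\
  (alpha = d%:~R / n%:R \/
   exists V : quadric_bundle L,
     [/\ has_type V n d, strictly_polystable V d alpha &
         ~ independently_polystable V d]).

End VectorBundles.

(* Main.v *)
(* Suppose alpha_c < d/n is critical, witnessed by (V, gamma), and let r be the
   generic rank of gamma.  If r = n, linear algebra at one point where gamma is
   nondegenerate shows that an equality in (1)(a) or (1)(c) is impossible and
   that an equality in (1)(b) or (2) makes (V, gamma) alpha-independent.
   Hence r < n, and the saturated kernel N of gamma, of rank n - r, satisfies
   deg N <= alpha_c (n - r).  The discriminant of the form induced on V/N is a
   non-zero section of (det V)^-2 (det N)^2 L^r; multiplying it by
   s_V^2 / (s_N^2 s_L^r), for meromorphic sections s_V, s_N, s_L of det V, det N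
   and L, gives a meromorphic function f, and the degrees of the divisors of s_V
   and f s_V agree, so that 2 d - 2 deg N <= r d_L.  The bound follows.

   The existence of N and of orders of vanishing needs that a function which is
   complex differentiable near a point is divisible by z - z0 as soon as it
   vanishes at z0.  This is deduced from a maximum principle, itself a
   consequence of Goursat's lemma for trapezoid sums along squares: these sums
   are additive under subdivision and exact on affine functions, so that no
   integral is needed. *)

Require Import Defs.
From mathcomp Require Import all_boot all_order all_algebra perm complex ring lra zify.
From mathcomp Require Import boolp classical_sets cardinality fsbigop.
From mathcomp Require Import reals topology normedtype derive.
Import Order.TTheory GRing.Theory Num.Theory numFieldNormedType.Exports.
Set Implicit Arguments.
Unset Strict Implicit.
Unset Printing Implicit Defensive.
Local Open Scope ring_scope.
Local Open Scope classical_set_scope.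

(** * Complex-differentiable functions *)

(** The meromorphic sections and the comparison of divisors both come from the notion of degree:
    [has_degree] provides a section of the determinant and gives the same degree to the divisors of
    all of them, which is why f is turned into a second section of det V. The degree of N is
    supplied by the inequality (1)(c), since [degP] asserts that it exists. The obstacle is that the
    rank of gamma may drop at isolated points, where the pointwise kernel is too large. Row
    reduction over germs of holomorphic functions gives, near each point, an invertible holomorphic
    matrix Q whose last n - r rows span the kernel at the other points nearby, and its limit at the
    point itself. The form on V/N is handled through matrices only: with G the Gram matrix of gamma,
    it is the upper left r by r corner of Q G Q^T. With q = n - r, the two bounds give alpha_c q >=
    d - r d_L / 2, and the right side exceeds alpha_m q by (q - 1)(n d_L / 2 - d); this is where d
    <= n d_L / 2 enters. *)

Section ComplexModulus.
Variable R : realType.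
Implicit Types (x y : R) (z w : Cx R).

(** The norm of [Cx R] takes its values in [Cx R]; this is the modulus as an element of [R], where
    [lra] and [nra] apply. *)
Definition cabs z : R := Normc.normc (z : R[i]).
Definition rc x : Cx R := (x%:C)%C.
Definition ci : Cx R := ('i : R[i])%C.

Lemma cabsE z : `|z| = rc (cabs z).
Proof. by []. Qed.
Lemma rc_le x y : (rc x <= rc y) = (x <= y). Proof. exact: lecR. Qed.
Lemma rc_lt x y : (rc x < rc y) = (x < y). Proof. exact: ltcR. Qed.
Lemma rc_inj : injective rc. Proof. by move=> x y []. Qed.
Lemma rc0 : rc 0 = 0. Proof. by []. Qed.
Lemma rcD x y : rc (x + y) = rc x + rc y. Proof. exact: (rmorphD (real_complex R)). Qed.
Lemma rcB x y : rc (x - y) = rc x - rc y. Proof. exact: (rmorphB (real_complex R)). Qed.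
Lemma rcN x : rc (- x) = - rc x. Proof. exact: (rmorphN (real_complex R)). Qed.
Lemma rcM x y : rc (x * y) = rc x * rc y. Proof. exact: (rmorphM (real_complex R)). Qed.
Lemma rcV x : rc (x^-1) = (rc x)^-1. Proof. exact: (fmorphV (real_complex R)). Qed.
Lemma rc_nat n : rc n%:R = n%:R. Proof. exact: (rmorph_nat (real_complex R)). Qed.
Lemma cabs_rc x : cabs (rc x) = `|x|.
Proof. by rewrite /cabs /= expr0n addr0 sqrtr_sqr. Qed.
Lemma cabs_ge0 z : 0 <= cabs z.
Proof. by rewrite -rc_le rc0 -cabsE normr_ge0. Qed.
Lemma cabsM z w : cabs (z * w) = cabs z * cabs w.
Proof. exact: Normc.normcM. Qed.
Lemma cabsD z w : cabs (z + w) <= cabs z + cabs w.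
Proof. by rewrite -rc_le rcD -!cabsE ler_normD. Qed.
Lemma cabsN z : cabs (- z) = cabs z.
Proof. by apply: rc_inj; rewrite -!cabsE normrN. Qed.
Lemma cabsB z w : cabs (z - w) <= cabs z + cabs w.
Proof. by rewrite -(cabsN w) cabsD. Qed.
Lemma cabs_sym z w : cabs (z - w) = cabs (w - z).
Proof. by rewrite -cabsN opprB. Qed.
Lemma cabsV z : cabs z^-1 = (cabs z)^-1.
Proof. exact: Normc.normcV. Qed.
Lemma cabs0 : cabs 0 = 0.
Proof. by apply: rc_inj; rewrite -cabsE normr0. Qed.
Lemma cabs1 : cabs 1 = 1.
Proof. by apply: rc_inj; rewrite -cabsE normr1. Qed.
Lemma cabs_ci : cabs ci = 1.
Proof. by rewrite /cabs /= expr0n expr1n add0r sqrtr1. Qed.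
Lemma cabs_eq0 z : (cabs z == 0) = (z == 0).
Proof. by rewrite -(inj_eq rc_inj) -cabsE normr_eq0. Qed.
Lemma cabs_gt0 z : (0 < cabs z) = (z != 0).
Proof. by rewrite lt_def cabs_eq0 cabs_ge0 andbT. Qed.
Lemma cabsX z n : cabs (z ^+ n) = cabs z ^+ n.
Proof. by elim: n => [|n IH]; rewrite ?expr0 ?cabs1// !exprS cabsM IH. Qed.
Lemma cabs_sum I (r : seq I) (P : pred I) (F : I -> Cx R) :
  cabs (\sum_(i <- r | P i) F i) <= \sum_(i <- r | P i) cabs (F i).
Proof.
elim/big_rec2: _ => [|i y z _ le]; first by rewrite cabs0.
by rewrite (le_trans (cabsD _ _))// lerD2l.
Qed.
Lemma cabs_subD z w v : cabs (z - w) <= cabs (z - v) + cabs (v - w).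
Proof. by rewrite -[X in cabs X](subrKA v) cabsD. Qed.

Definition re z : R := complex.Re (z : R[i]).
Definition im z : R := complex.Im (z : R[i]).
Lemma re_le z : `|re z| <= cabs z.
Proof. by rewrite -rc_le -cabsE; exact: (normc_ge_Re (z : R[i])). Qed.
Lemma imD z w : im (z + w) = im z + im w.
Proof. by case: z w => [a b] [c d]. Qed.
Lemma reB z w : re (z - w) = re z - re w.
Proof. by case: z w => [a b] [c d]. Qed.
Lemma imB z w : im (z - w) = im z - im w.
Proof. by case: z w => [a b] [c d]. Qed.
Lemma im_le z : `|im z| <= cabs z.
Proof.
case: z => a b; rewrite /cabs /im /= -(sqrtr_sqr b) ler_sqrt ?lerDr ?sqr_ge0//.
by rewrite addr_ge0 ?sqr_ge0.
Qed.
Lemma nbhs_cabsP z (P : set (Cx R)) :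
  nbhs z P <-> exists2 d : R, 0 < d & forall w, cabs (w - z) < d -> P w.
Proof.
split=> [/(@nbhs_normP _ _ z P)[e /= e0 eP]|[d d0 dP]].
  have er : rc (re e) = e by apply: RRe_real; exact: gtr0_real.
  exists (re e); first by rewrite -rc_lt er.
  by move=> w wz; apply: eP => /=; rewrite cabsE cabs_sym -er rc_lt.
apply/(@nbhs_normP _ _ z P); exists (rc d) => /=; first by rewrite -rc0 rc_lt.
by move=> w /=; rewrite cabsE rc_lt cabs_sym; exact: dP.
Qed.

Lemma cvg_cabsP (T : Type) (F : set_system T) (f : T -> Cx R) (l : Cx R) :
  Filter F ->
  (f x @[x --> F] --> l) <-> forall e : R, 0 < e -> \forall x \near F, cabs (f x - l) < e.
Proof.
move=> FF; split=> [fl e e0|H].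
  have lB : nbhs l [set y | cabs (y - l) < e] by apply/nbhs_cabsP; exists e.
  exact: (fl _ lB).
by move=> P /nbhs_cabsP[d d0 dP]; apply: filterS (H d d0) => x /dP.
Qed.

End ComplexModulus.

(** * Complex derivatives through slope functions *)

Section ComplexDerivative.
Variable R : realType.
Implicit Types (f g : Cx R -> Cx R) (z w : Cx R).

Lemma cts_cabsP f z : {for z, continuous f} <->
  forall e : R, 0 < e -> \forall w \near z, cabs (f w - f z) < e.
Proof. have := @cvg_cabsP R _ (nbhs z) f (f z) _; exact. Qed.

(** Caratheodory's form of differentiability: phi is the difference quotient, completed at z by the
    derivative. The identity holds for every w, so that products, composites and division by w - z
    become algebra. *)
Lemma derivable_slopeP f z : derivable f z 1 <->
  exists2 phi : Cx R -> Cx R, {for z, continuous phi} &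
    forall w, f w = f z + phi w * (w - z).
Proof.
split=> [/cvg_ex[l fl]|[phi phiz fE]].
  pose phi w := if w == z then l else (f w - f z) / (w - z).
  have phiz : phi z = l by rewrite /phi eqxx.
  exists phi; last first.
    move=> w; rewrite /phi; have [->|wz] := eqVneq w z; first by rewrite subrr mulr0 addr0.
    by rewrite divfK ?subr_eq0// addrC subrK.
  have H := (continuous_withinNshiftx phi z).1; apply: H; rewrite phiz.
  apply: cvg_trans fl; apply: near_eq_cvg.
  near=> h; rewrite /= [h *: _]mulr1 /phi -subr_eq0 addrK.
  have -> : (h == 0) = false by apply/negbTE; near: h; exact: nbhs_dnbhs_neq.
  by rewrite [_ *: _]mulrC.
apply/cvg_ex; exists (phi z).
have := (continuous_withinNshiftx phi z).2 phiz; apply: cvg_trans.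
apply: near_eq_cvg; near=> h; rewrite /= [h *: _]mulr1 fE [_ *: _]mulrC.
rewrite addrAC subrr add0r addrK mulfK//; near: h; exact: nbhs_dnbhs_neq.
Unshelve. all: by end_near.
Qed.

Lemma derivable_cts f z : derivable f z 1 -> {for z, continuous f}.
Proof. by move=> /derivable1_diffP/differentiable_continuous. Qed.

Lemma derivable_near f g z : (\forall w \near z, f w = g w) ->
  derivable f z 1 -> derivable g z 1.
Proof.
move=> fg /cvg_ex[l fl]; apply/cvg_ex; exists l.
apply: cvg_trans fl; apply: near_eq_cvg.
have gz : f z = g z by exact: (nbhs_singleton fg).
move/nbhs_cabsP: fg => [d d0 dfg].
apply: nbhs_dnbhs; apply/nbhs_cabsP; exists d => // h.
rewrite subr0 => hd /=; have h1 : h *: (1 : Cx R) = h by exact: mulr1.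
by rewrite gz h1 dfg// addrK.
Qed.

Lemma derivable_compC f g z : derivable f z 1 -> derivable g (f z) 1 ->
  derivable (g \o f) z 1.
Proof.
move=> fz /derivable_slopeP[psi cpsi gE]; have cf := derivable_cts fz.
move/derivable_slopeP : fz => [phi cphi fE].
apply/derivable_slopeP; exists (fun w => psi (f w) * phi w).
  have cpf : {for z, continuous (psi \o f)} by have := continuous_comp cf cpsi.
  have := continuousM cpf cphi; exact.
move=> w /=; rewrite (gE (f w)) -mulrA; congr (_ + _ * _).
by rewrite (fE w) addrAC subrr add0r.
Qed.

Lemma derivableMC f g z : derivable f z 1 -> derivable g z 1 ->
  derivable (fun w => f w * g w) z 1.
Proof. exact: derivableM. Qed.
Lemma derivableDC f g z : derivable f z 1 -> derivable g z 1 ->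
  derivable (fun w => f w + g w) z 1.
Proof. exact: derivableD. Qed.
Lemma derivableBC f g z : derivable f z 1 -> derivable g z 1 ->
  derivable (fun w => f w - g w) z 1.
Proof. exact: derivableB. Qed.
Lemma derivableNC f z : derivable f z 1 -> derivable (fun w => - f w) z 1.
Proof. exact: derivableN. Qed.
Lemma derivable_cstC (c : Cx R) z : derivable (fun _ => c) z 1.
Proof. exact: (derivable_cst (c : Cx R)). Qed.
Lemma derivable_idC z : derivable (fun w : Cx R => w) z 1.
Proof. exact: derivable_id. Qed.
Lemma derivableXC f n z : derivable f z 1 -> derivable (fun w => f w ^+ n) z 1.
Proof.
move=> fz; elim: n => [|n IH]; first exact: derivable_cstC.
by under [X in derivable X]eq_fun do rewrite exprS; exact: derivableMC.
Qed.
Lemma derivable_prodC (I : Type) (r : seq I) (P : pred I) (F : I -> Cx R -> Cx R) z :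
  (forall i, P i -> derivable (F i) z 1) ->
  derivable (fun w => \prod_(i <- r | P i) F i w) z 1.
Proof.
move=> dF; elim: r => [|i r IH].
  by under [X in derivable X]eq_fun do rewrite big_nil; exact: derivable_cstC.
under [X in derivable X]eq_fun do rewrite big_cons.
case Pi: (P i); last exact: IH.
by apply: derivableMC; [exact: dF|exact: IH].
Qed.
Lemma derivableVC f z : f z != 0 -> derivable f z 1 ->
  derivable (fun w => (f w)^-1) z 1.
Proof. exact: derivableV. Qed.

End ComplexDerivative.

(** * Trapezoid sums along segments and squares *)

Lemma big_ord_mul (V : zmodType) (m n : nat) (F : nat -> V) :
  \sum_(k < m * n) F k = \sum_(j < m) \sum_(i < n) F (j * n + i)%N.
Proof.
elim: m => [|m IH]; first by rewrite !big_ord0.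
rewrite big_ord_recr/= -IH mulSnr.
rewrite -(big_mkord xpredT F) -(big_mkord xpredT F) -(big_mkord xpredT (fun i => F (m * n + i)%N)).
rewrite (big_cat_nat (n := (m * n)%N)) ?leq_addr//=; congr (_ + _).
by rewrite -{1}[(m * n)%N]add0n big_addn addKn; apply: eq_bigr => i _; rewrite addnC.
Qed.

Section Trapezoid.
Variable R : realType.
Implicit Types (f g : Cx R -> Cx R) (p v c z : Cx R) (s : R).

(** Trapezoid sum with n equal steps for the integral of f dz along the segment from p to p + v. *)
Definition seg n f p v : Cx R :=
  \sum_(k < n) (f (p + v * (k%:R / n%:R)) + f (p + v * (k.+1%:R / n%:R))) / 2
               * (v / n%:R).

Lemma seg_mul m n f p v : (0 < m)%N -> (0 < n)%N ->
  seg (m * n) f p v = \sum_(j < m) seg n f (p + v * (j%:R / m%:R)) (v / m%:R).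
Proof.
move=> m0 n0.
have m1 : m%:R != 0 :> Cx R by rewrite pnatr_eq0 -lt0n.
have n1 : n%:R != 0 :> Cx R by rewrite pnatr_eq0 -lt0n.
rewrite /seg (big_ord_mul m n (fun k => (f (p + v * (k%:R / (m * n)%:R)) +
  f (p + v * (k.+1%:R / (m * n)%:R))) / 2 * (v / (m * n)%:R))).
apply: eq_bigr => j _; apply: eq_bigr => i _; rewrite natrM.
congr ((f _ + f _) / _ * _).
- by rewrite natrD natrM; field; rewrite m1 n1.
- by rewrite -addnS natrD natrM; field; rewrite m1 n1.
- by field; rewrite m1 n1.
Qed.

Lemma segB n f g p v : seg n (fun z => f z - g z) p v = seg n f p v - seg n g p v.
Proof. by rewrite -sumrB; apply: eq_bigr => k _; ring. Qed.

Lemma segZ n (a : Cx R) f p v : seg n (fun z => a * f z) p v = a * seg n f p v.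
Proof. by rewrite /seg mulr_sumr; apply: eq_bigr => k _; ring. Qed.

(** On an affine function each trapezoid is exactly the increment of the primitive a z + b z^2 / 2,
    and the increments telescope. *)
Lemma seg_affine n (a b : Cx R) p v : (0 < n)%N ->
  seg n (fun z => a + b * z) p v = (a * (p + v) + b * (p + v) ^+ 2 / 2) - (a * p + b * p ^+ 2 / 2).
Proof.
move=> n0; have n1 : n%:R != 0 :> Cx R by rewrite pnatr_eq0 -lt0n.
pose G (k : nat) := a * (p + v * (k%:R / n%:R)) + b * (p + v * (k%:R / n%:R)) ^+ 2 / 2.
have -> : seg n (fun z => a + b * z) p v = \sum_(0 <= k < n) (G k.+1 - G k).
  rewrite big_mkord; apply: eq_bigr => k _; rewrite /G -natr1.
  by field.
rewrite telescope_sumr// /G divff// mulr1 mul0r mulr0 addr0.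
by [].
Qed.

Lemma seg_bound n f p v (M : R) : (0 < n)%N ->
  (forall t, 0 <= t <= 1 -> cabs (f (p + v * rc t)) <= M) ->
  cabs (seg n f p v) <= M * cabs v.
Proof.
move=> n0 fM; have n1 : n%:R != 0 :> R by rewrite pnatr_eq0 -lt0n.
have nodeM k : (k <= n)%N -> cabs (f (p + v * (k%:R / n%:R))) <= M.
  move=> kn; rewrite -!rc_nat -rcV -rcM; apply: fM.
  by rewrite divr_ge0//= ler_pdivrMr ?ltr0n// mul1r ler_nat.
apply: (le_trans (cabs_sum _ _ _)).
have -> : M * cabs v = \sum_(k < n) M * (cabs v / n%:R).
  by rewrite sumr_const card_ord -mulr_natr; field.
apply: ler_sum => k _; rewrite !cabsM !cabsV -!rc_nat !cabs_rc.
rewrite !ger0_norm ?ler0n//.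
apply: ler_wpM2r; first by rewrite divr_ge0 ?cabs_ge0.
rewrite ler_pdivrMr// (le_trans (cabsD _ _))//.
have := nodeM k (ltnW (ltn_ord k)); have := nodeM k.+1 (ltn_ord k).
by rewrite -!rc_nat; lra.
Qed.

Lemma seg_im n f p v (m : R) : (0 < n)%N ->
  (forall t, 0 <= t <= 1 -> m <= im (v * f (p + v * rc t))) ->
  m <= im (seg n f p v).
Proof.
move=> n0 fm; have n1 : n%:R != 0 :> R by rewrite pnatr_eq0 -lt0n.
have nodem k : (k <= n)%N -> m <= im (v * f (p + v * (k%:R / n%:R))).
  move=> kn; rewrite -!rc_nat -rcV -rcM; apply: fm.
  by rewrite divr_ge0//= ler_pdivrMr ?ltr0n// mul1r ler_nat.
have im_sum (F : nat -> Cx R) : im (\sum_(k < n) F k) = \sum_(k < n) im (F k).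
  by apply: (big_morph (@im R) (@imD R)).
rewrite [seg _ _ _ _](_ : _ = \sum_(k < n)
    (v * f (p + v * (k%:R / n%:R)) + v * f (p + v * (k.+1%:R / n%:R))) * rc ((2 * n%:R)^-1)).
  rewrite (im_sum (fun k => (v * f (p + v * (k%:R / n%:R)) + v * f (p + v * (k.+1%:R / n%:R))) * rc ((2 * n%:R)^-1))).
  have -> : m = \sum_(k < n) (2 * m) * (2 * n%:R)^-1.
    by rewrite sumr_const card_ord -mulr_natr; field.
  apply: ler_sum => k _.
  have imM (w : Cx R) (x : R) : im (w * rc x) = im w * x.
    by case: w => a b; rewrite /im /= mulr0 add0r.
  rewrite imM; apply: ler_wpM2r; first by rewrite invr_ge0 mulr_ge0.
  have := nodem k (ltnW (ltn_ord k)); have := nodem k.+1 (ltn_ord k).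
  by rewrite imD; lra.
apply: eq_bigr => k _; rewrite rcV rcM !rc_nat.
have n2 : n%:R != 0 :> Cx R by rewrite pnatr_eq0 -lt0n.
by field.
Qed.

(** The sum along the counterclockwise boundary of the square with lower left corner c and side s,
    with n steps on each side. *)
Definition sq n f c s : Cx R :=
  seg n f c (rc s) + seg n f (c + rc s) (ci R * rc s)
  - seg n f (c + ci R * rc s) (rc s) - seg n f c (ci R * rc s).

Lemma sqB n f g c s : sq n (fun z => f z - g z) c s = sq n f c s - sq n g c s.
Proof. by rewrite /sq !segB; ring. Qed.

Lemma sqZ n (a : Cx R) f c s : sq n (fun z => a * f z) c s = a * sq n f c s.
Proof. by rewrite /sq !segZ; ring. Qed.

Lemma sq_affine n (a b : Cx R) c s : (0 < n)%N ->
  sq n (fun z => a + b * z) c s = 0.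
Proof. by move=> n0; rewrite /sq !seg_affine//; field. Qed.

(** Both sides use the same nodes on the boundary, so the identity is exact. [H i j] and [V i j] are
    the lower and the left side of the subsquare at [C i j]; sides shared by two subsquares cancel
    by telescoping. *)
Lemma sq_mul m n f c s : (0 < m)%N -> (0 < n)%N ->
  sq (m * n) f c s = \sum_(i < m) \sum_(j < m)
    sq n f (c + rc s * (i%:R / m%:R) + ci R * rc s * (j%:R / m%:R)) (s / m%:R).
Proof.
move=> m0 n0.
have m1 : m%:R != 0 :> Cx R by rewrite pnatr_eq0 -lt0n.
pose C i j : Cx R := c + rc s * (i%:R / m%:R) + ci R * rc s * (j%:R / m%:R).
pose H i j := seg n f (C i j) (rc (s / m%:R)).
pose V i j := seg n f (C i j) (ci R * rc (s / m%:R)).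
have -> : \sum_(i < m) \sum_(j < m) sq n f (C i j) (s / m%:R) =
    \sum_(i < m) \sum_(0 <= j < m) - (H i j.+1 - H i j) +
    \sum_(j < m) \sum_(0 <= i < m) (V i.+1 j - V i j).
  rewrite [X in _ = _ + X](eq_bigr (fun j : 'I_m => \sum_(i < m) (V i.+1 j - V i j))); last first.
    by move=> j _; rewrite big_mkord.
  rewrite [X in _ = _ + X]exchange_big/= -big_split/=; apply: eq_bigr => i _.
  rewrite big_mkord -big_split/=; apply: eq_bigr => j _.
  rewrite /sq -/(H i j) -/(V i j).
  rewrite (_ : C i j + rc (s / m%:R) = C i.+1 j); last first.
    by rewrite /C rcM rcV rc_nat -natr1; field.
  rewrite (_ : C i j + ci R * rc (s / m%:R) = C i j.+1); last first.
    by rewrite /C rcM rcV rc_nat -(natr1 j); field.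
  rewrite -/(V i.+1 j) -/(H i j.+1); ring.
rewrite (eq_bigr (fun i : 'I_m => H i 0%N - H i m)); last first.
  by move=> i _; rewrite sumrN telescope_sumr// opprB.
rewrite [X in _ + X](eq_bigr (fun j : 'I_m => V m j - V 0%N j)); last first.
  by move=> i _; rewrite telescope_sumr.
rewrite !sumrB /sq !seg_mul//.
have HE j : \sum_(i < m) H i j = \sum_(i < m)
    seg n f (c + ci R * rc s * (j%:R / m%:R) + rc s * (i%:R / m%:R)) (rc s / m%:R).
  by apply: eq_bigr => i _; rewrite /H /C rcM rcV rc_nat addrAC.
have VE i : \sum_(j < m) V i j = \sum_(j < m)
    seg n f (c + rc s * (i%:R / m%:R) + ci R * rc s * (j%:R / m%:R)) (ci R * rc s / m%:R).
  by apply: eq_bigr => j _; rewrite /V /C rcM rcV rc_nat mulrA.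
have mm : m%:R / m%:R = 1 :> Cx R by rewrite divff.
rewrite !HE !VE mm !mul0r !mulr0 !mulr1 !addr0; ring.
Qed.

Definition bdry c s z := exists x y, [/\ 0 <= x <= s, 0 <= y <= s,
  z = c + rc x + ci R * rc y & [\/ x = 0, x = s, y = 0 | y = s]].

Lemma sq_bound n f c s (M : R) : (0 < n)%N -> 0 <= s ->
  (forall z, bdry c s z -> cabs (f z) <= M) ->
  cabs (sq n f c s) <= 4 * M * s.
Proof.
move=> n0 s0 fM.
have H (t : R) : 0 <= t <= 1 -> 0 <= s * t <= s.
  by move=> /andP[t0 t1]; rewrite mulr_ge0//= ler_piMr.
have S0 : 0 <= s <= s by rewrite s0 lexx.
have Z0 : (0:R) <= 0 <= s by rewrite s0 lexx.
have B1 : cabs (seg n f c (rc s)) <= M * cabs (rc s).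
  apply: seg_bound => // t /H ts; apply: fM; exists (s * t), 0; split => //.
  - by rewrite rcM rc0 mulr0 addr0.
  - by apply: Or43.
have B2 : cabs (seg n f (c + rc s) (ci R * rc s)) <= M * cabs (ci R * rc s).
  apply: seg_bound => // t /H ts; apply: fM; exists s, (s * t); split => //.
  - by rewrite rcM mulrA.
  - by apply: Or42.
have B3 : cabs (seg n f (c + ci R * rc s) (rc s)) <= M * cabs (rc s).
  apply: seg_bound => // t /H ts; apply: fM; exists (s * t), s; split => //.
  - by rewrite rcM addrAC.
  - by apply: Or44.
have B4 : cabs (seg n f c (ci R * rc s)) <= M * cabs (ci R * rc s).
  apply: seg_bound => // t /H ts; apply: fM; exists 0, (s * t); split => //.
  - by rewrite rcM rc0 addr0 mulrA.
  - by apply: Or41.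
rewrite cabsM cabs_ci mul1r in B2 B4; rewrite cabs_rc ger0_norm// in B1 B2 B3 B4.
rewrite /sq; set z1 := seg n f c (rc s) in B1 *; set z2 := seg n f (c + rc s) _ in B2 *.
set z3 := seg n f (c + _) (rc s) in B3 *; set z4 := seg n f c (_ * _) in B4 *.
have := cabsB (z1 + z2 - z3) z4; have := cabsB (z1 + z2) z3; have := cabsD z1 z2.
lra.
Qed.

End Trapezoid.

(** * Goursat and the maximum principle *)

Section Goursat.
Variable R : realType.
Implicit Types (f g : Cx R -> Cx R) (p v c z : Cx R) (s x y : R).

Lemma nested_intervals (a b : nat -> R) :
  (forall k, a k <= a k.+1) -> (forall k, b k.+1 <= b k) -> (forall k, a k <= b k) ->
  exists x, forall k, a k <= x <= b k.
Proof.
move=> a_inc b_dec ab.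
have aD k j : a k <= a (k + j)%N.
  by elim: j => [|j IH]; rewrite ?addn0// addnS (le_trans IH).
have bD k j : b (k + j)%N <= b k.
  by elim: j => [|j IH]; rewrite ?addn0// addnS (le_trans _ IH).
have aub k j : a k <= b j.
  by rewrite (le_trans (aD k j))// (le_trans (ab _))// addnC bD.
pose E := range a.
exists (sup E) => k; apply/andP; split.
  by apply: ub_le_sup; [exists (b 0%N) => _ [j _ <-]|exists k].
by apply: ge_sup; [exists (a 0%N), 0%N|move=> _ [j _ <-]].
Qed.

(** Failure of P passes to one of the nine subsquares, and the nested squares shrink to (X, Y).
    Squares are cut in three, not in two, throughout, so that the centre of a square is interior to
    a subsquare, as [sq_small_center] requires. *)
Lemma square_subdivision (P : R -> R -> R -> Prop) x0 y0 s0 : 0 < s0 ->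
  (forall x y s, 0 < s -> (forall i j, (i < 3)%N -> (j < 3)%N ->
     P (x + i%:R * (s / 3)) (y + j%:R * (s / 3)) (s / 3)) -> P x y s) ->
  ~ P x0 y0 s0 ->
  exists X Y, [/\ x0 <= X <= x0 + s0, y0 <= Y <= y0 + s0 & forall k, exists x y,
    let s := s0 / 3 ^+ k in
    [/\ x0 <= x /\ x + s <= x0 + s0, y0 <= y /\ y + s <= y0 + s0,
        x <= X <= x + s, y <= Y <= y + s & ~ P x y s]].
Proof.
move=> s0_gt0 Psub nP.
have step (q : R * R * R) : exists q' : R * R * R,
    (0 < q.2 -> ~ P q.1.1 q.1.2 q.2 -> [/\ q'.2 = q.2 / 3, ~ P q'.1.1 q'.1.2 q'.2,
      q.1.1 <= q'.1.1 /\ q'.1.1 + q'.2 <= q.1.1 + q.2 &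
      q.1.2 <= q'.1.2 /\ q'.1.2 + q'.2 <= q.1.2 + q.2]).
  case: q => [[x y] s] /=; have [[s_gt0 nPq]|] := pselect (0 < s /\ ~ P x y s); last first.
    (* [choice] needs a total step; on a triple that is not a bad square its value is arbitrary. *)
    by move=> H; exists (0, 0, 0) => a b; exfalso; apply: H.
  apply: contrapT => /forallNP H; apply: nPq; apply: Psub => // i j i3 j3.
  apply: contrapT => nPij; apply: (H (x + i%:R * (s / 3), y + j%:R * (s / 3), s / 3)) => /= _ _.
  have b (k : nat) : (k < 3)%N -> 0 <= k%:R * (s / 3) /\ k%:R * (s / 3) + s / 3 <= s.
    move=> k3; have : (k.+1%:R : R) <= 3 by rewrite ler_nat.
    have : 0 <= (k%:R : R) by []; rewrite -natr1; nra.
  by have := b _ i3; have := b _ j3; split=> //; lra.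
have [nxt nxtP] := choice step.
pose u k := iter k nxt (x0, y0, s0).
have uP k : (u k).2 = s0 / 3 ^+ k /\ ~ P (u k).1.1 (u k).1.2 (u k).2.
  elim: k => [|k [IH1 IH2]]; first by rewrite expr0 divr1.
  have [] := nxtP (u k) _ IH2; first by rewrite IH1 divr_gt0 ?exprn_gt0.
  by move=> e1 e2 _ _; split; [rewrite exprSr invfM mulrA -IH1; exact: e1|exact: e2].
have u2_gt0 k : 0 < (u k).2 by rewrite (uP k).1 divr_gt0 ?exprn_gt0.
have uS k : [/\ (u k).1.1 <= (u k.+1).1.1, (u k.+1).1.1 + (u k.+1).2 <= (u k).1.1 + (u k).2,
    (u k).1.2 <= (u k.+1).1.2 & (u k.+1).1.2 + (u k.+1).2 <= (u k).1.2 + (u k).2].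
  by have [_ _ [? ?] [? ?]] := nxtP (u k) (u2_gt0 k) (uP k).2.
have [|||X XP] := @nested_intervals (fun k => (u k).1.1) (fun k => (u k).1.1 + (u k).2).
- by move=> k; have [] := uS k.
- by move=> k; have [] := uS k.
- by move=> k; rewrite lerDl ltW.
have [|||Y YP] := @nested_intervals (fun k => (u k).1.2) (fun k => (u k).1.2 + (u k).2).
- by move=> k; have [] := uS k.
- by move=> k; have [] := uS k.
- by move=> k; rewrite lerDl ltW.
have inQ k : [/\ x0 <= (u k).1.1, (u k).1.1 + (u k).2 <= x0 + s0,
    y0 <= (u k).1.2 & (u k).1.2 + (u k).2 <= y0 + s0].
  elim: k => [|k [? ? ? ?]]; first by rewrite /= !lexx.
  by have [? ? ? ?] := uS k; split; lra.
exists X, Y; split; [exact: (XP 0%N)|exact: (YP 0%N)|move=> k].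
exists (u k).1.1, (u k).1.2; rewrite /= -(uP k).1; have [? ? ? ?] := inQ k.
by split=> //; exact: (uP k).2.
Qed.

Definition pt x y : Cx R := rc x + ci R * rc y.

Lemma ptE z : z = pt (re z) (im z).
Proof. exact: (complexE (z : R[i])). Qed.

Lemma cabs_pt_le x y x' y' : cabs (pt x y - pt x' y') <= `|x - x'| + `|y - y'|.
Proof.
have -> : pt x y - pt x' y' = rc (x - x') + ci R * rc (y - y').
  by rewrite /pt !rcB; ring.
by apply: (le_trans (cabsD _ _)); rewrite cabsM cabs_ci mul1r !cabs_rc.
Qed.

Lemma pow3_small (s d : R) : 0 < d -> exists k : nat, s / 3 ^+ k < d.
Proof.
move=> d0; have [k sk] : exists k : nat, s / d < k%:R.
  by exists (Num.bound `|s / d|); exact: (le_lt_trans (ler_norm _) (archi_boundP (normr_ge0 _))).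
exists k; have k3 : (k%:R : R) < 3 ^+ k by rewrite -natrX ltr_nat ltn_expl.
rewrite ltr_pdivrMr ?exprn_gt0// mulrC -ltr_pdivrMr//.
exact: lt_trans k3.
Qed.

(** Compactness of the square, by subdivision: the sum of bounds on the nine subsquares bounds f on
    the whole. *)
Lemma loc_bounded_square f x0 y0 s0 : 0 < s0 ->
  (forall x y, x0 <= x <= x0 + s0 -> y0 <= y <= y0 + s0 ->
     exists B : R, \forall z \near pt x y, cabs (f z) <= B) ->
  exists B : R, forall x y, x0 <= x <= x0 + s0 -> y0 <= y <= y0 + s0 ->
     cabs (f (pt x y)) <= B.
Proof.
move=> s0_gt0 locb; apply: contrapT => nB.
have [|X [Y [XI YI XY]]] := square_subdivision
  (P := fun x1 y1 s => exists B : R, forall x y, x1 <= x <= x1 + s ->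
     y1 <= y <= y1 + s -> cabs (f (pt x y)) <= B) s0_gt0 _ nB.
  move=> x1 y1 s s_gt0 IH.
  have {IH} [B BP] : exists B : 'I_3 -> 'I_3 -> R, forall (i j : 'I_3) x y,
      x1 + i%:R * (s / 3) <= x <= x1 + i%:R * (s / 3) + s / 3 ->
      y1 + j%:R * (s / 3) <= y <= y1 + j%:R * (s / 3) + s / 3 ->
      cabs (f (pt x y)) <= B i j.
    have [B BP] := choice (fun p : 'I_3 * 'I_3 =>
      IH p.1 p.2 (ltn_ord p.1) (ltn_ord p.2)).
    by exists (fun i j => B (i, j)) => i j; exact: (BP (i, j)).
  exists (\sum_i \sum_j `|B i j|) => x y xI yI.
  have third (t1 t : R) : t1 <= t <= t1 + s -> exists i : 'I_3,
      t1 + i%:R * (s / 3) <= t <= t1 + i%:R * (s / 3) + s / 3.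
    move=> tI; have [t1s|t1s] := ltP t (t1 + s / 3).
      by exists (@Ordinal 3 0 isT); rewrite /=; lra.
    have [t2s|t2s] := ltP t (t1 + 2 * s / 3).
      by exists (@Ordinal 3 1 isT); rewrite /=; lra.
    by exists (@Ordinal 3 2 isT); rewrite /=; lra.
  have [i iP] := third _ _ xI; have [j jP] := third _ _ yI.
  apply: (le_trans (BP i j x y iP jP)); apply: (le_trans (ler_norm _)).
  rewrite (bigD1 i)//= (bigD1 j)//= -addrA lerDl addr_ge0// ?sumr_ge0// => *.
  exact: sumr_ge0.
have [B /nbhs_cabsP[d d0 dB]] := locb X Y XI YI.
have [k sk] := pow3_small s0 (divr_gt0 d0 (ltr0n R 3)).
have [x1 [y1 [_ _ x1I y1I]]] := XY k; apply; exists B => x y xI yI.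
apply: dB; apply: (le_lt_trans (cabs_pt_le _ _ _ _)).
set s := s0 / 3 ^+ k in sk x1I y1I xI yI.
have : `|x - X| <= s by rewrite ler_norml; lra.
have : `|y - Y| <= s by rewrite ler_norml; lra.
lra.
Qed.

(** Stands for: the boundary integral of f has modulus at most e. The numbers of steps are powers of
    3, so that cutting a square in thirds only lowers the exponent by 1. *)
Definition sq_small f c s (e : R) := exists N0, forall N, (N0 <= N)%N ->
  cabs (sq (3 ^ N) f c s) <= e.

Lemma sq_small_split f c s (E : 'I_3 -> 'I_3 -> R) :
  (forall i j : 'I_3, sq_small f (c + rc (i%:R * (s / 3)) + ci R * rc (j%:R * (s / 3))) (s / 3) (E i j)) ->
  sq_small f c s (\sum_i \sum_j E i j).
Proof.
move=> H; have [N NP] := choice (fun p : 'I_3 * 'I_3 => H p.1 p.2).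
(* The successor pays for the factor 3 spent on the subdivision. *)
exists (\max_p N p).+1 => -[//|M]; rewrite ltnS => NM.
rewrite expnS sq_mul ?expn_gt0//; apply: (le_trans (cabs_sum _ _ _)).
apply: ler_sum => i _; apply: (le_trans (cabs_sum _ _ _)); apply: ler_sum => j _.
have -> : c + rc s * (i%:R / 3%:R) + ci R * rc s * (j%:R / 3%:R) =
   c + rc (i%:R * (s / 3)) + ci R * rc (j%:R * (s / 3)).
  by rewrite !rcM !rcV !rc_nat; field.
by apply: (NP (i, j)); apply: leq_trans NM; exact: leq_bigmax.
Qed.

Lemma bdry_pt x y s z : bdry (pt x y) s z -> exists x' y',
  [/\ x <= x' <= x + s, y <= y' <= y + s & z = pt x' y'].
Proof.
move=> [a [b [aI bI -> _]]]; exists (x + a), (y + b); split; [lra|lra|].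
by rewrite /pt !rcD; ring.
Qed.

(** The bound is proportional to the area, hence additive over the nine subsquares. Near the limit
    point f differs from an affine function, whose sums vanish, by o(s) on a square of side s. *)
Theorem goursat f x0 y0 s0 (e : R) : 0 < s0 -> 0 < e ->
  (forall x y, x0 <= x <= x0 + s0 -> y0 <= y <= y0 + s0 -> derivable f (pt x y) 1) ->
  sq_small f (pt x0 y0) s0 (e * s0 ^+ 2).
Proof.
move=> s0_gt0 e0 df; apply: contrapT => nS.
have [|X [Y [XI YI XY]]] := square_subdivision
  (P := fun x y s => sq_small f (pt x y) s (e * s ^+ 2)) s0_gt0 _ nS.
  move=> x y s s_gt0 IH.
  have -> : e * s ^+ 2 = \sum_(i < 3) \sum_(j < 3) e * (s / 3) ^+ 2.
    by rewrite !sumr_const !card_ord; field.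
  apply: (sq_small_split (E := fun _ _ => e * (s / 3) ^+ 2)) => i j; have := IH i j (ltn_ord i) (ltn_ord j).
  set q := (X in _ -> sq_small f X _ _); rewrite (_ : q = pt (x + i%:R * (s / 3)) (y + j%:R * (s / 3)))//.
  by rewrite /q /pt !rcD; ring.
have /derivable_slopeP[phi phic fE] := df X Y XI YI.
set Z := pt X Y in phic fE.
(* Points of the square are within 2 s of Z, so the bound e / 8 becomes 4 (e / 8) (2 s) s = e s^2 in
   [sq_bound]. *)
have /nbhs_cabsP[d d0 dphi] : \forall w \near Z, cabs (phi w - phi Z) < e / 8.
  by have /cts_cabsP := phic; apply; lra.
have [k sk] := pow3_small s0 (divr_gt0 d0 (ltr0n R 3)).
have [x1 [y1 [_ _ x1I y1I]]] := XY k; apply; set s := s0 / 3 ^+ k in sk x1I y1I *.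
have s_gt0 : 0 < s by rewrite divr_gt0 ?exprn_gt0.
exists 0%N => N _; have N0 : (0 < 3 ^ N)%N by rewrite expn_gt0.
rewrite -[sq _ _ _ _]subr0 -(sq_affine (f Z - phi Z * Z) (phi Z) (pt x1 y1) s N0) -sqB.
have -> : e * s ^+ 2 = 4 * (e / 8 * (2 * s)) * s by field.
apply: sq_bound => //; first exact: ltW.
move=> z /bdry_pt[x [y [xI yI ->]]].
have zZ : cabs (pt x y - Z) <= 2 * s.
  apply: (le_trans (cabs_pt_le _ _ _ _)).
  have : `|x - X| <= s by rewrite ler_norml; lra.
  have : `|y - Y| <= s by rewrite ler_norml; lra.
  lra.
have -> : f (pt x y) - (f Z - phi Z * Z + phi Z * pt x y) =
  (phi (pt x y) - phi Z) * (pt x y - Z) by rewrite (fE (pt x y)); ring.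
rewrite cabsM; apply: ler_pM; rewrite ?cabs_ge0//.
by apply: ltW; apply: dphi; lra.
Qed.

End Goursat.

(** * A Cauchy estimate at the centre of a square *)

Section CauchyEstimate.
Variable R : realType.
Implicit Types (f g u : Cx R -> Cx R) (z w : Cx R) (a s x y X Y : R).

Lemma im_rc_div s x y : im (rc s * (pt x y)^-1) = - (s * y / (x ^+ 2 + y ^+ 2)).
Proof.
have -> : pt x y = (x +i* y)%C.
  by rewrite /pt /rc /ci; apply/eqP; rewrite eq_complex /=; apply/andP; split; apply/eqP; ring.
by rewrite /im /rc /=; ring.
Qed.

Lemma im_ci_div s x y : im (ci R * rc s * (pt x y)^-1) = s * x / (x ^+ 2 + y ^+ 2).
Proof.
have -> : pt x y = (x +i* y)%C.
  by rewrite /pt /rc /ci; apply/eqP; rewrite eq_complex /=; apply/andP; split; apply/eqP; ring.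
by rewrite /im /rc /=; ring.
Qed.

(* Crude form of the fact that the integral of dz / (z - z0) is 2 i pi: each side
   contributes at least 1 to the imaginary part. *)
Lemma winding_bound n X Y a : (0 < n)%N -> 0 < a ->
  4 <= cabs (sq n (fun z => (z - pt X Y)^-1) (pt (X - a) (Y - a)) (2 * a)).
Proof.
move=> n0 a0; apply: le_trans (le_trans (ler_norm _) (im_le _)).
set h := fun z => _; set c := pt _ _; set s := 2 * a.
have key t : 0 <= t <= 1 ->
    1 <= s * a / ((- a + s * t) ^+ 2 + a ^+ 2) /\ 1 <= s * a / (a ^+ 2 + (- a + s * t) ^+ 2).
  move=> tI; rewrite [a ^+ 2 + _]addrC.
  have D0 : 0 < (- a + s * t) ^+ 2 + a ^+ 2 by rewrite ltr_wpDl ?sqr_ge0 ?exprn_gt0.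
  suff : 1 <= s * a / ((- a + s * t) ^+ 2 + a ^+ 2) by [].
  have : 0 <= a ^+ 2 * (t * (1 - t)).
    by case/andP: tI => t0 t1; rewrite mulr_ge0 ?sqr_ge0// mulr_ge0// subr_ge0.
  by rewrite ler_pdivlMr// mul1r /s; lra.
have hE p x y : p - pt X Y = pt x y -> h p = (pt x y)^-1 by rewrite /h => ->.
have e1 : 1 <= im (seg n h c (rc s)).
  apply: seg_im => // t tI.
  rewrite (hE _ (- a + s * t) (- a)); last by rewrite /c /pt !rcD !rcN !rcM; ring.
  by rewrite im_rc_div sqrrN mulrN mulNr opprK; exact: (key t tI).1.
have e2 : 1 <= im (seg n h (c + rc s) (ci R * rc s)).
  apply: seg_im => // t tI.
  rewrite (hE _ a (- a + s * t)); last by rewrite /c /pt /s !rcD !rcN !rcM !rc_nat; ring.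
  by rewrite im_ci_div; exact: (key t tI).2.
have e3 : 1 <= im (seg n (fun z => -1 * h z) (c + ci R * rc s) (rc s)).
  apply: seg_im => // t tI.
  rewrite (hE _ (- a + s * t) a); last by rewrite /c /pt /s !rcD !rcN !rcM !rc_nat; ring.
  rewrite mulrA mulrN1 -rcN im_rc_div mulNr mulNr opprK; exact: (key t tI).1.
have e4 : 1 <= im (seg n (fun z => -1 * h z) c (ci R * rc s)).
  apply: seg_im => // t tI.
  rewrite (hE _ (- a) (- a + s * t)); last by rewrite /c /pt /s !rcD !rcN !rcM !rc_nat; ring.
  rewrite mulrA mulrN1 -mulrN -rcN im_ci_div mulrNN sqrrN; exact: (key t tI).2.
have imN (w : Cx R) : im (- w) = - im w by case: w.
rewrite segZ mulN1r imN in e3; rewrite segZ mulN1r imN in e4.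
rewrite /sq; move: (seg n h c (rc s)) (seg n h (c + rc s) _) (seg n h (c + _) (rc s)) (seg n h c (_ * _)) e1 e2 e3 e4.
by move=> z1 z2 z3 z4 e1 e2 e3 e4; rewrite !imD !imN; lra.
Qed.

(** Passes from a small square to a large one with the same centre, where g may fail to be
    derivable: by [goursat] the region between them contributes at most eta. *)
Lemma sq_small_center g X Y a (e eta : R) k : 0 < a -> 0 < eta ->
  (forall x y, `|x - X| <= a -> `|y - Y| <= a -> (x, y) != (X, Y) ->
    derivable g (pt x y) 1) ->
  sq_small g (pt (X - a / 3 ^+ k) (Y - a / 3 ^+ k)) (2 * (a / 3 ^+ k)) e ->
  sq_small g (pt (X - a) (Y - a)) (2 * a) (e + eta).
Proof.
elim: k a eta => [|k IH] a eta a0 eta0 dg.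
  rewrite expr0 divr1 => -[N NP]; exists N => M /NP le.
  by apply: (le_trans le); lra.
move=> small_k.
have small1 : sq_small g (pt (X - a / 3) (Y - a / 3)) (2 * (a / 3)) (e + eta / 2).
  apply: IH; [lra|lra| |].
    move=> x y xX yY; apply: dg; lra.
  suff -> : a / 3 / 3 ^+ k = a / 3 ^+ k.+1 by [].
  by rewrite exprS invfM mulrA.
(* The middle subsquare gets e + eta / 2 by induction and each of the eight others eta / 16: in all
   e + eta. *)
pose E (i j : 'I_3) := if (i == 1%N :> nat) && (j == 1%N :> nat) then e + eta / 2 else eta / 16.
have -> : e + eta = \sum_i \sum_j E i j.
  rewrite !big_ord_recl !big_ord0 /E /=; lra.
apply: sq_small_split => i j.
set c := (X in sq_small _ X _ _).
have cE : c = pt (X - a + i%:R * (2 * a / 3)) (Y - a + j%:R * (2 * a / 3)).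
  by rewrite /c /pt !rcD; ring.
rewrite /E; case: ifPn => [/andP[/eqP i1 /eqP j1]|ij].
  rewrite cE i1 j1 (_ : X - a + 1 * _ = X - a / 3); last by lra.
  by rewrite (_ : Y - a + 1 * _ = Y - a / 3); [rewrite -mulrA|lra].
have q0 : 0 < 2 * a / 3 by lra.
have -> : eta / 16 = (eta / 16 / (2 * a / 3) ^+ 2) * (2 * a / 3) ^+ 2.
  by rewrite divfK// sqrf_eq0 gt_eqF.
rewrite cE; apply: goursat => //; first by rewrite divr_gt0 ?exprn_gt0//; lra.
have third (m : 'I_3) : m%:R <= (2 : R) /\ 0 <= (m%:R : R) by rewrite ler_nat -ltnS.
move=> x y xI yI; have [i2 i0] := third i; have [j2 j0] := third j; apply: dg.
- by rewrite ler_norml; nra.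
- by rewrite ler_norml; nra.
apply/eqP => -[xX yY]; move/negP: ij; apply.
have mid (m : 'I_3) (t T : R) : t = T ->
    T - a + m%:R * (2 * a / 3) <= t <= T - a + m%:R * (2 * a / 3) + 2 * a / 3 -> m == 1%N :> nat.
  move=> -> {xX yY}; case: m => -[|[|[|//]]] //= _; lra.
by rewrite (mid i x X xX xI) (mid j y Y yY yI).
Qed.

(** A weak Cauchy formula. The quotient g of f z - f z0 by z - z0 is bounded near z0, so its sums
    are negligible. Hence f z0 times the sum W of 1 / (z - z0) is close to the sum of f z / (z -
    z0), which is at most 4 (M / a) (2 a) = 8 M in modulus; as W has modulus at least 4, the
    constant is 2. *)
Lemma center_bound f X Y a (M : R) : 0 < a ->
  (forall x y, `|x - X| <= a -> `|y - Y| <= a -> derivable f (pt x y) 1) ->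
  (forall x y, `|x - X| <= a -> `|y - Y| <= a -> a <= cabs (pt x y - pt X Y) ->
     cabs (f (pt x y)) <= M) ->
  cabs (f (pt X Y)) <= 2 * M.
Proof.
move=> a0 df fM; set z0 := pt X Y.
pose g z := f z / (z - z0) - f z0 * (z - z0)^-1.
have dg x y : `|x - X| <= a -> `|y - Y| <= a -> (x, y) != (X, Y) ->
    derivable g (pt x y) 1.
  move=> xX yY xy; have zz0 : pt x y - z0 != 0.
    rewrite subr_eq0; apply: contra xy => /eqP e; apply/eqP.
    by case: (congr1 (@re R) e) (congr1 (@im R) e); rewrite /re /im /= !mul0r !mulr0 !mul1r ?subr0 ?addr0 ?add0r => -> ->.
  have dV : derivable (fun z => (z - z0)^-1) (pt x y) 1.
    apply: (derivableVC (f := fun z => z - z0)); first exact: zz0.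
    by apply: derivableBC; [exact: derivable_idC|exact: derivable_cstC].
  apply: derivableBC; first by apply: derivableMC; [exact: df|exact: dV].
  by apply: derivableMC; [exact: derivable_cstC|exact: dV].
have [phi phic fE] : exists2 phi : Cx R -> Cx R, {for z0, continuous phi} &
    forall w, f w = f z0 + phi w * (w - z0).
  by apply/derivable_slopeP; apply: df; rewrite subrr normr0 ltW.
pose B := cabs (phi z0) + 1.
have /nbhs_cabsP[d d0 dB] : \forall w \near z0, cabs (phi w - phi z0) < 1.
  by have /cts_cabsP := phic; apply.
have B0 : 0 < B by rewrite ltr_wpDl ?cabs_ge0.
have gB w : cabs (w - z0) < d -> cabs (g w) <= B.
  move=> wd; have [->|wz] := eqVneq w z0.
    by rewrite /g subrr cabs0 ltW.
  have -> : g w = phi w.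
    have wz' : w - z0 != 0 by rewrite subr_eq0.
    by rewrite /g (fE w); field.
  have := dB w wd; have := cabs_subD (phi w) 0 (phi z0); rewrite !subr0 /B; lra.
have bdryP b z : 0 < b -> bdry (pt (X - b) (Y - b)) (2 * b) z ->
    exists x y, [/\ z = pt x y, `|x - X| <= b, `|y - Y| <= b & b <= cabs (z - z0)].
  move=> b0 [x [y [xI yI -> side]]]; exists (X - b + x), (Y - b + y).
  have zE : pt (X - b) (Y - b) + rc x + ci R * rc y = pt (X - b + x) (Y - b + y).
    by rewrite /pt !rcD; ring.
  split => //; try by rewrite ler_norml; lra.
  have zzE : pt (X - b) (Y - b) + rc x + ci R * rc y - z0 = pt (x - b) (y - b).
    by rewrite /z0 /pt !rcB; ring.
  have reE : re (pt (x - b) (y - b)) = x - b by rewrite /re /=; ring.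
  have imE : im (pt (x - b) (y - b)) = y - b by rewrite /im /=; ring.
  rewrite zzE; have := re_le (pt (x - b) (y - b)); have := im_le (pt (x - b) (y - b)).
  rewrite reE imE => h1 h2.
  have := ler_norm (x - b); have := ler_norm (y - b).
  have := ler_norm (- (x - b)); have := ler_norm (- (y - b)); rewrite !normrN.
  by case: side => ?; lra.
have M0 : 0 <= M.
  apply: (le_trans (cabs_ge0 (f (pt (X + a) Y)))); apply: fM.
  - by rewrite addrAC subrr add0r ger0_norm; [exact: lexx|exact: ltW].
  - by rewrite subrr normr0; exact: ltW.
  - have -> : pt (X + a) Y - pt X Y = rc a by rewrite /pt rcD; ring.
    by rewrite cabs_rc ger0_norm; [exact: lexx|exact: ltW].
have smallg (e : R) : 0 < e -> sq_small g (pt (X - a) (Y - a)) (2 * a) e.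
  move=> e0; have -> : e = e / 2 + e / 2 by lra.
  (* The innermost square, of half side b, has to lie in the disc where g is bounded by B, whence 2
     b < d, and its sum is at most 4 B (2 b) < e / 2. *)
  have mn0 : 0 < Num.min (d / 2) (e / 16 / B) by rewrite lt_min !divr_gt0.
  have [k] := pow3_small a mn0.
  rewrite lt_min => /andP[kd ke]; set b := a / 3 ^+ k in kd ke.
  have b0 : 0 < b by rewrite divr_gt0 ?exprn_gt0.
  apply: (@sq_small_center _ _ _ _ _ _ k) => //; first by lra.
  exists 0%N => N _; apply: (@le_trans _ _ (4 * B * (2 * b))).
    apply: sq_bound; [by rewrite expn_gt0|by rewrite mulr_ge0// ltW|].
    move=> z /(bdryP _ _ b0)[x [y [-> xX yY _]]]; apply: gB.
    apply: (le_lt_trans (cabs_pt_le _ _ _ _)); apply: (le_lt_trans (lerD xX yY)).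
    by rewrite [d]splitr ltrD.
  have : b * B < e / 16 by rewrite -ltr_pdivlMr.
  by move: b {kd ke b0} B {dB gB bdryP B0 mn0} => b B; lra.
apply/ler_addgt0Pr => e e0.
have e4 : 0 < 4 * e by lra.
have [N NP] := smallg (4 * e) e4.
have n0 : (0 < 3 ^ N)%N by rewrite expn_gt0.
have := NP N (leqnn N); rewrite /g sqB sqZ.
have := winding_bound X Y n0 a0; rewrite -/z0.
set W := sq _ (fun z => (z - z0)^-1) _ _ => W4.
have : cabs (sq (3 ^ N) (fun z => f z / (z - z0)) (pt (X - a) (Y - a)) (2 * a)) <= 8 * M.
  have -> : 8 * M = 4 * (M / a) * (2 * a) by field; rewrite gt_eqF.
  apply: sq_bound; [by []|lra|].
  move=> z /(bdryP _ _ a0)[x [y [zE xX yY az]]]; rewrite cabsM cabsV.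
  apply: ler_pM; rewrite ?invr_ge0 ?cabs_ge0//.
    by rewrite zE; apply: fM => //; rewrite -zE.
  by rewrite lef_pV2// posrE (lt_le_trans a0).
set S := sq _ _ _ _ => S8 SW.
have : cabs (f z0) * cabs W <= 8 * M + 4 * e.
  have := cabs_subD (f z0 * W) 0 S; rewrite !subr0 cabsM cabs_sym.
  by move=> H; apply: (le_trans H); lra.
have := cabs_ge0 (f z0); nra.
Qed.

End CauchyEstimate.

(** * Maximum principle, division by w - z and orders of vanishing *)

Section LocalTheory.
Variable R : realType.
Implicit Types (f g u : Cx R -> Cx R) (p z w : Cx R).

Definition locb u p := exists B : R, \forall w \near p, cabs (u w) <= B.

Lemma locb_cts u p : {for p, continuous u} -> locb u p.
Proof.
move=> /cts_cabsP/(_ 1 ltr01) H; exists (cabs (u p) + 1).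
apply: filterS H => w wp; have := cabs_subD (u w) 0 (u p); rewrite !subr0; lra.
Qed.

Lemma locbD u1 u2 p : locb u1 p -> locb u2 p -> locb (fun w => u1 w + u2 w) p.
Proof.
move=> [B1 H1] [B2 H2]; exists (B1 + B2); apply: filterS2 H1 H2 => w b1 b2.
by rewrite (le_trans (cabsD _ _))// lerD.
Qed.

Lemma locbN u p : locb u p -> locb (fun w => - u w) p.
Proof. by move=> [B H]; exists B; apply: filterS H => w; rewrite cabsN. Qed.

Lemma locbM u1 u2 p : locb u1 p -> locb u2 p -> locb (fun w => u1 w * u2 w) p.
Proof.
move=> [B1 H1] [B2 H2]; exists (B1 * B2); apply: filterS2 H1 H2 => w b1 b2.
by rewrite cabsM ler_pM ?cabs_ge0.
Qed.

Lemma locbX u p k : locb u p -> locb (fun w => u w ^+ k) p.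
Proof.
move=> [B H]; exists (B ^+ k); apply: filterS H => w b.
by rewrite cabsX lerXn2r ?nnegrE ?cabs_ge0// (le_trans (cabs_ge0 _) b).
Qed.

(** As u is only bounded near p, one factor w - p is needed to make the slope tend to 0, whence the
    square. *)
Lemma derivable_sqr_locb u p : locb u p -> derivable (fun w => (w - p) ^+ 2 * u w) p 1.
Proof.
move=> [B /nbhs_cabsP[d d0 dB]]; apply/derivable_slopeP.
exists (fun w => (w - p) * u w); last by move=> w; ring.
apply/cts_cabsP => e e0; apply/nbhs_cabsP.
have B0 : 0 <= B by rewrite (le_trans (cabs_ge0 (u p)))// dB// subrr cabs0.
exists (Num.min d (e / (B + 1))); first by rewrite lt_min d0 divr_gt0// ltr_wpDl.
move=> w; rewrite lt_min => /andP[wd we].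
rewrite subrr mul0r subr0 cabsM; have := dB w wd; have := cabs_ge0 (w - p).
have := cabs_ge0 (u w); move: we; rewrite ltr_pdivlMr ?ltr_wpDl//; nra.
Qed.

(** If x > M, the powers of x / M are unbounded by Bernoulli's inequality. This removes any constant
    that does not depend on k. *)
Lemma pow_compare (p x M D : R) : 0 < p -> 0 <= M ->
  (forall k, p * x ^+ k <= D * M ^+ k) -> x <= M.
Proof.
move=> p0 M0 H; rewrite leNgt; apply/negP => Mx.
have [M_eq0|M_neq0] := eqVneq M 0.
  by have := H 1%N; rewrite !expr1 M_eq0 mulr0 pmulr_rle0// leNgt -{1}M_eq0 Mx.
have M_gt0 : 0 < M by rewrite lt_def M_neq0.
pose y := x / M - 1.
have y0 : 0 < y by rewrite subr_gt0 ltr_pdivlMr// mul1r.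
have bern k : 1 + k%:R * y <= (1 + y) ^+ k.
  elim: k => [|k IH]; first by rewrite mul0r addr0 expr0.
  rewrite exprS -natr1; have := ler0n R k; nra.
have [k kD] : exists k : nat, D / p / y < k%:R.
  exists (Num.bound `|D / p / y|); exact: (le_lt_trans (ler_norm _) (archi_boundP (normr_ge0 _))).
have := H k; have -> : x = (1 + y) * M by rewrite /y; field.
rewrite exprMn mulrA ler_pM2r ?exprn_gt0// => le1.
have : p * (1 + k%:R * y) <= D by rewrite (le_trans _ le1)// ler_pM2l.
by move: kD; rewrite !ltr_pdivrMr//; nra.
Qed.

Lemma pt_range x y X Y (b : R) : `|x - X| <= b -> `|y - Y| <= b ->
  cabs (pt x y - pt X Y) <= 2 * b.
Proof. by move=> xX yY; rewrite (le_trans (cabs_pt_le _ _ _ _))// mulr2n mulrDl mul1r lerD. Qed.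

Lemma loc_bounded_disc u z (s : R) : (forall w, cabs (w - z) <= 2 * s -> locb u w) ->
  exists K : R, forall w, cabs (w - z) <= s -> cabs (u w) <= K.
Proof.
have [s0|s0] := ltP 0 s; last first.
  move=> _; exists (cabs (u z)) => w wz; suff -> : w = z by [].
  by apply/eqP; rewrite -subr_eq0 -cabs_eq0; have := cabs_ge0 (w - z); lra.
move=> bu; have s2 : 0 < 2 * s by lra.
have [|K KP] := @loc_bounded_square R u (re z - s) (im z - s) _ s2.
  move=> x y xI yI; apply: bu; rewrite {1}(ptE z).
  by apply: pt_range; rewrite ler_norml; lra.
exists K => w wz; rewrite (ptE w).
have := le_trans (re_le (w - z)) wz; have := le_trans (im_le (w - z)) wz.
by rewrite reB imB !ler_norml => ? ?; apply: KP; lra.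
Qed.

(* Applying the estimate to the powers u^k, multiplied by squared linear
   factors that remove the exceptional points, improves its constant to 1. *)
Lemma band_max u (l : seq (Cx R)) w0 (r M : R) : 0 < r ->
  (forall w, cabs (w - w0) < 6 * r -> w \notin l -> derivable u w 1) ->
  (forall p, p \in l -> locb u p) ->
  (forall w, r <= cabs (w - w0) <= 5 * r -> cabs (u w) <= M) ->
  forall z, cabs (z - w0) < r -> z \notin l -> cabs (u z) <= M.
Proof.
move=> r0 du bu uM z zw0 zl.
pose P (s : seq (Cx R)) w := \prod_(p <- s) (w - p) ^+ 2.
have dP s w : derivable (P s) w 1.
  apply: derivable_prodC => p _; apply: derivableXC; apply: derivableBC.
    exact: derivable_idC.
  exact: derivable_cstC.
have M0 : 0 <= M.
  apply: le_trans (cabs_ge0 (u (w0 + rc r))) (uM _ _).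
  by rewrite addrAC subrr add0r cabs_rc ger0_norm; lra.
have dPu k w : cabs (w - w0) < 6 * r -> derivable (fun w => P l w * u w ^+ k) w 1.
  move=> wr; case: (boolP (w \in l)) => [wl|wl]; last first.
    by apply: derivableMC; [exact: dP|apply: derivableXC; exact: du].
  (* At an exceptional point w one squared factor is split off; what remains is bounded near w. *)
  have -> : (fun w => P l w * u w ^+ k) =
      (fun w' => (w' - w) ^+ 2 * (P (rem w l) w' * u w' ^+ k)).
    by apply/funext => w'; rewrite /P (perm_big _ (perm_to_rem wl)) big_cons mulrA.
  apply: derivable_sqr_locb; apply: locbM; last by apply: locbX; exact: bu.
  by apply: locb_cts; exact: derivable_cts (dP _ _).
have [D PD] : exists D : R, forall w, cabs (w - w0) <= 5 * r -> cabs (P l w) <= D.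
  elim: l {zl du bu dPu} => [|p l [D IH]].
    by exists 1 => w _; rewrite /P big_nil cabs1.
  exists ((5 * r + cabs (w0 - p)) ^+ 2 * D) => w wr.
  rewrite /P big_cons cabsM cabsX ler_pM ?exprn_ge0 ?cabs_ge0 ?IH//.
  rewrite lerXn2r ?nnegrE ?cabs_ge0 ?addr_ge0 ?cabs_ge0//; first lra.
  by rewrite (le_trans (cabs_subD _ _ w0))// lerD2r.
apply: (@pow_compare (cabs (P l z)) _ _ (2 * D)) => //.
  rewrite cabs_gt0 /P prodf_seq_neq0; apply/allP => p pl /=.
  by rewrite expf_neq0// subr_eq0; apply: contraNneq zl => ->.
move=> k; rewrite -cabsX -cabsM -mulrA.
(* The square of half side 2 r about z stays within 5 r of w0, and its points at distance at least 2
   r from z are at distance at least r from w0: the bound M is available there. *)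
have dist x y : `|x - re z| <= 2 * r -> `|y - im z| <= 2 * r ->
    cabs (pt x y - w0) < 5 * r.
  move=> xX yY; have := pt_range xX yY; rewrite -ptE => H.
  by apply: (le_lt_trans (cabs_subD _ _ z)); lra.
have r2 : 0 < 2 * r by lra.
have := @center_bound R (fun w => P l w * u w ^+ k) (re z) (im z) (2 * r) (D * M ^+ k) r2.
rewrite -ptE; apply.
  by move=> x y xX yY; apply: dPu; have := dist x y xX yY; lra.
move=> x y xX yY far; have dxy := dist x y xX yY.
rewrite cabsM cabsX ler_pM ?exprn_ge0 ?cabs_ge0//; first by apply: PD; lra.
rewrite lerXn2r ?nnegrE ?cabs_ge0//; apply: uM.
by have := cabs_subD (pt x y) z w0; rewrite (cabs_sym w0); lra.
Qed.

(** Completeness of [R], applied to real and imaginary parts, which are 1-Lipschitz. *)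
Lemma cauchy_punctured (q : Cx R -> Cx R) w0 :
  (forall e : R, 0 < e -> exists2 d : R, 0 < d & forall w1 w2, w1 != w0 -> w2 != w0 ->
     cabs (w1 - w0) < d -> cabs (w2 - w0) < d -> cabs (q w1 - q w2) <= e) ->
  exists l, forall e : R, 0 < e -> exists2 d : R, 0 < d & forall w, w != w0 ->
     cabs (w - w0) < d -> cabs (q w - l) < e.
Proof.
move=> qC.
have nearP (P : set (Cx R)) : (\forall w \near w0^', P w) <->
    exists2 d : R, 0 < d & forall w, w != w0 -> cabs (w - w0) < d -> P w.
  split=> [/nbhs_cabsP[d d0 H]|[d d0 H]].
    by exists d => // w ww0 wd; exact: H.
  by apply/nbhs_cabsP; exists d => // w wd ww0; exact: H.
have coord (h : Cx R -> R) : (forall z w, `|h z - h w| <= cabs (z - w)) ->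
    exists a : R, forall e : R, 0 < e -> \forall w \near w0^', `|h (q w) - a| < e.
  move=> hlip.
  have /cvg_ex[a aP] : cvg (h (q w) @[w --> w0^']).
    apply: cauchy_cvg; apply: cauchy_exP => e e0.
    have [d d0 dq] := qC (e / 2) (divr_gt0 e0 (ltr0Sn R 1)).
    have w1n : w0 + rc (d / 2) != w0.
      by rewrite -subr_eq0 addrAC subrr add0r -cabs_eq0 cabs_rc normr_eq0 gt_eqF// divr_gt0.
    have w1d : cabs (w0 + rc (d / 2) - w0) < d.
      by rewrite addrAC subrr add0r cabs_rc ger0_norm; lra.
    exists (h (q (w0 + rc (d / 2)))).
    have : \forall w \near w0^', ball (h (q (w0 + rc (d / 2)))) e (h (q w)).
      apply/nearP; exists d => // w ww0 wd; rewrite /ball /=.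
      by apply: (le_lt_trans (hlip _ _)); apply: (le_lt_trans (dq _ _ w1n ww0 w1d wd)); lra.
    exact.
  exists a => e e0; move/cvgrPdist_lt : aP => /(_ e e0).
  by apply: filterS => w; rewrite distrC.
have [|a aP] := coord (@re R); first by move=> z w; rewrite -reB re_le.
have [|b bP] := coord (@im R); first by move=> z w; rewrite -imB im_le.
exists (pt a b) => e e0; apply/nearP.
have e2 : 0 < e / 2 by lra.
apply: filterS2 (aP _ e2) (bP _ e2) => w aw bw.
rewrite (ptE (q w)); apply: (le_lt_trans (cabs_pt_le _ _ _ _)); lra.
Qed.

(* The difference quotients (phi z - phi w) / (z - w) are uniformly Cauchy in z
   away from w0 as w tends to w0; by [band_max] they are so at z = w0, which is
   the derivability of phi at w0. *)
Lemma slope_derivable f w0 (rho : R) : 0 < rho ->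
  (forall w, cabs (w - w0) < rho -> derivable f w 1) ->
  exists2 phi : Cx R -> Cx R, forall w, cabs (w - w0) < rho -> derivable phi w 1 &
    forall w, f w = f w0 + phi w * (w - w0).
Proof.
move=> rho0 df.
have [|phi phic fE] := (derivable_slopeP f w0).1.
  by apply: df; rewrite subrr cabs0.
have phiE w : w != w0 -> phi w = (f w - f w0) / (w - w0).
  by move=> ww0; rewrite (fE w) addrAC subrr add0r mulfK// subr_eq0.
have dphi w : w != w0 -> cabs (w - w0) < rho -> derivable phi w 1.
  move=> ww0 wr; apply: (@derivable_near _ (fun w => (f w - f w0) / (w - w0))).
    apply/nbhs_cabsP; exists (cabs (w - w0)); first by rewrite cabs_gt0 subr_eq0.
    move=> w' w'w; rewrite phiE//; apply: contraTneq w'w => ->.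
    by rewrite cabs_sym ltxx.
  apply: derivableMC; first by apply: derivableBC; [exact: df|exact: derivable_cstC].
  apply: (derivableVC (f := fun w => w - w0)); first by rewrite subr_eq0.
  by apply: derivableBC; [exact: derivable_idC|exact: derivable_cstC].
have cphi w : cabs (w - w0) < rho -> {for w, continuous phi}.
  have [->//|ww0 wr] := eqVneq w w0.
  exact: derivable_cts (dphi w ww0 wr).
exists phi; [|exact: fE]; move=> w; have [-> _|] := eqVneq w w0; last exact: dphi.
pose q w := (phi w - phi w0) / (w - w0).
suff [l lP] : exists l, forall e : R, 0 < e -> exists2 d : R, 0 < d &
    forall w, w != w0 -> cabs (w - w0) < d -> cabs (q w - l) < e.
  apply/derivable_slopeP; exists (fun w => if w == w0 then l else q w); last first.
    move=> w'; have [->|w'w0] := eqVneq w' w0; first by rewrite subrr mulr0 addr0.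
    by rewrite /q divfK ?subr_eq0// addrC subrK.
  apply/cts_cabsP => e e0; rewrite eqxx; apply/nbhs_cabsP.
  have [d d0 dq] := lP e e0; exists d => // w' w'd.
  by have [_|w'w0] := eqVneq w' w0; [rewrite subrr cabs0|exact: dq].
apply: cauchy_punctured => e e0.
(* [loc_bounded_disc] bounds phi on the disc of radius 5 r from its behaviour on the disc of radius
   10 r, which must stay inside the domain. *)
pose r := rho / 11; have r0 : 0 < r by rewrite /r; lra.
have r_rho : 11 * r = rho by rewrite /r; field.
have [|K KP] := @loc_bounded_disc phi w0 (5 * r).
  by move=> w' w'r; apply: locb_cts; apply: cphi; lra.
have K0 : 0 <= K by rewrite (le_trans (cabs_ge0 (phi w0)))// KP// subrr cabs0; lra.
(* On the band the numerator of u will be at most 2 K (2 d2) + 2 e' (6 r) <= 16 e r^2 / 100 and the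
   denominator at least r^2 / 4, so that u is at most e. *)
pose e' := e * r / 100; have e'0 : 0 < e' by rewrite /e' divr_gt0// mulr_gt0.
have /nbhs_cabsP[d1 d1_gt0 dphi0] : \forall w \near w0, cabs (phi w - phi w0) < e'.
  by have /cts_cabsP := phic; apply.
pose d2 := e * r ^+ 2 / (100 * (K + 1)).
have d2_gt0 : 0 < d2.
  by rewrite divr_gt0// mulr_gt0 ?exprn_gt0// ltr_wpDl.
exists (Num.min (r / 2) (Num.min d1 d2)).
  by rewrite !lt_min d1_gt0 d2_gt0 divr_gt0.
move=> w1 w2 w1n w2n; rewrite !lt_min => /andP[w1r /andP[w1d1 w1d2]] /andP[w2r /andP[w2d1 w2d2]].
pose D w' z := (phi z - phi w') / (z - w').
pose u z := D w1 z - D w2 z.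
have qE w' : q w' = D w' w0 by rewrite /q /D -(opprB (phi w0)) -(opprB w0) invrN mulrNN.
rewrite !qE -/(u w0).
have dD w' z : z != w' -> z != w0 -> cabs (z - w0) < rho -> derivable (D w') z 1.
  move=> zw' zw0 zr; apply: derivableMC.
    by apply: derivableBC; [exact: dphi|exact: derivable_cstC].
  apply: (derivableVC (f := fun w => w - w')); first by rewrite subr_eq0.
  by apply: derivableBC; [exact: derivable_idC|exact: derivable_cstC].
have cD w' z : z != w' -> cabs (z - w0) < rho -> {for z, continuous (D w')}.
  move=> zw' zr.
  have c1 : {for z, continuous (fun w => phi w - phi w')}.
    apply/cts_cabsP => a a0; have /cts_cabsP/(_ a a0) := cphi z zr.
    apply: filterS => w''; suff -> : phi w'' - phi w' - (phi z - phi w') = phi w'' - phi z by [].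
    by ring.
  have c2 : {for z, continuous (fun w : Cx R => (w - w')^-1)}.
    apply: derivable_cts; apply: (derivableVC (f := fun w => w - w')); first by rewrite subr_eq0.
    by apply: derivableBC; [exact: derivable_idC|exact: derivable_cstC].
  by have := continuousM c1 c2; exact.
have bD w' z : w' != w0 -> cabs (z - w0) < rho -> locb (D w') z.
  move=> w'w0 zr; have [zw'|zw'] := eqVneq z w'; last exact: locb_cts (cD _ _ zw' zr).
  have /derivable_slopeP[psi psic psiE] : derivable phi w' 1 by apply: dphi; [exact: w'w0|rewrite -zw'].
  rewrite zw'; have [B HB] := locb_cts psic; exists (Num.max B 0); apply: filterS HB => z' z'B.
  rewrite /D; have [->|z'w'] := eqVneq z' w'; first by rewrite subrr mul0r cabs0 le_max lexx orbT.
  by rewrite (psiE z') addrAC subrr add0r mulfK ?subr_eq0// le_max z'B.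
(* At w0 the derivability of phi is what is being proved; at w1 and w2 one of the quotients is 0 /
   0. Near all three u is bounded. *)
pose l := [:: w0; w1; w2].
have l_r p : p \in l -> cabs (p - w0) < r / 2.
  by rewrite !inE => /or3P[] /eqP->//; rewrite subrr cabs0; lra.
have band z : r <= cabs (z - w0) <= 5 * r -> cabs (u z) <= e.
  move=> /andP[zr1 zr2].
  have far w' : cabs (w' - w0) < r / 2 -> r / 2 < cabs (z - w').
    by move=> w'r; have := cabs_subD z w0 w'; lra.
  have f1 := far _ w1r; have f2 := far _ w2r.
  have n1 : z - w1 != 0 by rewrite -cabs_gt0; lra.
  have n2 : z - w2 != 0 by rewrite -cabs_gt0; lra.
  have -> : u z = ((phi z - phi w2) * (w1 - w2) - (phi w1 - phi w2) * (z - w2)) /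
      ((z - w1) * (z - w2)) by rewrite /u /D; field; rewrite n1 n2.
  rewrite cabsM cabsV cabsM ler_pdivrMr; last by rewrite mulr_gt0 ?cabs_gt0.
  apply: (le_trans (cabsB _ _)); rewrite !cabsM.
  have b1 : cabs (phi z - phi w2) <= 2 * K.
    have := cabsB (phi z) (phi w2); have := KP z zr2.
    by have := KP w2 _; move=> H1 H2 H3; have : cabs (phi w2) <= K by [apply: H1; lra]; lra.
  have b2 : cabs (w1 - w2) <= 2 * d2.
    by have := cabs_subD w1 w2 w0; rewrite (cabs_sym w0); lra.
  have b3 : cabs (phi w1 - phi w2) <= 2 * e'.
    have := cabs_subD (phi w1) (phi w2) (phi w0); rewrite (cabs_sym (phi w0)).
    by have := dphi0 w1 w1d1; have := dphi0 w2 w2d1; lra.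
  have b4 : cabs (z - w2) <= 6 * r.
    by have := cabs_subD z w2 w0; rewrite (cabs_sym w0); lra.
  have t1 : cabs (phi z - phi w2) * cabs (w1 - w2) <= 2 * K * (2 * d2).
    by rewrite ler_pM ?cabs_ge0.
  have t2 : cabs (phi w1 - phi w2) * cabs (z - w2) <= 2 * e' * (6 * r).
    by rewrite ler_pM ?cabs_ge0.
  have t3 : e * (r / 2 * (r / 2)) <= e * (cabs (z - w1) * cabs (z - w2)).
    by rewrite ler_pM2l// ler_pM ?divr_ge0 ?ltW.
  have t4 : K * d2 <= e * r ^+ 2 / 100.
    have -> : e * r ^+ 2 / 100 = (K + 1) * d2 by rewrite /d2; field; rewrite gt_eqF// ltr_wpDl.
    by rewrite ler_pM2r// lerDl.
  have t5 : e' * r = e * r ^+ 2 / 100 by rewrite /e'; ring.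
  have t6 : 0 < e * r ^+ 2 by rewrite mulr_gt0 ?exprn_gt0.
  apply: (le_trans (lerD t1 t2)); apply: le_trans t3.
  have -> : e * (r / 2 * (r / 2)) = e * r ^+ 2 / 4 by field.
  have -> : 2 * e' * (6 * r) = 12 * (e * r ^+ 2 / 100) by rewrite -t5; ring.
  have -> : 2 * K * (2 * d2) = 4 * (K * d2) by ring.
  by move: t4 t6; move: (K * d2) (e * r ^+ 2) => A B t4 t6; lra.
have uM : forall z, cabs (z - w0) < r -> z \notin l -> cabs (u z) <= e.
  move=> z' z'r z'l; apply: (band_max (l := l) r0 _ _ band z'r z'l) => {z' z'r z'l}.
  - move=> z zr; rewrite !inE !negb_or => /and3P[z0 z1 z2].
    by apply: derivableBC; apply: dD; rewrite ?z0 ?z1 ?z2//; lra.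
  - move=> p /l_r pr; apply: locbD; first by apply: bD => //; lra.
    by apply: locbN; apply: bD => //; lra.
(* [uM] leaves out w0 itself; there the bound follows from the continuity of u, tested at a nearby
   point outside l. *)
rewrite leNgt; apply/negP => e_lt.
have cu : {for w0, continuous u}.
  have w00 : cabs (w0 - w0) < rho by rewrite subrr cabs0.
  have c1 : {for w0, continuous (D w1)} by apply: cD; rewrite 1?eq_sym.
  have c2 : {for w0, continuous (D w2)} by apply: cD; rewrite 1?eq_sym.
  by have := continuousB c1 c2; exact.
have [d3 d3_gt0 d3P] : exists2 d : R, 0 < d & forall z, cabs (z - w0) < d ->
    cabs (u z - u w0) < cabs (u w0) - e.
  by apply/nbhs_cabsP; have /cts_cabsP := cu; apply; lra.
have [t [t0 td3 tr tw1 tw2]] : exists t, [/\ 0 < t, t < d3, t < r, t < cabs (w1 - w0) & t < cabs (w2 - w0)].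
  pose m := Num.min (Num.min d3 r) (Num.min (cabs (w1 - w0)) (cabs (w2 - w0))).
  have m0 : 0 < m by rewrite !lt_min d3_gt0 r0 !cabs_gt0 !subr_eq0 w1n.
  have : m <= m by []; rewrite {2}/m !le_min => /andP[/andP[? ?] /andP[? ?]].
  by exists (m / 2); split; lra.
have zE : cabs (w0 + rc t - w0) = t by rewrite addrAC subrr add0r cabs_rc ger0_norm// ltW.
have zl : w0 + rc t \notin l.
  rewrite !inE !negb_or; apply/and3P; split; apply/negP => /eqP E.
  - by move: zE; rewrite E subrr cabs0 => t_0; rewrite -t_0 ltxx in t0.
  - by move: tw1; rewrite -E zE ltxx.
  - by move: tw2; rewrite -E zE ltxx.
have := uM (w0 + rc t); rewrite zE => /(_ tr zl).
have := d3P (w0 + rc t); rewrite zE => /(_ td3).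
have := cabs_subD (u w0) 0 (u (w0 + rc t)); rewrite !subr0 (cabs_sym (u w0)); lra.
Qed.

Definition hol f z := \forall w \near z, derivable f w 1.

Lemma hol_slope f z : hol f z ->
  exists2 phi : Cx R -> Cx R, hol phi z & forall w, f w = f z + phi w * (w - z).
Proof.
move=> /nbhs_cabsP[d d0 df]; have [phi dphi fE] := slope_derivable d0 df.
by exists phi; [apply/nbhs_cabsP; exists d|exact: fE].
Qed.

(** If the first form fails, f is divisible by every (w - z)^m. By [band_max] the quotient is at
    most K / r^m on the disc of radius r, with K independent of m, and large m forces f w = 0. *)
Lemma hol_order f z : hol f z ->
  (exists m g, [/\ hol g z, g z != 0 & forall w, f w = (w - z) ^+ m * g w]) \/
  (\forall w \near z, f w = 0).
Proof.
move=> /nbhs_cabsP[d d0 df].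
have [H|nH] := pselect (exists m g, [/\ hol g z, g z != 0 & forall w, f w = (w - z) ^+ m * g w]).
  by left.
right.
have all_m m : exists2 g : Cx R -> Cx R, forall w, cabs (w - z) < d -> derivable g w 1 &
    forall w, f w = (w - z) ^+ m * g w.
  elim: m => [|m [g dg fg]]; first by exists f; [exact: df|move=> w; rewrite expr0 mul1r].
  have gz0 : g z = 0.
    apply: contrapT => /eqP gz; apply: nH; exists m, g; split => //.
    by apply/nbhs_cabsP; exists d.
  have [phi dphi gE] := slope_derivable d0 dg; exists phi; [exact: dphi|move=> w].
  by rewrite fg (gE w) gz0 add0r exprSr; ring.
pose r := d / 11; have r0 : 0 < r by rewrite /r; lra.
have r_d : 11 * r = d by rewrite /r; field.
have [|K KP] := @loc_bounded_disc f z (5 * r).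
  by move=> w wr; apply: locb_cts; apply: derivable_cts; apply: df; lra.
have fK m w : cabs (w - z) < r -> cabs (f w) * r ^+ m <= K * cabs (w - z) ^+ m.
  move=> wr; have [g dg fg] := all_m m.
  have gK : cabs (g w) <= K / r ^+ m.
    apply: (band_max (l := [::]) (w0 := z) r0 _ _ _ wr isT).
    - by move=> w' w'r _; apply: dg; lra.
    - by [].
    - move=> w' /andP[w'r1 w'r2]; rewrite ler_pdivlMr ?exprn_gt0//.
      apply: le_trans (KP w' w'r2); rewrite fg cabsM cabsX mulrC.
      by rewrite ler_wpM2r ?cabs_ge0// lerXn2r ?nnegrE ?cabs_ge0// ltW.
  rewrite fg cabsM cabsX -mulrA mulrC ler_wpM2r ?exprn_ge0 ?cabs_ge0//.
  by rewrite -ler_pdivlMr ?exprn_gt0.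
apply/nbhs_cabsP; exists r => // w wr; apply: contrapT => /eqP; rewrite -cabs_gt0 => fw.
have := @pow_compare (cabs (f w)) r (cabs (w - z)) K fw (cabs_ge0 _) (fun m => fK m w wr).
by move=> ?; lra.
Qed.

End LocalTheory.

(** * Germs of holomorphic functions and of holomorphic matrices *)

Section HolomorphicGerms.
Variable R : realType.
Implicit Types (f g : Cx R -> Cx R) (z w : Cx R).

Lemma hol_near f g z : (\forall w \near z, f w = g w) -> hol f z -> hol g z.
Proof.
move=> /near_join fg df; apply: filterS2 fg df => w.
exact: derivable_near.
Qed.

Lemma hol_nearby f z : hol f z -> \forall w \near z, hol f w.
Proof. exact: near_join. Qed.

Lemma hol_derivable f z : hol f z -> derivable f z 1.
Proof. exact: nbhs_singleton. Qed.

Lemma hol_cts f z : hol f z -> {for z, continuous f}.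
Proof. by move=> /hol_derivable; exact: derivable_cts. Qed.

Lemma hol_cst (c : Cx R) z : hol (fun _ => c) z.
Proof. by apply: filterE => w; exact: derivable_cstC. Qed.

Lemma hol_id z : hol (fun w => w) z.
Proof. by apply: filterE => w; exact: derivable_idC. Qed.

Lemma holD f g z : hol f z -> hol g z -> hol (fun w => f w + g w) z.
Proof. by move=> hf hg; apply: filterS2 hf hg => w; exact: derivableDC. Qed.

Lemma holM f g z : hol f z -> hol g z -> hol (fun w => f w * g w) z.
Proof. by move=> hf hg; apply: filterS2 hf hg => w; exact: derivableMC. Qed.

Lemma holN f z : hol f z -> hol (fun w => - f w) z.
Proof. by move=> hf; apply: filterS hf => w; exact: derivableNC. Qed.

Lemma holX f n z : hol f z -> hol (fun w => f w ^+ n) z.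
Proof. by move=> hf; apply: filterS hf => w; exact: derivableXC. Qed.

Lemma hol_sum (I : Type) (r : seq I) (P : pred I) (F : I -> Cx R -> Cx R) z :
  (forall i, P i -> hol (F i) z) -> hol (fun w => \sum_(i <- r | P i) F i w) z.
Proof.
move=> dF; elim: r => [|i r IH].
  by under [X in hol X]eq_fun do rewrite big_nil; exact: hol_cst.
under [X in hol X]eq_fun do rewrite big_cons.
case Pi: (P i); last exact: IH.
by apply: holD; [exact: dF|exact: IH].
Qed.

Lemma hol_prod (I : Type) (r : seq I) (P : pred I) (F : I -> Cx R -> Cx R) z :
  (forall i, P i -> hol (F i) z) -> hol (fun w => \prod_(i <- r | P i) F i w) z.
Proof.
move=> dF; elim: r => [|i r IH].
  by under [X in hol X]eq_fun do rewrite big_nil; exact: hol_cst.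
under [X in hol X]eq_fun do rewrite big_cons.
case Pi: (P i); last exact: IH.
by apply: holM; [exact: dF|exact: IH].
Qed.

Lemma near_neq0 f z : {for z, continuous f} -> f z != 0 -> \forall w \near z, f w != 0.
Proof.
move=> /cts_cabsP H fz; have := H (cabs (f z)); rewrite cabs_gt0 => /(_ fz).
apply: filterS => w; apply: contraTneq => ->.
by rewrite sub0r cabsN ltxx.
Qed.

Lemma holV f z : hol f z -> f z != 0 -> hol (fun w => (f w)^-1) z.
Proof.
move=> hf fz; apply: filterS2 hf (near_neq0 (hol_cts hf) fz) => w df fw.
exact: derivableVC.
Qed.

(** Punctured neighbourhoods are non-empty. *)
Lemma near_unique (P : Prop) z : (\forall w \near z, w != z -> P) -> P.
Proof.
move=> /nbhs_cabsP[d d0 H]; apply: (H (z + rc (d / 2))).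
  by rewrite addrAC subrr add0r cabs_rc ger0_norm; lra.
by rewrite -subr_eq0 addrAC subrr add0r -cabs_eq0 cabs_rc normr_eq0; lra.
Qed.

Definition mxhol m n (A : Cx R -> 'M[Cx R]_(m, n)) z := forall i j, hol (fun w => A w i j) z.

Lemma mxholM m n p (A : Cx R -> 'M[Cx R]_(m, n)) (B : Cx R -> 'M[Cx R]_(n, p)) z :
  mxhol A z -> mxhol B z -> mxhol (fun w => A w *m B w) z.
Proof.
move=> hA hB i j; under [X in hol X]eq_fun do rewrite mxE.
by apply: hol_sum => k _; apply: holM; [exact: hA|exact: hB].
Qed.

Lemma mxhol_cst m n (A : 'M[Cx R]_(m, n)) z : mxhol (fun _ => A) z.
Proof. by move=> i j; exact: hol_cst. Qed.

Lemma mxhol_sub m n m' n' (A : Cx R -> 'M[Cx R]_(m, n)) (s : 'I_m' -> 'I_m) (t : 'I_n' -> 'I_n) z :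
  mxhol A z -> mxhol (fun w => \matrix_(i, j) A w (s i) (t j)) z.
Proof. by move=> hA i j; under [X in hol X]eq_fun do rewrite mxE; exact: hA. Qed.

Lemma mxhol_block m1 m2 n1 n2 (A : Cx R -> 'M[Cx R]_(m1, n1)) (B : Cx R -> 'M[Cx R]_(m1, n2))
    (C : Cx R -> 'M[Cx R]_(m2, n1)) (D : Cx R -> 'M[Cx R]_(m2, n2)) z :
  mxhol A z -> mxhol B z -> mxhol C z -> mxhol D z ->
  mxhol (fun w => block_mx (A w) (B w) (C w) (D w)) z.
Proof.
move=> hA hB hC hD i0 j; rewrite -[i0]splitK -[j]splitK.
case: (fintype.split i0) => i'; case: (fintype.split j) => j'; rewrite /unsplit.
- by under [X in hol X]eq_fun do rewrite block_mxEul; exact: hA.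
- by under [X in hol X]eq_fun do rewrite block_mxEur; exact: hB.
- by under [X in hol X]eq_fun do rewrite block_mxEdl; exact: hC.
- by under [X in hol X]eq_fun do rewrite block_mxEdr; exact: hD.
Qed.

Lemma hol_det n (A : Cx R -> 'M[Cx R]_n) z : mxhol A z -> hol (fun w => \det (A w)) z.
Proof.
move=> hA; apply: hol_sum => s _; apply: holM; first exact: hol_cst.
by apply: hol_prod => i _; exact: hA.
Qed.

Lemma mxhol_inv n (A : Cx R -> 'M[Cx R]_n) z : mxhol A z -> \det (A z) != 0 ->
  mxhol (fun w => invmx (A w)) z.
Proof.
move=> hA dA i j; have hdet := hol_det hA.
apply: (@hol_near (fun w => (\det (A w))^-1 * \adj (A w) i j)).
  apply: filterS (near_neq0 (hol_cts hdet) dA) => w dw.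
  by rewrite /invmx unitmxE unitfE dw [in RHS]mxE.
apply: holM; first exact: holV.
under [X in hol X]eq_fun do rewrite mxE /cofactor.
apply: holM; first exact: hol_cst.
apply: hol_det => i' j'; under [X in hol X]eq_fun do rewrite !mxE.
exact: hA.
Qed.

(** k is the least order among the entries that do not vanish identically near z: (w - z)^k divides
    all of them and one quotient is a unit at z. *)
Lemma hol_pivot n (a : 'I_n -> Cx R -> Cx R) z : (forall i, hol (a i) z) ->
  (\forall w \near z, forall i, a i w = 0) \/
  exists i0 k (b : 'I_n -> Cx R -> Cx R), [/\ forall i, hol (b i) z, b i0 z != 0 &
    \forall w \near z, forall i, a i w = (w - z) ^+ k * b i w].
Proof.
move=> ha.
have nearI (P : 'I_n -> Cx R -> Prop) : (forall i, \forall w \near z, P i w) ->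
    \forall w \near z, forall i, P i w.
  by move=> H; have := @filter_forall _ _ P (nbhs z) _ H; exact.
pose Z i := \forall w \near z, a i w = 0.
have [/forallP aZ|/forallPn[i1 nZ1]] := boolP [forall i, `[< Z i >]].
  by left; apply: nearI => i; have /asboolP := aZ i; exact.
right.
have /choice[M MP] : forall i, exists p : nat * (Cx R -> Cx R), ~ Z i ->
    [/\ hol p.2 z, p.2 z != 0 & forall w, a i w = (w - z) ^+ p.1 * p.2 w].
  move=> i.
  have [[m [g H]]|Zi] := hol_order (ha i); first by exists (m, g).
  by exists (0%N, fun _ => 0).
case: (arg_minnP (P := fun i => ~~ `[< Z i >]) (fun i => (M i).1) nZ1) => i0 nZ0 i0min.
exists i0, (M i0).1.
have /choice[b bP] : forall i, exists b : Cx R -> Cx R, [/\ hol b z, i = i0 -> b = (M i0).2 &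
    \forall w \near z, a i w = (w - z) ^+ (M i0).1 * b w].
  move=> i; have [Zi|nZi] := boolP `[< Z i >].
    exists (fun _ => 0); split; [exact: hol_cst| |].
      by move=> ii0; rewrite ii0 in Zi; rewrite Zi in nZ0.
    by move/asboolP: Zi; apply: filterS => w ->; rewrite mulr0.
  have [hM Mz aE] := MP i (elimN (asboolP _) nZi).
  exists (fun w => (w - z) ^+ ((M i).1 - (M i0).1) * (M i).2 w); split.
  - by apply: holM; [apply: holX; apply: holD; [exact: hol_id|exact: hol_cst]|exact: hM].
  - by move=> ->; apply/funext => w; rewrite subnn expr0 mul1r.
  - by apply: filterE => w; rewrite mulrA -exprD subnKC ?i0min.
exists b; split.
- by move=> i; have [] := bP i.
- have [_ -> // _] := bP i0; have [] := MP i0 (elimN (asboolP _) nZ0); by [].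
- by apply: nearI => i; have [] := bP i.
Qed.

Lemma rank_block_pivot m n (a : Cx R) (r : 'rV[Cx R]_n) (B : 'M[Cx R]_(m, n)) : a != 0 ->
  \rank (block_mx a%:M r 0 B : 'M_(1 + m, 1 + n)) = (\rank B).+1.
Proof.
move=> a0; pose U : 'M[Cx R]_(1 + n) := block_mx a%:M r 0 1%:M.
have Uu : row_free U.
  by rewrite row_free_unit unitmxE /U det_ublock det_scalar1 det1 mulr1 unitfE.
have -> : block_mx a%:M r 0 B = block_mx 1%:M 0 0 B *m U :> 'M_(1 + m, 1 + n).
  by rewrite /U mulmx_block !mul1mx !mul0mx !mulmx0 mulmx1 !addr0 !add0r.
by rewrite mxrankMfree// rank_diag_block_mx mxrank1.
Qed.

(* Gaussian elimination over the discrete valuation ring of germs at z: the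
   entry of least order in a column divides the others. *)
Lemma row_echelon m n (A : Cx R -> 'M[Cx R]_(n, m)) z : mxhol A z ->
  exists Q r, [/\ mxhol Q z, \det (Q z) != 0, (r <= n)%N,
    \forall w \near z, forall (i : 'I_n) j, (r <= i)%N -> (Q w *m A w) i j = 0 &
    \forall w \near z, w != z -> \rank (A w) = r].
Proof.
elim: m n A => [|m IH] n A hA.
  exists (fun _ => 1%:M), 0%N; split; rewrite ?det1 ?oner_eq0//.
  - exact: mxhol_cst.
  - by apply: filterE => w i [].
  - by apply: filterE => w _; rewrite thinmx0 mxrank0.
pose Ar w : 'M[Cx R]_(n, m) := \matrix_(i, j) A w i (lift ord0 j).
have hAr : mxhol Ar z by have := mxhol_sub id (lift ord0) hA; exact.
have AE w : A w = row_mx (\col_i A w i ord0) (Ar w) :> 'M_(n, 1 + m).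
  apply/matrixP => i j; rewrite mxE; case: fintype.splitP => k; rewrite mxE.
    by rewrite ord1 => /= j0; congr (A w i _); exact: val_inj.
  by move=> jk; congr (A w i _); apply: val_inj; rewrite /= jk.
have [col0|[i0 [k [b [hb b0 aE]]]]] := hol_pivot (fun i => hA i ord0).
  have [Q [r [hQ Qz rn Qr rk]]] := IH n Ar hAr.
  have col0E w : (forall i, A w i ord0 = 0) -> A w = row_mx 0 (Ar w) :> 'M_(n, 1 + m).
    by move=> c0; rewrite AE; congr row_mx; apply/colP => i; rewrite !mxE.
  exists Q, r; split; [exact: hQ|exact: Qz|exact: rn| |].
    apply: filterS2 col0 Qr => w /col0E -> H i j ri.
    rewrite (@mul_mx_row _ _ _ 1 m) mulmx0 mxE; case: fintype.split => j'; first by rewrite mxE.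
    exact: H.
  by apply: filterS2 col0 rk => w /col0E -> H /H <-; rewrite (@rank_row_0mx _ n m 1).
case: n A hA Ar hAr AE i0 b hb b0 aE => [|n] A hA Ar hAr AE i0 b hb b0 aE; first by have := ltn_ord i0; rewrite ltn0.
pose P : 'M[Cx R]_(n.+1) := tperm_mx i0 ord0.
pose s (i : 'I_n.+1) := tperm i0 ord0 i.
have PE w i j : (P *m A w) i j = A w (s i) j by rewrite -xrowE !mxE.
(* The entries of the first column divided by the pivot: the common power of w - z cancels, so these
   are holomorphic germs. *)
pose c w : 'cV[Cx R]_n := \col_i (- (b (s (lift ord0 i)) w / b i0 w)).
have hc : mxhol c z.
  move=> i j; under [X in hol X]eq_fun do rewrite mxE.
  by apply: holN; apply: holM; [exact: hb|exact: holV].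
pose Lm w : 'M[Cx R]_(1 + n) := block_mx 1%:M 0 (c w) 1%:M.
pose top w : 'rV[Cx R]_m := \row_j A w i0 (lift ord0 j).
pose bot w : 'M[Cx R]_(n, m) := \matrix_(i, j) A w (s (lift ord0 i)) (lift ord0 j).
pose A' w := c w *m top w + bot w.
have hA' : mxhol A' z.
  move=> i j; under [X in hol X]eq_fun do rewrite mxE.
  apply: holD; last by under [X in hol X]eq_fun do rewrite mxE; exact: hA.
  apply: (mxholM hc) => i' j'; under [X in hol X]eq_fun do rewrite mxE.
  exact: hA.
have [Q [r [hQ Qz rn Qr rk]]] := IH n A' hA'.
have PAE w : P *m A w = block_mx (A w i0 ord0)%:M (top w) (\col_i A w (s (lift ord0 i)) ord0) (bot w)
    :> 'M_(1 + n, 1 + m).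
  have l0 (p : nat) (x : 'I_1) : lshift p x = ord0 :> 'I_p.+1 by apply: val_inj; rewrite /= (ord1 x).
  have r0 (p : nat) (x : 'I_p) : rshift 1 x = lift ord0 x :> 'I_p.+1 by apply: val_inj.
  have s0 : s ord0 = i0 by rewrite /s tpermR.
  apply/matrixP => i j; rewrite PE -[i in LHS](@splitK 1 n) -[j in LHS](@splitK 1 m) !mxE.
  case: (fintype.split i) => i' /=; rewrite !mxE; case: (fintype.split j) => j' /=; rewrite !mxE ?l0 ?r0 ?s0//.
  by rewrite !ord1 mulr1n.
have LPE : \forall w \near z, Lm w *m (P *m A w) =
    block_mx (A w i0 ord0)%:M (top w) 0 (A' w) :> 'M_(1 + n, 1 + m).
  apply: filterS2 aE (near_neq0 (hol_cts (hb i0)) b0) => w aEw bw.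
  rewrite PAE /Lm (@mulmx_block _ 1 n 1 n 1 m) !mul1mx !mul0mx !addr0; congr block_mx.
  apply/colP => i; rewrite !mxE big_ord1 !mxE mulr1n !aEw; field; exact: bw.
have dP : \det P != 0 by rewrite det_perm signr_eq0.
exists (fun w => block_mx 1%:M 0 0 (Q w) *m Lm w *m P : 'M_(1 + n)), r.+1; split.
- have h1 := mxhol_block (mxhol_cst (1%:M : 'M[Cx R]_1) z) (mxhol_cst (0 : 'M[Cx R]_(1, n)) z)
    (mxhol_cst (0 : 'M[Cx R]_(n, 1)) z) hQ.
  have h2 := mxhol_block (mxhol_cst (1%:M : 'M[Cx R]_1) z) (mxhol_cst (0 : 'M[Cx R]_(1, n)) z)
    hc (mxhol_cst (1%:M : 'M[Cx R]_n) z).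
  by have := mxholM (mxholM h1 h2) (mxhol_cst P z); exact.
- by rewrite !det_mulmx (@det_ublock _ 1 n) (@det_lblock _ 1 n) !det1 !mul1r mulr1 mulf_neq0.
- by rewrite ltnS.
- apply: filterS2 LPE Qr => w LPEw H i j.
  rewrite -!mulmxA LPEw (@mulmx_block _ 1 n 1 n 1 m) !mul1mx !mul0mx !mulmx0 !addr0 !add0r => ri.
  rewrite -[ i ](@splitK 1 n) -[j](@splitK 1 m); case: fintype.splitP => i' ii'.
    by move: ri; rewrite ii' (ord1 i').
  rewrite /unsplit; case: (@fintype.split 1 m j) => j' /=; first by rewrite (@block_mxEdl _ 1 n 1 m) mxE.
  by rewrite (@block_mxEdr _ 1 n 1 m) H// -ltnS; move: ri; rewrite ii'.
- apply: filterS3 LPE rk (filterI aE (near_neq0 (hol_cts (hb i0)) b0)) => w LPEw H [aEw bw] wz.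
  have a0 : A w i0 ord0 != 0 by rewrite aEw mulf_neq0// expf_neq0// subr_eq0.
  have uLP : Lm w *m P \in unitmx.
    by rewrite unitmxE det_mulmx (@det_lblock _ 1 n) !det1 !mul1r unitfE.
  rewrite -(H wz) -(rank_block_pivot (top w) (A' w) a0) -LPEw mulmxA.
  by rewrite -[LHS]mxrank_tr -[RHS]mxrank_tr trmx_mul mxrankMfree// row_free_unit unitmx_tr.
Qed.

End HolomorphicGerms.

(** * Orders of functions on a Riemann surface *)

Section FiniteSupport.

(** For S infinite, the sets that contain all but finitely many points of S form a proper filter,
    and each neighbourhood of a cluster point p of it contains points of S other than p. *)
Lemma compact_discrete_finite (T : topologicalType) (S : set T) : compact [set: T] ->
  (forall x : T, \forall y \near x, y <> x -> ~ S y) -> finite_set S.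
Proof.
move=> cT Sdisc; apply: contrapT => Sinf.
pose F : set_system T := fun A => exists2 D : set T, finite_set D & S `\` D `<=` A.
have FF : ProperFilter F.
  apply: Build_ProperFilter_ex.
    move=> A [D finD SDA]; apply: contrapT => A0; apply: Sinf.
    by apply: sub_finite_set finD => x Sx; apply: contrapT => nDx; apply: A0; exists x; apply: SDA.
  split; first by exists set0.
    move=> A B [D finD SDA] [E finE SEB]; exists (D `|` E); first by rewrite finite_setU.
    by move=> x [Sx /not_orP[nD nE]]; split; [exact: SDA|exact: SEB].
  by move=> A B AB [D finD SDA]; exists D => //; exact: subset_trans AB.
have [|p [_ clp]] := cT F FF; first by exists set0.
have [|y [[Sy yp] Uy]] := clp (S `\` [set p]) _ _ (Sdisc p); first by exists [set p].
exact: Uy.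
Qed.

Lemma fsum_support (T : choiceType) (f : T -> int) (A : set T) (finA : finite_set A) :
  (forall x, f x != 0 -> A x) ->
  \sum_(x \in [set: T]) f x = \sum_(x <- finmap.enum_fset (fset_set A)) f x.
Proof.
move=> fA; apply: fsbigTE => x; rewrite in_fset_set// notin_setE => nAx.
by apply: contrapT => /eqP /fA.
Qed.

End FiniteSupport.

(** * Holomorphic functions and orders in local coordinates *)

Section Surface.
Variables (R : realType) (X : riemann_surface R).
Implicit Types (f g : X -> Cx R) (x y : X) (i j : chart_index X).

Lemma hol_comp (f g : Cx R -> Cx R) z : hol f z -> hol g (f z) -> hol (g \o f) z.
Proof.
move=> hf /nbhs_cabsP[d d0 dg]; have /cts_cabsP/(_ d d0) cf := hol_cts hf.
by apply: filterS2 hf cf => w df /dg; exact: derivable_compC.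
Qed.

Lemma near_chart_inv i x (P : set X) : chart_dom i x -> (\forall y \near x, P y) ->
  \forall z \near chart i x, P (chart_inv i z).
Proof.
move=> xi nP; have cI := @chart_inv_continuous R X i.
rewrite (continuous_open_subspace _ (@chart_img_open R X i)) in cI.
have xin : chart i x \in chart i @` chart_dom i by apply/mem_set; exists x.
have nP' : nbhs (chart_inv i (chart i x)) P by rewrite chartK.
exact: (cI _ xin _ nP').
Qed.

Lemma near_chart i x (P : set (Cx R)) : chart_dom i x ->
  (\forall z \near chart i x, P z) -> \forall y \near x, P (chart i y).
Proof.
move=> xi nP; have cI := @chart_continuous R X i.
rewrite (continuous_open_subspace _ (@chart_dom_open R X i)) in cI.
by have := cI _ (mem_set xi) _ nP; exact.
Qed.

Lemma near_dom i x : chart_dom i x -> \forall y \near x, chart_dom i y.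
Proof. by move=> xi; apply: open_nbhs_nbhs; split=> //; exact: chart_dom_open. Qed.

Lemma near_img i x : chart_dom i x ->
  \forall z \near chart i x, chart_dom i (chart_inv i z) /\ chart i (chart_inv i z) = z.
Proof.
move=> xi; have : \forall z \near chart i x, (chart i @` chart_dom i) z.
  by apply: open_nbhs_nbhs; split; [exact: chart_img_open|exact: imageP].
by apply: filterS => z [y yi <-]; rewrite chartK.
Qed.

Lemma chart_inj i x y : chart_dom i x -> chart_dom i y -> chart i x = chart i y -> x = y.
Proof. by move=> xi yi e; rewrite -(chartK xi) e chartK. Qed.

(** Holomorphy on a neighbourhood of x, since [hol] is; by [holx_chart] one chart is enough to check
    it. *)
Definition holx f x := forall i, chart_dom i x -> hol (f \o chart_inv i) (chart i x).

Lemma hol_transition i j x : chart_dom i x -> chart_dom j x ->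
  hol (chart j \o chart_inv i) (chart i x).
Proof.
move=> xi xj; have := near_chart_inv xi (near_dom xj).
apply: filterS2 (near_img xi) => z [zi zE] zj.
by have := chart_holo zi zj; rewrite zE.
Qed.

Lemma holx_chart i f x : chart_dom i x -> hol (f \o chart_inv i) (chart i x) -> holx f x.
Proof.
move=> xi hf j xj; apply: (@hol_near _ ((f \o chart_inv i) \o (chart i \o chart_inv j))).
  have := near_chart_inv xj (near_dom xi); apply: filterS => z zi /=.
  by rewrite chartK.
by apply: hol_comp; [exact: hol_transition|rewrite /= chartK].
Qed.

Lemma holx_near f g x : (\forall y \near x, f y = g y) -> holx f x -> holx g x.
Proof.
move=> fg hf i xi; apply: hol_near (hf i xi).
exact: (near_chart_inv xi fg).
Qed.

Lemma holx_ex f x : holx f x -> exists2 i, chart_dom i x & hol (f \o chart_inv i) (chart i x).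
Proof. by move=> hf; have [i xi] := chart_cover x; exists i => //; exact: hf. Qed.

Lemma holx_nearby f x : holx f x -> \forall y \near x, holx f y.
Proof.
move=> /holx_ex[i xi /hol_nearby/(near_chart xi)].
apply: filterS2 (near_dom xi) => y yi hy; exact: (holx_chart yi hy).
Qed.

Lemma holx_cst (c : Cx R) x : holx (fun _ => c) x.
Proof. by move=> i xi; exact: hol_cst. Qed.
Lemma holxD f g x : holx f x -> holx g x -> holx (fun y => f y + g y) x.
Proof. by move=> hf hg i xi; exact: holD (hf i xi) (hg i xi). Qed.
Lemma holxM f g x : holx f x -> holx g x -> holx (fun y => f y * g y) x.
Proof. by move=> hf hg i xi; exact: holM (hf i xi) (hg i xi). Qed.
Lemma holxX f n x : holx f x -> holx (fun y => f y ^+ n) x.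
Proof. by move=> hf i xi; exact: holX (hf i xi). Qed.
Lemma holxV f x : holx f x -> f x != 0 -> holx (fun y => (f y)^-1) x.
Proof.
move=> hf fx i xi; apply: holV (hf i xi) _.
by rewrite /= chartK.
Qed.

Lemma holx_sum (I : Type) (r : seq I) (P : pred I) (F : I -> X -> Cx R) x :
  (forall k : I, P k -> holx (F k) x) -> holx (fun y => \sum_(k <- r | P k) F k y) x.
Proof.
by move=> hF i xi; have := @hol_sum R I r P (fun k => F k \o chart_inv i) (chart i x)
  (fun k Pk => hF k Pk i xi); exact.
Qed.

Lemma holx_mx m n (A : X -> 'M[Cx R]_(m, n)) i x : chart_dom i x ->
  (forall a b, holx (fun y => A y a b) x) <-> mxhol (A \o chart_inv i) (chart i x).
Proof.
move=> xi; split=> [hA a b|hA a b]; first exact: (hA a b i xi).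
exact: (holx_chart xi (hA a b)).
Qed.

Lemma near_punctured i x (P : set X) : chart_dom i x ->
  (\forall z \near chart i x, z != chart i x -> P (chart_inv i z)) ->
  \forall y \near x, y <> x -> P y.
Proof.
move=> xi /(near_chart xi); apply: filterS2 (near_dom xi) => y yi.
rewrite chartK// => H yx; apply: H; apply/eqP => /(chart_inj yi xi).
exact: yx.
Qed.

Lemma punctured_near i x (P : set X) : chart_dom i x ->
  (\forall y \near x, y <> x -> P y) ->
  \forall z \near chart i x, z != chart i x -> P (chart_inv i z).
Proof.
move=> xi /(near_chart_inv xi); apply: filterS2 (near_img xi) => z [zi zE] H zx.
by apply: H => e; move: zx; rewrite -zE e eqxx.
Qed.

(** No point of X is isolated, because the charts have open images in the plane. *)
Lemma punctured_ex x (P : Prop) : (\forall y \near x, y <> x -> P) -> P.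
Proof.
have [i xi] := chart_cover x => /(@punctured_near i x (fun _ => P) xi).
exact: near_unique.
Qed.

Lemma holx_near_neq0 f x : holx f x -> f x != 0 -> \forall y \near x, f y != 0.
Proof.
move=> /holx_ex[i xi hf] fx.
have := near_neq0 (hol_cts hf); rewrite /= chartK// => /(_ fx)/(near_chart xi).
by apply: filterS2 (near_dom xi) => y yi; rewrite chartK.
Qed.

Lemma holx_onP f x : holx f x <-> exists U : set X, [/\ open U, U x & holo_on U f].
Proof.
split=> [/holx_nearby hf|[U [oU Ux hU]] i xi].
  exists (interior [set y | holx f y]); split; first exact: open_interior.
    exact: hf.
  by move=> i y /interior_subset hy yi; have /hol_derivable := hy i yi.
have /(near_chart_inv xi) : \forall y \near x, U y by apply: open_nbhs_nbhs.
apply: filterS2 (near_img xi) => z [zi zE] zU.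
by have := hU i _ zU zi; rewrite zE.
Qed.

Lemma holx_chart_id i x : chart_dom i x -> holx (chart i) x.
Proof. by move=> xi; apply: (holx_chart xi); exact: hol_transition. Qed.

(** [has_order] with neighbourhood filters in place of explicit open sets. *)
Definition ordx f x (m : int) := forall i, chart_dom i x -> exists g,
  [/\ holx g x, g x != 0 &
      \forall y \near x, y <> x -> f y = (chart i y - chart i x) ^ m * g y].

Lemma has_orderP f x m : has_order f x m <-> ordx f x m.
Proof.
split=> H i xi.
  have [U [g [oU Ux hg gx fE]]] := H i xi; exists g; split => //.
    by apply/holx_onP; exists U.
  have nU : \forall y \near x, U y by apply: open_nbhs_nbhs.
  by apply: filterS2 nU (near_dom xi) => y Uy yi yx; apply: fE.
have [g [/holx_onP[U [oU Ux hg]] gx fE]] := H i xi.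
exists (U `&` interior [set y | y <> x -> f y = (chart i y - chart i x) ^ m * g y]), g.
split => //.
- by apply: openI => //; exact: open_interior.
- by move=> j y [Uy _] yj; exact: hg.
- by move=> y [_ yE] _ yx; exact: (nbhs_singleton yE).
Qed.

(** u is the slope of one coordinate with respect to the other. It is non-zero at x, because its
    product with the slope of the inverse change of coordinates is 1 off x and continuous at x. *)
Lemma chart_ratio i j x : chart_dom i x -> chart_dom j x -> exists u : X -> Cx R,
  [/\ holx u x, u x != 0 &
      \forall y \near x, chart i y - chart i x = (chart j y - chart j x) * u y].
Proof.
move=> xi xj.
have [phi hphi phiE] := hol_slope (hol_transition xj xi).
have [psi hpsi psiE] := hol_slope (hol_transition xi xj).
exists (phi \o chart j); split.
- apply: (holx_chart xj); apply: hol_near hphi.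
  by apply: filterS (near_img xj) => z [_ zE] /=; rewrite zE.
- rewrite /=; apply/negP => /eqP phi0.
  have prod1 : \forall z \near chart j x, z != chart j x ->
      phi z * psi (chart i (chart_inv j z)) = 1.
    have nI := near_chart_inv xj (near_dom xi).
    apply: filterS2 nI (near_img xj) => z zi [_ zE] zx.
    have e1 := phiE z; have e2 := psiE (chart i (chart_inv j z)).
    rewrite /= !chartK// zE in e1 e2.
    have zx0 : z - chart j x != 0 by rewrite subr_eq0.
    move: e1 e2; set w := chart i (chart_inv j z) => e1 e2.
    have d1 : w - chart i x = phi z * (z - chart j x) by rewrite e1; ring.
    have d2 : z - chart j x = psi w * (w - chart i x) by rewrite {1}e2; ring.
    by apply: (mulIf zx0); rewrite mul1r [RHS]d2 d1; ring.
  have hprod : hol (fun z => phi z * psi (chart i (chart_inv j z))) (chart j x).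
    apply: holM; first exact: hphi.
    apply: (@hol_comp (chart i \o chart_inv j) psi).
      exact: hol_transition.
    by rewrite /= chartK.
  have /cts_cabsP/(_ 1 ltr01) := hol_cts hprod.
  rewrite phi0 mul0r => small; apply: (@near_unique R False (chart j x)).
  apply: filterS2 small prod1 => z lt1 E /E E1; move: lt1.
  by rewrite subr0 E1 cabs1 ltxx.
- apply: filterS (near_dom xj) => y yj; have := phiE (chart j y).
  by rewrite /= !chartK// => ->; rewrite addrAC subrr add0r mulrC.
Qed.

Lemma holxXz f x (m : int) : holx f x -> f x != 0 -> holx (fun y => f y ^ m) x.
Proof.
move=> hf fx; case: m => n; first exact: holxX.
by have := holxV (holxX n.+1 hf) (expf_neq0 _ fx); exact.
Qed.

Lemma ordx_chart i f x m g : chart_dom i x -> holx g x -> g x != 0 ->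
  (\forall y \near x, y <> x -> f y = (chart i y - chart i x) ^ m * g y) -> ordx f x m.
Proof.
move=> xi hg gx fE j xj; have [u [hu ux uE]] := chart_ratio xi xj.
exists (fun y => u y ^ m * g y); split.
- by apply: holxM; [exact: holxXz|exact: hg].
- by rewrite mulf_neq0// expfz_neq0.
- apply: filterS2 fE uE => y fE uE /fE ->.
  by rewrite uE expfzMl mulrA.
Qed.

Lemma ordx_near f g x m : (\forall y \near x, y <> x -> f y = g y) ->
  ordx f x m -> ordx g x m.
Proof.
move=> fg H i xi; have [h [hh hx fE]] := H i xi; exists h; split => //.
by apply: filterS2 fg fE => y e1 e2 yx; rewrite -e1// e2.
Qed.

Lemma near_chart_neq i x : chart_dom i x ->
  \forall y \near x, y <> x -> chart i y - chart i x != 0.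
Proof.
move=> xi; apply: filterS (near_dom xi) => y yi yx; rewrite subr_eq0.
by apply/eqP => /(chart_inj yi xi).
Qed.

Lemma ordxM f g x m n : ordx f x m -> ordx g x n -> ordx (fun y => f y * g y) x (m + n).
Proof.
move=> of_ og i xi; have [h [hh hx fE]] := of_ i xi; have [k [hk kx gE]] := og i xi.
exists (fun y => h y * k y); split; [exact: holxM|by rewrite mulf_neq0|].
apply: filterS3 fE gE (near_chart_neq xi) => y e1 e2 e3 yx.
by rewrite e1// e2// expfzDr ?e3//; ring.
Qed.

Lemma ordxV f x m : ordx f x m -> ordx (fun y => (f y)^-1) x (- m).
Proof.
move=> of_ i xi; have [h [hh hx fE]] := of_ i xi.
exists (fun y => (h y)^-1); split; [exact: holxV|by rewrite invr_eq0|].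
by apply: filterS fE => y e1 yx; rewrite e1// invfM invr_expz.
Qed.

Lemma ordx_unit f x : holx f x -> f x != 0 -> ordx f x 0.
Proof.
move=> hf fx i xi; exists f; split=> //.
by apply: filterE => y _; rewrite expr0z mul1r.
Qed.

Lemma ordxX f x m n : ordx f x m -> ordx (fun y => f y ^+ n) x (m *+ n).
Proof.
move=> of_; elim: n => [|n IH].
  by rewrite mulr0n; apply: ordx_unit; [exact: holx_cst|rewrite expr0 oner_eq0].
rewrite mulrS; apply: ordx_near (ordxM of_ IH).
by apply: filterE => y _; rewrite exprS.
Qed.

Lemma holx_ord f x : holx f x -> (\forall y \near x, y <> x -> f y != 0) ->
  exists n : nat, ordx f x n%:Z.
Proof.
move=> /holx_ex[i xi hf] nz.
have [[m [g [hg gx fE]]]|f0] := hol_order hf; last first.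
  exfalso; apply: (@punctured_ex x False).
  have := near_chart xi f0; apply: filterS3 nz (near_dom xi) => y nzy yi.
  by rewrite /= chartK// => e yx; move: (nzy yx); rewrite e eqxx.
have hgi : holx (g \o chart i) x.
  apply: (holx_chart xi); apply: hol_near hg.
  by apply: filterS (near_img xi) => z [_ zE] /=; rewrite zE.
have fEi : \forall y \near x, y <> x -> f y = (chart i y - chart i x) ^ m%:Z * (g \o chart i) y.
  by apply: filterS (near_dom xi) => y yi _; have := fE (chart i y); rewrite /= chartK.
by exists m; exact: (ordx_chart xi hgi gx fEi).
Qed.

Lemma near_neq x y : y <> x -> \forall z \near y, z <> x.
Proof.
move=> yx; apply: open_nbhs_nbhs; split=> //.
rewrite (_ : (fun z => z <> x) = ~` [set x])//.
by apply: closed_openC; apply: accessible_closed_set1; exact/hausdorff_accessible/rs_hausdorff.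
Qed.

(** At a point y near x and different from it, the factor with exponent m is a unit, so f agrees
    near y with a unit, and a unit has no factor vanishing at y. *)
Lemma ordx_isolated f x m : ordx f x m ->
  \forall y \near x, y <> x -> forall k, ordx f y k -> k = 0.
Proof.
have [i xi] := chart_cover x => /(_ i xi)[g [hg gx fE]].
have hfE := near_join fE.
apply: filterS3 (holx_nearby hg) (holx_near_neq0 hg gx) (filterI (near_dom xi) hfE).
move=> y hgy gy [yi fEy] yx k ofk.
have [h [hh hy fEk]] := ofk i yi.
have yxi : chart i y - chart i x != 0.
  by rewrite subr_eq0; apply/eqP => /(chart_inj yi xi).
pose F y' := (chart i y' - chart i x) ^ m * g y'.
have hci : holx (fun y' => chart i y' - chart i x) y.
  by apply: holxD; [exact: holx_chart_id|exact: holx_cst].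
have hF : holx F y by apply: holxM; [exact: (holxXz m hci yxi)|exact: hgy].
have Fy : F y != 0 by rewrite mulf_neq0// expfz_neq0.
have ny := near_neq yx.
have FE : \forall y' \near y, y' <> y -> F y' = (chart i y' - chart i y) ^ k * h y'.
  by apply: filterS3 fEy ny fEk => y' e1 ne e2 yy; rewrite -e2// e1.
have aux (p : nat) (A B : X -> Cx R) : holx A y -> A y != 0 -> holx B y ->
    (\forall y' \near y, y' <> y -> A y' = (chart i y' - chart i y) ^+ p.+1 * B y') -> False.
  move=> hA Ay hB AE; apply: (@punctured_ex y False).
  pose D y' := A y' - (chart i y' - chart i y) ^+ p.+1 * B y'.
  have hD : holx D y.
    apply: holxD; first exact: hA.
    have -> : (fun x0 => - ((chart i x0 - chart i y) ^+ p.+1 * B x0)) =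
      (fun x0 => (-1) * ((chart i x0 - chart i y) ^+ p.+1 * B x0)).
      by apply/funext => y'; rewrite mulN1r.
    apply: holxM; first exact: holx_cst.
    apply: holxM; [apply: holxX; apply: holxD; last exact: holx_cst|exact: hB].
    exact: holx_chart_id.
  have Dy : D y != 0 by rewrite /D subrr expr0n mul0r subr0.
  apply: filterS2 (holx_near_neq0 hD Dy) AE => y' nz e yy.
  by move: nz; rewrite /D e// subrr eqxx.
case: k FE {ofk fEk} => [[//|p]|p] FE; exfalso.
  exact: (aux p F h hF Fy hh).
(* For negative k the two units F and h exchange their roles. *)
apply: (aux p h F hh hy hF); apply: filterS2 FE (near_chart_neq yi) => y' e ne yy.
by rewrite e// NegzE -exprnN mulrA mulfV ?mul1r// expf_neq0// ne.
Qed.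

Hypothesis X_compact : compact [set: X].

(** f may depend on x because a section of a determinant bundle is a different function in each
    frame. *)
Lemma ordx_finite (nu : X -> int) :
  (forall x, exists f, \forall y \near x, ordx f y (nu y)) ->
  finite_set [set x | nu x != 0].
Proof.
move=> H; apply: (compact_discrete_finite X_compact) => x.
have [f fnu] := H x; have := ordx_isolated (nbhs_singleton fnu).
by apply: filterS2 fnu => y oy iso yx /=; rewrite (iso yx _ oy) eqxx.
Qed.

End Surface.

(** * Frames and Gram matrices *)

Section Frames.
Variables (R : realType) (X : riemann_surface R) (E : vbundle X) (m : nat) (eE : m = rk E).
Implicit Types (x y : X) (j k : triv_index E).

(** Frames are indexed by a number m equal to the rank; this permits m = r + q for V and m = 1 for
    L, so that block decompositions and 1 by 1 matrices apply directly. *)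
Definition fr j y (a : 'I_m) : fiber E y := tnth (frame j y) (cast_ord eE a).
Definition cv j y (v : fiber E y) : 'rV[Cx R]_m := \row_a coord (frame j y) (cast_ord eE a) v.
Definition vec j y (u : 'rV[Cx R]_m) : fiber E y := \sum_a u 0 a *: fr j y a.
Definition tr j k y : 'M[Cx R]_m := \matrix_(a, b) coord (frame k y) (cast_ord eE b) (fr j y a).

Lemma frE j y a : fr j y a = (frame j y)`_(cast_ord eE a).
Proof. by rewrite /fr (tnth_nth 0). Qed.

Lemma cast_sum (V : zmodType) (F : 'I_(rk E) -> V) :
  \sum_a F a = \sum_(a < m) F (cast_ord eE a).
Proof. by rewrite (reindex (cast_ord eE))//; exists (cast_ord (esym eE)) => i _; rewrite ?cast_ordK ?cast_ordKV. Qed.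

Lemma vecK j y : triv_dom j y -> cancel (vec j y) (@cv j y).
Proof.
move=> /frame_basis/basis_free frj u; apply/rowP => a; rewrite mxE.
pose k (i : 'I_(rk E)) := u 0 (cast_ord (esym eE) i).
have -> : vec j y u = \sum_(i < rk E) k i *: (frame j y)`_i.
  by rewrite cast_sum; apply: eq_bigr => i _; rewrite frE /k cast_ordK.
by rewrite coord_sum_free// /k cast_ordK.
Qed.

Lemma cvK j y : triv_dom j y -> cancel (@cv j y) (vec j y).
Proof.
move=> /frame_basis frj v; rewrite {2}(coord_basis frj (memvf v)) cast_sum.
by apply: eq_bigr => a _; rewrite mxE frE.
Qed.

Lemma vec_linear j y (A : Cx R) u v : vec j y (A *: u + v) = A *: vec j y u + vec j y v.
Proof.
rewrite /vec scaler_sumr -big_split/=; apply: eq_bigr => a _.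
by rewrite !mxE scalerDl scalerA.
Qed.

Lemma vec0 j y : vec j y 0 = 0.
Proof. by rewrite /vec big1// => a _; rewrite mxE scale0r. Qed.

Lemma vec_sum j y (I : Type) (r : seq I) (A : I -> Cx R) (u : I -> 'rV[Cx R]_m) :
  vec j y (\sum_(i <- r) A i *: u i) = \sum_(i <- r) A i *: vec j y (u i).
Proof.
by elim: r => [|i r IH]; rewrite ?big_nil ?vec0// !big_cons vec_linear IH.
Qed.

Lemma vecM j y p (A : 'rV[Cx R]_p) (M : 'M[Cx R]_(p, m)) :
  vec j y (A *m M) = \sum_a A 0 a *: vec j y (row a M).
Proof. by rewrite mulmx_sum_row vec_sum. Qed.

Lemma vec_row1 j y a : vec j y (row a 1%:M) = fr j y a.
Proof.
rewrite /vec (bigD1 a)//= !mxE eqxx scale1r big1 ?addr0// => b ba.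
by rewrite !mxE eq_sym (negbTE ba) scale0r.
Qed.

Lemma cv_fr j k y a : cv k (fr j y a) = row a (tr j k y).
Proof. by apply/rowP => b; rewrite !mxE. Qed.

Lemma cv_sum k y (I : Type) (r : seq I) (A : I -> Cx R) (v : I -> fiber E y) :
  cv k (\sum_(i <- r) A i *: v i) = \sum_(i <- r) A i *: cv k (v i).
Proof.
apply/rowP => b; rewrite mxE linear_sum summxE/=; apply: eq_bigr => i _.
by rewrite linearZ !mxE.
Qed.

Lemma cv_tr j k y (v : fiber E y) : triv_dom j y -> cv k v = cv j v *m tr j k y.
Proof.
move=> yj; rewrite -{1}(cvK yj v) cv_sum mulmx_sum_row.
by apply: eq_bigr => a _; rewrite cv_fr.
Qed.

Lemma cv_vec_tr j k y u : triv_dom j y -> cv k (vec j y u) = u *m tr j k y.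
Proof. by move=> yj; rewrite (cv_tr k _ yj) vecK. Qed.

Lemma tr_id j y : triv_dom j y -> tr j j y = 1%:M.
Proof.
move=> yj; apply/row_matrixP => a.
by rewrite -cv_fr -vec_row1 vecK.
Qed.

Lemma tr_comp j k l y : triv_dom j y -> triv_dom k y -> tr j k y *m tr k l y = tr j l y.
Proof.
move=> yj yk; apply/row_matrixP => a; rewrite row_mul -!cv_fr.
by rewrite -cv_tr.
Qed.

Lemma det_tr_neq0 j k y : triv_dom j y -> triv_dom k y -> \det (tr j k y) != 0.
Proof.
move=> yj yk; have := congr1 determinant (tr_comp j yj yk).
rewrite tr_id// det1 det_mulmx => e; apply/eqP => d0.
by move/eqP: e; rewrite d0 mul0r eq_sym oner_eq0.
Qed.

Lemma det_tr_transition j k y : \det (tr j k y) = \det (transition j k y).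
Proof.
rewrite /tr /transition /fr; move: (frame j y) (frame k y) => tj tk.
by case: (rk E) / eE tj tk => tj tk; congr determinant; apply/matrixP => a b; rewrite !mxE !cast_ord_id.
Qed.

Lemma tr_hol j k x a b : triv_dom j x -> triv_dom k x -> holx (fun y => tr j k y a b) x.
Proof.
move=> xj xk; have hf := @frame_holo R X E j k (cast_ord eE a) (cast_ord eE b).
have hx : holx (fun y => coord (frame k y) (cast_ord eE b) (tnth (frame j y) (cast_ord eE a))) x.
  apply/holx_onP; exists (triv_dom j `&` triv_dom k); split => //.
  by apply: openI; exact: triv_dom_open.
by apply: holx_near hx; apply: filterE => y; rewrite mxE.
Qed.

Lemma near_triv j x : triv_dom j x -> \forall y \near x, triv_dom j y.
Proof. by move=> xj; apply: open_nbhs_nbhs; split => //; exact: triv_dom_open. Qed.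

Lemma free_vec j y p (M : 'M[Cx R]_(p, m)) : triv_dom j y -> row_free M ->
  free [tuple vec j y (row a M) | a < p].
Proof.
move=> yj freeM; apply/freeP => k.
under eq_bigr => i _ do rewrite -(tnth_nth 0) tnth_mktuple.
move=> e i; pose A : 'rV[Cx R]_p := \row_i k i.
have : vec j y (A *m M) = 0.
  by rewrite vecM -[RHS]e; apply: eq_bigr => a _; rewrite mxE.
move/(congr1 (@cv j y)); rewrite vecK//.
have -> : cv j (0 : fiber E y) = 0 by rewrite -(vec0 j y) vecK.
move/eqP; rewrite mulmx_free_eq0// => /eqP A0.
by have := congr1 (fun B : 'rV[Cx R]_p => B 0 i) A0; rewrite !mxE.
Qed.

Lemma row_free_cv j y (U : {vspace fiber E y}) : triv_dom j y ->
  row_free (\matrix_(a < \dim U) cv j (tnth (vbasis U) a)).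
Proof.
move=> yj; apply/row_freeP.
have /freeP fU := basis_free (vbasisP U).
pose M : 'M[Cx R]_(\dim U, m) := \matrix_(a < \dim U) cv j (tnth (vbasis U) a).
suff : kermx M = 0 by rewrite -/M => /eqP; rewrite kermx_eq0 => /row_freeP.
apply/row_matrixP => c; rewrite row0; set A := row c _.
have : A *m M = 0 by rewrite /A -row_mul mulmx_ker row0.
rewrite mulmx_sum_row => e; apply/rowP => a; rewrite [RHS]mxE.
apply: (fU (fun a => A 0 a)).
have := congr1 (vec j y) e; rewrite vec_sum vec0 => e'; apply: etrans e'.
by apply: eq_bigr => b _; rewrite rowK cvK// (tnth_nth 0).
Qed.

End Frames.

(** * Gram matrices of the form *)

Lemma bilinear_entry (K : comNzRingType) p m (A : 'M[K]_(p, m)) (B : 'M[K]_m) a b :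
  (A *m B *m A^T) a b = (row a A *m B *m (row b A)^T) 0 0.
Proof.
rewrite [LHS]mxE [RHS]mxE; apply: eq_bigr => c _; rewrite !mxE; congr (_ * _).
by apply: eq_bigr => d _; rewrite !mxE.
Qed.

Section Gram.
Variables (R : realType) (X : riemann_surface R) (L : vbundle X) (V : quadric_bundle L).
Variables (m : nat) (eV : m = rk V) (eL : 1%N = rk L).
Implicit Types (x y : X) (j k : triv_index V) (l : triv_index L).

Definition gram j l y : 'M[Cx R]_m :=
  \matrix_(a, b) cv eL l (qform V y (fr eV j y a) (fr eV j y b)) 0 0.

Lemma gram_hol j l x a b : triv_dom j x -> triv_dom l x -> holx (fun y => gram j l y a b) x.
Proof.
move=> xj xl; have hf := @qform_holo R X L V j (cast_ord eV a) (cast_ord eV b) l (cast_ord eL 0).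
have hx := (holx_onP _ x).2 (ex_intro _ _ (And3 (openI (triv_dom_open j) (triv_dom_open l)) (conj xj xl) hf)).
by apply: holx_near hx; apply: filterE => y; rewrite !mxE.
Qed.

Lemma gramE j l y (u v : fiber V y) : triv_dom j y ->
  cv eL l (qform V y u v) = cv eV j u *m gram j l y *m (cv eV j v)^T.
Proof.
move=> yj.
have -> : qform V y u v = \sum_a cv eV j u 0 a *:
    \sum_b cv eV j v 0 b *: qform V y (fr eV j y a) (fr eV j y b).
  rewrite -{1}(cvK eV yj u) {1}/vec linear_sum sum_lfunE; apply: eq_bigr => a _.
  rewrite linearZ scale_lfunE; congr (_ *: _).
  rewrite -{1}(cvK eV yj v) {1}/vec linear_sum; apply: eq_bigr => b _.
  by rewrite linearZ.
rewrite cv_sum; apply/rowP => c; rewrite (ord1 c) summxE -mulmxA mxE.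
apply: eq_bigr => a _; rewrite mxE; congr (_ * _).
rewrite cv_sum summxE mxE; apply: eq_bigr => b _.
by rewrite !mxE mulrC.
Qed.

Lemma fiber_eq0 (E : vbundle X) (p : nat) (eE : p = rk E) (k : triv_index E) y (v : fiber E y) :
  triv_dom k y -> cv eE k v = 0 -> v = 0.
Proof. by move=> yk v0; rewrite -(cvK eE yk v) v0 vec0. Qed.

Lemma qform_eq0 j l y (u : fiber V y) : triv_dom j y -> triv_dom l y ->
  qform V y u = 0 <-> cv eV j u *m gram j l y = 0.
Proof.
move=> yj yl; split=> [u0|u0].
  apply/rowP => b; have := gramE l u (fr eV j y b) yj.
  rewrite u0 lfunE/= -(vec_row1 eV j y b) (vecK eV yj) row1 trmx_delta -colE.
  move/(congr1 (fun M : 'M_1 => M 0 0)); rewrite [RHS]mxE => <-.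
  by rewrite !mxE linear0.
apply/lfunP => v; rewrite lfunE/=; apply: (fiber_eq0 (eE := eL) yl).
by rewrite (gramE _ _ _ yj) u0 mul0mx.
Qed.

Lemma gram_sym j l y : (gram j l y)^T = gram j l y.
Proof. by apply/matrixP => a b; rewrite !mxE qform_sym. Qed.

Lemma gram_tr j k l l' y : triv_dom j y -> triv_dom k y -> triv_dom l y ->
  tr eL l l' y 0 0 *: gram j l y = tr eV j k y *m gram k l' y *m (tr eV j k y)^T.
Proof.
move=> yj yk yl; apply/matrixP => a b.
have := gramE l' (fr eV j y a) (fr eV j y b) yk.
rewrite (cv_tr eL l' _ yl) !(cv_fr eV) => /(congr1 (fun M : 'M_1 => M 0 0)).
rewrite mxE big_ord1 mulrC => e.
have -> : (tr eL l l' y 0 0 *: gram j l y) a b =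
  tr eL l l' y 0 0 * cv eL l (qform V y (fr eV j y a) (fr eV j y b)) 0 0 by rewrite !mxE.
by rewrite e [RHS]bilinear_entry.
Qed.

End Gram.

(** * Adapted bases and the generic rank *)

Lemma det_castmx (K : comNzRingType) m n (e : m = n) (A : 'M[K]_m) :
  \det (castmx (e, e) A) = \det A.
Proof. by case: n / e; rewrite castmx_id. Qed.

Lemma castmx_mul (K : comNzRingType) m n (e : m = n) (A B : 'M[K]_m) :
  castmx (e, e) A *m castmx (e, e) B = castmx (e, e) (A *m B).
Proof. by case: n / e; rewrite !castmx_id. Qed.

Lemma rank_castmx (K : fieldType) m n m' n' (e : (m = m') * (n = n')) (A : 'M[K]_(m, n)) :
  \rank (castmx e A) = \rank A.
Proof. by case: e => e1 e2; case: m' / e1; case: n' / e2; rewrite castmx_id. Qed.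

Section GenericRank.
Variables (R : realType) (X : riemann_surface R) (L : vbundle X) (V : quadric_bundle L).
Variables (eL : 1%N = rk L).
Implicit Types (x y : X).

Lemma tr_line_neq0 (l l' : triv_index L) y : triv_dom l y -> triv_dom l' y ->
  tr eL l l' y 0 0 != 0.
Proof. by move=> yl yl'; have := det_tr_neq0 eL yl yl'; rewrite det_mx11. Qed.

Lemma rank_gram m (eV : m = rk V) (j k : triv_index V) (l l' : triv_index L) y :
  triv_dom j y -> triv_dom k y -> triv_dom l y -> triv_dom l' y ->
  \rank (gram eV eL j l y) = \rank (gram eV eL k l' y).
Proof.
move=> yj yk yl yl'.
have := gram_tr eV eL l' yj yk yl; have := tr_line_neq0 yl yl'.
have Tu : row_free (tr eV j k y)^T by rewrite row_free_unit unitmx_tr unitmxE unitfE det_tr_neq0.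
move=> t0 /(congr1 (fun M => \rank M)); rewrite mxrank_scale_nz// => ->.
by rewrite mxrankMfree// -[LHS]mxrank_tr trmx_mul mxrankMfree// mxrank_tr.
Qed.

(* A moving basis of V near a point: the rows of index at least r of [kd_Q] are
   the coordinates, in the frame [kd_j], of a basis of the saturated kernel. *)
Record kdata m := KData {
  kd_j : triv_index V;
  kd_l : triv_index L;
  kd_U : set X;
  kd_Q : X -> 'M[Cx R]_m
}.

Definition kdata_ok m (eV : m = rk V) (r : nat) x (D : kdata m) : Prop :=
  [/\ open (kd_U D), kd_U D x,
      forall y, kd_U D y -> triv_dom (kd_j D) y /\ triv_dom (kd_l D) y,
      forall y, kd_U D y -> \det (kd_Q D y) != 0 /\
        forall a b, holx (fun y' => kd_Q D y' a b) y &
      forall y, kd_U D y ->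
        (forall (a b : 'I_m), (r <= a)%N -> (kd_Q D y *m gram eV eL (kd_j D) (kd_l D) y) a b = 0) /\
        (y <> x -> \rank (gram eV eL (kd_j D) (kd_l D) y) = r)].

(** Row reduction of the Gram matrix in a chart at x. Each required property holds near x, and the
    open set is the interior of the set where all of them hold. *)
Lemma kdata_exists m (eV : m = rk V) x : exists r D, (r <= m)%N /\ kdata_ok eV r x D.
Proof.
have [j xj] := @triv_cover _ _ V x; have [l xl] := @triv_cover _ _ L x.
have [i xi] := chart_cover x.
have hG : mxhol (gram eV eL j l \o chart_inv i) (chart i x).
  by apply/(holx_mx _ xi) => a b; exact: gram_hol.
have [Q [r [hQ Qx rm Qr rk]]] := row_echelon hG.
have hQx : forall a b, holx (fun y => (Q \o chart i) y a b) x.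
  apply/(holx_mx _ xi) => a b; apply: hol_near (hQ a b).
  by apply: filterS (near_img xi) => z [_ zE] /=; rewrite zE.
pose P y := [/\ triv_dom j y /\ triv_dom l y, \det ((Q \o chart i) y) != 0,
  forall a b, holx (fun y => (Q \o chart i) y a b) y,
  forall (a b : 'I_m), (r <= a)%N -> ((Q \o chart i) y *m gram eV eL j l y) a b = 0 &
  y <> x -> \rank (gram eV eL j l y) = r].
have nP : \forall y \near x, P y.
  have n1 : \forall y \near x, triv_dom j y /\ triv_dom l y.
    by apply: filterS2 (near_triv xj) (near_triv xl).
  have n2 : \forall y \near x, \det ((Q \o chart i) y) != 0.
    by apply: (near_chart xi (P := fun z => \det (Q z) != 0)); exact: near_neq0 (hol_cts (hol_det hQ)) Qx.
  have n3 : \forall y \near x, forall a b, holx (fun y => (Q \o chart i) y a b) y.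
    have H a : \forall y \near x, forall b, holx (fun y => (Q \o chart i) y a b) y.
      have H' b := holx_nearby (hQx a b).
      by have := @filter_forall _ _ (fun b y => holx (fun y => (Q \o chart i) y a b) y) (nbhs x) _ H'; exact.
    by have := @filter_forall _ _ (fun a y => forall b, holx (fun y => (Q \o chart i) y a b) y) (nbhs x) _ H; exact.
  have n4 : \forall y \near x, forall (a b : 'I_m), (r <= a)%N -> ((Q \o chart i) y *m gram eV eL j l y) a b = 0.
    have := near_chart xi Qr; apply: filterS2 (near_dom xi) => y yi H a b ra.
    by have := H a b ra; rewrite /= chartK.
  have n5 := near_punctured (P := fun y => \rank (gram eV eL j l y) = r) xi rk.
  apply: filterS3 n1 n2 (filterI n3 (filterI n4 n5)) => y ? ? [? [? ?]]; by split.
exists r, (KData j l (interior P) (Q \o chart i)); split; first exact: rm.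
split => /=; [exact: open_interior|exact: nP| | | ].
- by move=> y /nbhs_singleton[].
- by move=> y /nbhs_singleton[].
- by move=> y /nbhs_singleton[].
Qed.

(** Both numbers are the rank of gamma at one point near y and different from the two centres. *)
Lemma kdata_rank m (eV : m = rk V) r r' x y D D' :
  kdata_ok eV r x D -> kdata_ok eV r' y D' -> kd_U D y -> r = r'.
Proof.
move=> [oU Ux Udom _ UG] [oU' Uy' Udom' _ UG'] Uy; apply: (@punctured_ex _ X y).
have nU : \forall z \near y, kd_U D z by apply: open_nbhs_nbhs.
have nU' : \forall z \near y, kd_U D' z by apply: open_nbhs_nbhs.
have nx : \forall z \near y, z <> y -> z <> x.
  have [->|/near_neq] := pselect (y = x); first exact: filterE.
  by apply: filterS.
apply: filterS3 nU nU' nx => z Uz Uz' zx zy.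
have [_ <-] := UG z Uz; last exact: zx.
have [_ <-] := UG' z Uz'; last exact: zy.
by have [? ?] := Udom z Uz; have [? ?] := Udom' z Uz'; exact: rank_gram.
Qed.

(** By [kdata_rank] the local generic rank is locally constant, so the points where it equals r form
    an open and closed set, and X is connected. *)
Lemma generic_rank m (eV : m = rk V) (x0 : X) : exists2 r, (r <= m)%N &
  forall x, exists D, kdata_ok eV r x D.
Proof.
have [r [D0 [rm ok0]]] := kdata_exists eV x0; exists r => //.
pose A := [set x | exists D, kdata_ok eV r x D].
have AU r' x D y : kdata_ok eV r' x D -> kd_U D y -> A y -> r' = r.
  by move=> ok Uy [D' ok']; exact: kdata_rank ok ok' Uy.
have oA : open A.
  rewrite openE => x [D ok]; have [oU Ux _ _ _] := ok.
  have : \forall y \near x, kd_U D y by apply: open_nbhs_nbhs.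
  apply: filterS => y Uy; have [r' [D' [_ ok']]] := kdata_exists eV y.
  have e := kdata_rank ok ok' Uy; rewrite -e in ok'; by exists D'.
have cA : closed A.
  rewrite -(setCK A); apply: open_closedC; rewrite openE => x nAx.
  have [r' [D [_ ok]]] := kdata_exists eV x; have [oU Ux _ _ _] := ok.
  have : \forall y \near x, kd_U D y by apply: open_nbhs_nbhs.
  apply: filterS => y Uy Ay; apply: nAx; exists D.
  by have e := AU _ _ _ _ ok Uy Ay; rewrite e in ok.
have AT : A = setT.
  apply: (@rs_connected _ X); first by exists x0, D0.
    by exists A => //; rewrite setTI.
  by exists A => //; rewrite setTI.
by move=> x; have : A x by rewrite AT.
Qed.

Lemma gram_cast m (eV : m = rk V) (j : triv_index V) (l : triv_index L) y :
  gram eV eL j l y = castmx (esym eV, esym eV) (gram erefl eL j l y).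
Proof.
apply/matrixP => a b; rewrite castmxE !mxE /= !esymK /fr !cast_ord_id.
by [].
Qed.

Lemma kdata_cast m (eV : m = rk V) r x (D : kdata (rk V)) : kdata_ok erefl r x D ->
  kdata_ok eV r x (KData (kd_j D) (kd_l D) (kd_U D) (fun y => castmx (esym eV, esym eV) (kd_Q D y))).
Proof.
move=> [oU Ux Udom UQ UG]; split=> //= y Uy.
  have [dQ hQ] := UQ y Uy; rewrite det_castmx; split=> // a b.
  by apply: holx_near (hQ (cast_ord eV a) (cast_ord eV b)); apply: filterE => y'; rewrite castmxE /= !esymK.
have [QG rG] := UG y Uy; split=> [a b ra|/rG <-]; last by rewrite gram_cast rank_castmx.
rewrite gram_cast castmx_mul; rewrite castmxE; exact: QG.
Qed.

(** For r = 0 all rows of Q G vanish at every point, the centres included; as Q is invertible, gamma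
    would be 0. *)
Lemma generic_rank_gt0 m (eV : m = rk V) r : (forall x, exists D, kdata_ok eV r x D) -> (0 < r)%N.
Proof.
case: r => // ok0; exfalso.
have [x /eqP] := qform_neq0 V; apply; have [D [_ Ux Udom UQ UG]] := ok0 x.
have [xj xl] := Udom x Ux; have [QG _] := UG x Ux; have [dQ _] := UQ x Ux.
apply/lfunP => u; rewrite lfunE/=; apply/(qform_eq0 eV eL u xj xl).
have Qu : kd_Q D x \in unitmx by rewrite unitmxE unitfE.
have QG0 : kd_Q D x *m gram eV eL (kd_j D) (kd_l D) x = 0.
  by apply/matrixP => a b; rewrite QG// mxE.
by rewrite -(mulKmx Qu (gram _ _ _ _ _)) QG0 !mulmx0.
Qed.

End GenericRank.

(** * The kernel subbundle and its degree *)

Section KernelBundle.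
Variables (R : realType) (X : riemann_surface R) (L : vbundle X) (V : quadric_bundle L).
Variables (eL : 1%N = rk L) (r q : nat) (eV : (r + q)%N = rk V).
Variable D : X -> kdata V (r + q).
Hypothesis okD : forall x, kdata_ok eL eV r x (D x).
Implicit Types (x y : X).

Let J x := kd_j (D x).
Let l x := kd_l (D x).
Let U x := kd_U (D x).
Let Q x y := kd_Q (D x) y.
Let Qb x y : 'M[Cx R]_(q, r + q) := dsubmx (Q x y).
Let G x y := gram eV eL (J x) (l x) y.

Let U_open x : open (U x). Proof. by have [] := okD x. Qed.
Let U_center x : U x x. Proof. by have [] := okD x. Qed.
Let U_J x y : U x y -> triv_dom (J x) y.
Proof. by have [_ _ H _ _] := okD x; move/H => []. Qed.
Let U_l x y : U x y -> triv_dom (l x) y.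
Proof. by have [_ _ H _ _] := okD x; move/H => []. Qed.
Let Q_det x y : U x y -> \det (Q x y) != 0.
Proof. by have [_ _ _ H _] := okD x; move/H => []. Qed.
Let Q_unit x y : U x y -> Q x y \in unitmx.
Proof. by move=> Uxy; rewrite unitmxE unitfE Q_det. Qed.
Let Q_hol x y a b : U x y -> holx (fun y' => Q x y' a b) y.
Proof. by have [_ _ _ H _] := okD x; move/H => [_]; exact. Qed.

Lemma ker_rows x y : U x y -> Qb x y *m G x y = 0.
Proof.
have [_ _ _ _ H] := okD x => /H[H0 _]; apply/matrixP => a b.
have e := H0 (rshift r a) b (leq_addr _ _).
rewrite [RHS]mxE -[RHS]e [LHS]mxE [RHS]mxE; apply: eq_bigr => c _.
by rewrite mxE.
Qed.

Lemma rank_G x y : U x y -> y <> x -> \rank (G x y) = r.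
Proof. by have [_ _ _ _ H] := okD x => /H[_]; exact. Qed.

Lemma Qb_invmx x y : U x y -> Qb x y *m invmx (Q x y) = row_mx 0 1%:M.
Proof.
move=> Uxy; have : Q x y *m invmx (Q x y) = 1%:M by rewrite mulmxV ?Q_unit.
rewrite -{1}(vsubmxK (Q x y)) mul_col_mx scalar_mx_block => e.
by have := congr1 dsubmx e; rewrite col_mxKd /block_mx col_mxKd.
Qed.

Lemma Qb_free x y : U x y -> row_free (Qb x y).
Proof.
move=> Uxy; apply/row_freeP; exists (invmx (Q x y) *m col_mx 0 1%:M).
by rewrite mulmxA Qb_invmx// mul_row_col mulmx0 add0r mul1mx.
Qed.

Definition ksec x a y : fiber V y := vec eV (J x) y (row a (Qb x y)).
(* [kspace y] is the kernel at generic points only; at the others, where the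
   kernel is larger, it is its limit. *)
Definition kspace y : {vspace fiber V y} := <<[tuple ksec y a y | a < q]>>%VS.

Lemma ksec_free x y : U x y -> free [tuple ksec x a y | a < q].
Proof. by move=> Uxy; apply: free_vec; [exact: U_J|exact: Qb_free]. Qed.

Lemma qform_ksec x a y : U x y -> qform V y (ksec x a y) = 0.
Proof.
move=> Uxy; apply/(qform_eq0 eV eL _ (U_J Uxy) (U_l Uxy)).
by rewrite /ksec (vecK eV (U_J Uxy)) -row_mul ker_rows// row0.
Qed.

Lemma dim_lker_le x y : U x y -> y <> x -> (\dim (lker (qform V y)) <= q)%N.
Proof.
move=> Uxy yx; have := row_free_cv eV (lker (qform V y)) (U_J Uxy).
set M := \matrix_(a < _) _; rewrite /row_free => /eqP rM.
have MG : M *m G x y = 0.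
  apply/row_matrixP => a; rewrite row_mul rowK row0.
  apply/(qform_eq0 eV eL _ (U_J Uxy) (U_l Uxy)).
  by have := vbasis_mem (mem_tnth a (vbasis (lker (qform V y)))); rewrite memv_ker => /eqP.
have := mulmx0_rank_max MG; rewrite rM rank_G//.
by rewrite addnC leq_add2l.
Qed.

Lemma dim_kspan x y : U x y -> \dim <<[tuple ksec x a y | a < q]>> = q.
Proof. by move=> /ksec_free; rewrite /free => /eqP ->; rewrite size_tuple. Qed.

Lemma kspan_lker x y : U x y -> (<<[tuple ksec x a y | a < q]>> <= lker (qform V y))%VS.
Proof.
move=> Uxy; apply/span_subvP => v /tnthP[a ->].
by rewrite tnth_mktuple memv_ker qform_ksec.
Qed.

(** For y other than the centre x the rank at y is r, so that by dimension every adapted basis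
    defined at y spans the whole kernel, including the one that defines [kspace y]. *)
Lemma kspan_kspace x y : U x y -> <<[tuple ksec x a y | a < q]>>%VS = kspace y.
Proof.
move=> Uxy; have [->//|yx] := pselect (y = x).
have e z : U z y -> <<[tuple ksec z a y | a < q]>>%VS = lker (qform V y).
  move=> Uzy; apply/eqP; rewrite eqEdim kspan_lker// dim_kspan//.
  exact: dim_lker_le Uxy yx.
by rewrite e// /kspace e.
Qed.

Lemma ksec_kspace x a y : U x y -> ksec x a y \in kspace y.
Proof.
move=> Uxy; rewrite -(kspan_kspace Uxy); apply: memv_span.
by apply/tnthP; exists a; rewrite tnth_mktuple.
Qed.

Lemma dim_kspace y : \dim (kspace y) = q.
Proof. exact: dim_kspan. Qed.

Definition kfiber y : vectType (Cx R) := subvs_of (kspace y).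
Definition kframe x y : q.-tuple (kfiber y) := [tuple vsproj (kspace y) (ksec x a y) | a < q].

Lemma kframeE x y a : U x y -> vsval (tnth (kframe x y) a) = ksec x a y.
Proof. by move=> Uxy; rewrite tnth_mktuple vsprojK// ksec_kspace. Qed.

Lemma kframe_basis x y : U x y -> basis_of fullv (kframe x y).
Proof.
move=> Uxy; have dimf : \dim {:kfiber y} = q by rewrite dimvf -[RHS](dim_kspace y).
rewrite basisEfree size_tuple subvf dimf leqnn !andbT.
apply/freeP => k e; have /freeP := ksec_free Uxy; apply.
have := congr1 vsval e; rewrite linear0 linear_sum => e'; apply: etrans e'.
apply: eq_bigr => a _; rewrite linearZ -(tnth_nth 0) -(tnth_nth 0) !tnth_mktuple; congr (_ *: _).
by have := vsprojK (ksec_kspace a Uxy) => /esym; exact.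
Qed.

(** Coordinates in the kernel frame are the last q coordinates in the basis given by the rows of Q;
    in this form their holomorphy is visible. *)
Lemma kcoordE x y b (v : kfiber y) : U x y ->
  coord (kframe x y) b v = (cv eV (J x) (vsval v) *m invmx (Q x y)) 0 (rshift r b).
Proof.
move=> Uxy; pose c : 'rV[Cx R]_q := \row_a coord (kframe x y) a v.
have -> : cv eV (J x) (vsval v) = c *m Qb x y.
  rewrite -[RHS](vecK eV (U_J Uxy)) vecM; congr cv.
  rewrite {1}(coord_basis (kframe_basis Uxy) (memvf v)) linear_sum.
  apply: eq_bigr => a _; rewrite linearZ mxE -(tnth_nth 0); congr (_ *: _).
  exact: kframeE.
by rewrite -mulmxA Qb_invmx// mul_mx_row mulmx0 mulmx1 row_mxEr mxE.
Qed.

Lemma cv_ksec_hol x a (k : triv_index V) y b : U x y -> triv_dom k y ->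
  holx (fun y => cv eV k (ksec x a y) 0 b) y.
Proof.
move=> Uxy yk; apply: (@holx_near _ _ (fun y => \sum_c Q x y (rshift r a) c * tr eV (J x) k y c b)).
  have nU : \forall y' \near y, U x y' by apply: open_nbhs_nbhs; split.
  apply: filterS nU => y' Uxy'; rewrite /ksec (cv_vec_tr eV _ _ (U_J Uxy')) mxE.
  by apply: eq_bigr => c _; rewrite !mxE.
apply: holx_sum => c _; apply: holxM; first exact: Q_hol.
by apply: tr_hol => //; exact: U_J.
Qed.

Lemma kframe_holo x x' a b :
  holo_on (U x `&` U x') (fun y => coord (kframe x' y) b (tnth (kframe x y) a)).
Proof.
have H y : U x y -> U x' y -> holx (fun y => coord (kframe x' y) b (tnth (kframe x y) a)) y.
  move=> Uxy Ux'y.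
  have [i yi] := chart_cover y.
  have hinv : forall c d, holx (fun y => invmx (Q x' y) c d) y.
    apply/(holx_mx (fun y => invmx (Q x' y)) yi); apply: mxhol_inv.
      by apply/(holx_mx _ yi) => c d; exact: Q_hol.
    by rewrite /= chartK// Q_det.
  apply: (@holx_near _ _ (fun y => \sum_c cv eV (J x') (ksec x a y) 0 c * invmx (Q x' y) c (rshift r b))).
    have nU : \forall y' \near y, U x y' by apply: open_nbhs_nbhs; split.
    have nU' : \forall y' \near y, U x' y' by apply: open_nbhs_nbhs; split.
    by apply: filterS2 nU nU' => y' Uxy' Ux'y'; rewrite kcoordE// kframeE// mxE.
  apply: holx_sum => c _; apply: holxM; last exact: hinv.
  by apply: cv_ksec_hol; last exact: U_J.
move=> i y [Uxy Ux'y] yi.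
by have := hol_derivable (H y Uxy Ux'y i yi); exact.
Qed.

Let U_cover y : exists x : X, U x y. Proof. by exists y. Qed.

Definition kbundle : vbundle X :=
  @VBundle R X q kfiber X U kframe U_cover U_open kframe_basis kframe_holo.

Definition kincl y : 'Hom(fiber kbundle y, fiber V y) := linfun (@vsval _ _ (kspace y)).

Lemma kinclE y v : kincl y v = vsval v.
Proof. by rewrite lfunE. Qed.

Lemma kincl_holo (x : triv_index kbundle) (a : 'I_(rk kbundle)) :
  holo_section (triv_dom x) (fun y => kincl y (tnth (@frame R X kbundle x y) a)).
Proof.
move=> k b i y [Uxy yk] yi.
have hx := cv_ksec_hol a (cast_ord (esym eV) b) Uxy yk.
have : holx (fun y => coord (frame k y) b (kincl y (tnth (@frame R X kbundle x y) a))) y.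
  apply: holx_near hx; have nU : \forall y' \near y, U x y' by apply: open_nbhs_nbhs; split.
  by apply: filterS nU => y' Uxy'; rewrite kinclE /= kframeE// mxE cast_ordKV.
by move=> /(_ i yi)/hol_derivable; exact.
Qed.

Lemma kincl_inj y : lker (kincl y) = 0%VS.
Proof. by apply/eqP/lker0P => u v; rewrite !kinclE => /subvs_inj. Qed.

Definition ksub : subbundle V := Subbundle kincl_holo kincl_inj.

Lemma ksub_in_kernel : in_kernel ksub.
Proof.
move=> y u /memv_imgP[v _ ->]; rewrite kinclE.
have /subvP := kspan_lker (U_center y); move=> /(_ _ (subvsP v)).
by rewrite memv_ker => /eqP.
Qed.

(** The kernel sections around x, written in two ways in the frame [J x']. This is the compatibility
    that [corner_change] asks of C. *)
Lemma ktransition (x x' y : X) : U x y -> U x' y ->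
  Qb x y *m tr eV (J x) (J x') y = @transition R X kbundle x x' y *m Qb x' y.
Proof.
move=> Uxy Ux'y; apply/row_matrixP => a.
rewrite !row_mul -(cv_vec_tr eV _ _ (U_J Uxy)).
have -> : vec eV (J x) y (row a (Qb x y)) = vsval (tnth (kframe x y) a) by rewrite kframeE.
pose c : 'rV[Cx R]_q := row a (@transition R X kbundle x x' y).
rewrite -[RHS](vecK eV (U_J Ux'y)) vecM; congr cv.
rewrite {1}(coord_basis (kframe_basis Ux'y) (memvf (tnth (kframe x y) a))) linear_sum.
apply: eq_bigr => b _; rewrite linearZ !mxE -(tnth_nth 0); congr (_ *: _).
exact: kframeE.
Qed.

End KernelBundle.

(** * Discriminants in adapted bases *)

Section GramBlocks.
Variables (K : fieldType) (r q : nat).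
Implicit Types (Q G T : 'M[K]_(r + q)).

(** When the last q basis vectors lie in the kernel, only the r by r corner survives: it is the Gram
    matrix of the form induced on the quotient. *)
Lemma corner_block Q G : G^T = G -> dsubmx Q *m G = 0 ->
  Q *m G *m Q^T = block_mx (ulsubmx (Q *m G *m Q^T)) 0 0 0.
Proof.
move=> Gs QG; set S := Q *m G *m Q^T.
have Ss : S^T = S by rewrite /S !trmx_mul trmxK Gs mulmxA.
have Sd : dsubmx S = 0.
  by rewrite /S -(vsubmxK Q) !mul_col_mx QG mul0mx col_mxKd.
have Sdl : dlsubmx S = 0 by rewrite -[dlsubmx S]/(lsubmx (dsubmx S)) Sd linear0.
have Sdr : drsubmx S = 0 by rewrite -[drsubmx S]/(rsubmx (dsubmx S)) Sd linear0.
have Sur : ursubmx S = 0 by rewrite -Ss -trmx_dlsub Sdl trmx0.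
by rewrite -{1}(submxK S) Sdl Sdr Sur.
Qed.

Lemma corner_det_neq0 Q G : \det Q != 0 -> G^T = G -> dsubmx Q *m G = 0 ->
  \rank G = r -> \det (ulsubmx (Q *m G *m Q^T)) != 0.
Proof.
move=> dQ Gs QG rG; have Qf : row_free Q^T by rewrite row_free_unit unitmx_tr unitmxE unitfE.
have rS : \rank (Q *m G *m Q^T) = r.
  by rewrite mxrankMfree// -mxrank_tr trmx_mul mxrankMfree// mxrank_tr.
rewrite (corner_block Gs QG) rank_diag_block_mx mxrank0 addn0 in rS.
by rewrite -unitfE -unitmxE -row_free_unit; apply/eqP.
Qed.

(** H is the change between two adapted bases. It preserves the kernel, hence is block triangular,
    with A the change on the quotient and C the one on the kernel. The exponent r is the size of the
    corner. *)
Lemma corner_change Q0 Q1 T G0 G1 (C : 'M[K]_q) (t : K) :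
  \det Q1 != 0 -> G1^T = G1 -> dsubmx Q1 *m G1 = 0 ->
  dsubmx Q0 *m T = C *m dsubmx Q1 -> t *: G0 = T *m G1 *m T^T ->
  exists A : 'M[K]_r, \det Q0 * \det T = \det A * \det C * \det Q1 /\
    t ^+ r * \det (ulsubmx (Q0 *m G0 *m Q0^T)) =
    \det A ^+ 2 * \det (ulsubmx (Q1 *m G1 *m Q1^T)).
Proof.
move=> dQ1 Gs QG QT tG; have Qu : Q1 \in unitmx by rewrite unitmxE unitfE.
pose H := Q0 *m T *m invmx Q1.
have HQ : H *m Q1 = Q0 *m T by rewrite /H mulmxKV.
have Qb1 : dsubmx Q1 *m invmx Q1 = row_mx 0 1%:M.
  have : Q1 *m invmx Q1 = 1%:M by rewrite mulmxV.
  rewrite -{1}(vsubmxK Q1) mul_col_mx scalar_mx_block => e.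
  by have := congr1 dsubmx e; rewrite col_mxKd /block_mx col_mxKd.
have Hd : dsubmx H = row_mx 0 C.
  rewrite /H -(vsubmxK Q0) !mul_col_mx col_mxKd QT -mulmxA Qb1.
  by rewrite mul_mx_row mulmx0 mulmx1.
have HE : H = block_mx (ulsubmx H) (ursubmx H) 0 C.
  rewrite -{1}(submxK H) -[dlsubmx H]/(lsubmx (dsubmx H)) -[drsubmx H]/(rsubmx (dsubmx H)).
  by rewrite Hd row_mxKl row_mxKr.
clearbody H; exists (ulsubmx H); split.
  by rewrite -det_mulmx -HQ det_mulmx {1}HE det_ublock.
have e : t *: (Q0 *m G0 *m Q0^T) = H *m (Q1 *m G1 *m Q1^T) *m H^T.
  rewrite scalemxAl scalemxAr tG.
  have -> : H *m (Q1 *m G1 *m Q1^T) *m H^T = (H *m Q1) *m G1 *m (H *m Q1)^T.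
    by rewrite trmx_mul !mulmxA.
  by rewrite HQ trmx_mul !mulmxA.
have ulZ (M : 'M[K]_(r + q)) : t *: ulsubmx M = ulsubmx (t *: M) by apply/matrixP => a b; rewrite !mxE.
rewrite -detZ ulZ e (corner_block Gs QG).
rewrite {1 2}HE tr_block_mx !mulmx_block !mulmx0 !mul0mx !addr0 !block_mxKul.
by rewrite mul0mx addr0 !det_mulmx det_tr; ring.
Qed.

End GramBlocks.

(** The computation behind [kratio_indep]: g, u, s, n, z are the discriminant, det Q and the values
    of [sV], [sN], [sL ^+ r], and t is the r-th power of the transition of L. If n or z is 0, both
    sides are 0 since the inverse of 0 is 0. *)
Lemma scalar_ratio (K : fieldType) (a c u u' t T g g' s n z : K) :
  a != 0 -> c != 0 -> u != 0 -> u' != 0 -> t != 0 ->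
  t * g = a ^+ 2 * g' -> u * T = a * c * u' ->
  g * (s / u) ^+ 2 / (n ^+ 2 * z) = g' * (T * s / u') ^+ 2 / ((c * n) ^+ 2 * (t * z)).
Proof.
move=> a0 c0 u0 u'0 t0 gE TE.
have -> : g = a ^+ 2 * g' / t by rewrite -gE mulrAC mulfV ?mul1r.
have -> : T = a * c * u' / u by rewrite -TE mulrAC mulfV ?mul1r.
have [->|n0] := eqVneq n 0; first by rewrite !(mulr0, expr0n, mul0r, invr0).
have [->|z0] := eqVneq z 0; first by rewrite !(mulr0, invr0).
by field; rewrite ?a0 ?c0 ?u0 ?u'0 ?t0 ?n0 ?z0.
Qed.

(** * The divisor of the discriminant *)

Section KernelDegree.
Variables (R : realType) (X : riemann_surface R) (X_compact : compact [set: X]).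

Lemma holx_mulmx m n p (A : X -> 'M[Cx R]_(m, n)) (B : X -> 'M[Cx R]_(n, p)) x :
  (forall a b, holx (fun y => A y a b) x) -> (forall a b, holx (fun y => B y a b) x) ->
  forall a b, holx (fun y => (A y *m B y) a b) x.
Proof.
move=> hA hB a b; apply: (@holx_near _ _ (fun y => \sum_c A y a c * B y c b)).
  by apply: filterE => y; rewrite mxE.
by apply: holx_sum => c _; apply: holxM; [exact: hA|exact: hB].
Qed.

Lemma holx_det m (A : X -> 'M[Cx R]_m) x :
  (forall a b, holx (fun y => A y a b) x) -> holx (fun y => \det (A y)) x.
Proof.
have [i xi] := chart_cover x => /(holx_mx A xi) hA.
exact: (holx_chart xi (hol_det hA)).
Qed.

Lemma det_divisor_ordx (E : vbundle X) s nu : det_divisor (E := E) s nu ->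
  forall x j, triv_dom j x -> ordx (s j) x (nu x).
Proof. by move=> [_ H] x j xj; apply/has_orderP; exact: H. Qed.

Lemma det_divisor_finite (E : vbundle X) s nu : det_divisor (E := E) s nu ->
  finite_set [set x | nu x != 0].
Proof.
move=> snu; apply: (ordx_finite X_compact) => x.
have [j xj] := @triv_cover _ _ E x; exists (s j).
by apply: filterS (near_triv xj) => y; exact: det_divisor_ordx.
Qed.

Lemma sum_det_divisor (E : vbundle X) k s nu (A : set X) (finA : finite_set A) :
  has_degree E k -> det_divisor (E := E) s nu -> [set x | nu x != 0] `<=` A ->
  \sum_(x <- finmap.enum_fset (fset_set A)) nu x = k.
Proof. by move=> [_ H] /H <- nuA; rewrite (fsum_support finA). Qed.

Variables (L : vbundle X) (V : quadric_bundle L) (eL : 1%N = rk L).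
Variables (r q : nat) (eV : (r + q)%N = rk V) (D : X -> kdata V (r + q)).
Hypothesis okD : forall x, kdata_ok eL eV r x (D x).

Let N := kbundle okD.
Let Q x y := kd_Q (D x) y.
Let G x y := gram eV eL (kd_j (D x)) (kd_l (D x)) y.

Variables (sV : triv_index V -> X -> Cx R) (sN : X -> X -> Cx R) (sL : triv_index L -> X -> Cx R).
Variables (nuV nuN nuL : X -> int).
Hypotheses (VdivE : det_divisor sV nuV) (NdivE : det_divisor (E := N) sN nuN)
  (LdivE : det_divisor sL nuL).

(* The discriminant of the form induced on V/N, read as a rational function
   through the sections sV, sN and sL. *)
Definition kratio x y : Cx R :=
  \det (ulsubmx (Q x y *m G x y *m (Q x y)^T)) * (sV (kd_j (D x)) y / \det (Q x y)) ^+ 2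
  / (sN x y ^+ 2 * sL (kd_l (D x)) y ^+ r).

(** The quotient of [sV] by det Q is the coordinate of the section of det V in the adapted basis.
    The changes det A of the quotient, det C of the kernel and t of L cancel out. *)
Lemma kratio_indep (x x' y : X) : kd_U (D x) y -> kd_U (D x') y -> kratio x y = kratio x' y.
Proof.
move=> Uxy Ux'y.
have [_ _ Udom UQ _] := okD x; have [_ _ Udom' UQ' _] := okD x'.
have [yj yl] := Udom y Uxy; have [yj' yl'] := Udom' y Ux'y.
have [dQ _] := UQ y Uxy; have [dQ' _] := UQ' y Ux'y.
pose T := tr eV (kd_j (D x)) (kd_j (D x')) y.
pose C := @transition R X N x x' y.
pose t := tr eL (kd_l (D x)) (kd_l (D x')) y 0 0.
have [A [detE cornE]] := corner_change dQ' (gram_sym eV eL (kd_j (D x')) (kd_l (D x')) y)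
  (ker_rows okD Ux'y) (ktransition okD Uxy Ux'y) (gram_tr eV eL (kd_l (D x')) yj yj' yl).
have t0 : t != 0 by exact: tr_line_neq0.
have T0 : \det T != 0 by exact: det_tr_neq0.
have AC0 : \det A * \det C != 0.
  by apply/eqP => e; move: detE; rewrite e mul0r => /eqP; rewrite mulf_eq0 (negbTE dQ) (negbTE T0).
have A0 : \det A != 0 by apply: contraNneq AC0 => ->; rewrite mul0r.
have C0 : \det C != 0 by apply: contraNneq AC0 => ->; rewrite mulr0.
have eVs : sV (kd_j (D x')) y = \det T * sV (kd_j (D x)) y.
  by case: VdivE => H _; rewrite (H _ _ _ yj yj') det_tr_transition.
have eNs : sN x' y = \det C * sN x y by case: NdivE => H _; rewrite (H _ _ _ Uxy Ux'y).
have eLs : sL (kd_l (D x')) y = t * sL (kd_l (D x)) y.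
  by case: LdivE => H _; rewrite (H _ _ _ yl yl') -(det_tr_transition eL) det_mx11.
rewrite /kratio eVs eNs eLs.
rewrite [(t * _) ^+ r]exprMn; have tr0 : t ^+ r != 0 by rewrite expf_neq0.
exact: (scalar_ratio _ _ _ A0 C0 dQ dQ' tr0 cornE detE).
Qed.

(** [mm x] is the order of the discriminant at x and nu the divisor of f times [sV]. Of the three
    terms [nuV x], two come from the square of [sV] inside f and one from the last factor. *)
Lemma kernel_degree_divisor : exists mm : X -> nat, exists s, exists nu,
  det_divisor (E := V) s nu /\
  forall x, (mm x)%:Z = nu x - 3 * nuV x + 2 * nuN x + r%:Z * nuL x.
Proof.
have U_near x : \forall y \near x, kd_U (D x) y.
  by have [oU Ux _ _ _] := okD x; apply: open_nbhs_nbhs.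
have /choice[mm mmE] x : exists n : nat,
    ordx (fun y => \det (ulsubmx (Q x y *m G x y *m (Q x y)^T))) x n%:Z.
  have [_ Ux Udom UQ UG] := okD x; have [xj xl] := Udom x Ux; have [_ hQ] := UQ x Ux.
  apply: holx_ord.
    apply: holx_det => a b.
    have hQt a' b' : holx (fun y => (Q x y)^T a' b') x.
      by apply: holx_near (hQ b' a'); apply: filterE => y; rewrite mxE.
    have hS := holx_mulmx (holx_mulmx hQ (fun a' b' => gram_hol eV eL a' b' xj xl)) hQt.
    by apply: holx_near (hS (lshift q a) (lshift q b)); apply: filterE => y; rewrite !mxE.
  apply: filterS (U_near x) => y Uxy yx; have [dQ _] := UQ y Uxy; have [_ rG] := UG y Uxy.
  by apply: corner_det_neq0 => //; [exact: gram_sym|exact: (ker_rows okD Uxy)|exact: rG].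
(* The centre moves with y; by [kratio_indep], f agrees with [kratio x] near x. *)
pose f y := kratio y y.
(* The 0 is the order of det Q, a unit at x. *)
pose e x : int := (mm x)%:Z + (nuV x + - 0) *+ 2 + - (nuN x *+ 2 + nuL x *+ r).
have f_ord x : ordx f x (e x).
  have [_ Ux Udom UQ _] := okD x; have [xj xl] := Udom x Ux; have [dQ hQ] := UQ x Ux.
  have oV := det_divisor_ordx VdivE xj; have oL := det_divisor_ordx LdivE xl.
  have oN := @det_divisor_ordx N _ _ NdivE x x Ux.
  have oQ := ordxV (ordx_unit (holx_det hQ) dQ).
  have := ordxM (ordxM (mmE x) (ordxX 2 (ordxM oV oQ))) (ordxV (ordxM (ordxX 2 oN) (ordxX r oL))).
  apply: ordx_near; apply: filterS (U_near x) => y Uxy _.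
  by rewrite /f (kratio_indep _ Uxy)//; have [_ Uy _ _ _] := okD y.
exists mm, (fun j y => f y * sV j y), (fun x => e x + nuV x); split.
  split=> [j k x xj xk|x j xj]; first by case: VdivE => H _; rewrite (H _ _ _ xj xk) mulrCA.
  by apply/has_orderP; apply: ordxM; [exact: f_ord|exact: (det_divisor_ordx VdivE)].
move=> x; rewrite /e; move: (mm x)%:Z (nuV x) (nuN x) (nuL x) => m v n l.
by rewrite -[l *+ r]mulr_natl natz oppr0 addr0; ring.
Qed.

End KernelDegree.

(** Summed over a finite set that contains all the supports, the orders of the discriminant give 0
    <= d - 3 d + 2 k + r dL. *)
Theorem kernel_degree (R : realType) (X : riemann_surface R) (X_compact : compact [set: X])
  (L : vbundle X) (V : quadric_bundle L) (eL : 1%N = rk L) (r q : nat) (eV : (r + q)%N = rk V)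
  (D : X -> kdata V (r + q)) (okD : forall x, kdata_ok eL eV r x (D x)) (d dL k : int) :
  has_degree V d -> has_degree L dL -> has_degree (kbundle okD) k ->
  2 * d - 2 * k <= r%:Z * dL.
Proof.
move=> dV dLL dN.
have [[sV [nuV VdivE]] _] := dV; have [[sL [nuL LdivE]] _] := dLL.
have [[sN [nuN NdivE]] _] := dN.
have [mm [s [nu [divE mmE]]]] := kernel_degree_divisor VdivE NdivE LdivE.
pose A := ([set x | nuV x != 0] `|` [set x | nuL x != 0]) `|`
  ([set x | nuN x != 0] `|` [set x | nu x != 0]).
have finA : finite_set A.
  have fV := det_divisor_finite X_compact VdivE; have fL := det_divisor_finite X_compact LdivE.
  have fN := det_divisor_finite X_compact NdivE; have fv := det_divisor_finite X_compact divE.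
  by rewrite !finite_setU; split; split.
have sumV := sum_det_divisor finA dV VdivE (fun x h => or_introl (or_introl h)).
have sumL := sum_det_divisor finA dLL LdivE (fun x h => or_introl (or_intror h)).
have sumN := sum_det_divisor finA dN NdivE (fun x h => or_intror (or_introl h)).
have sumv := sum_det_divisor finA dV divE (fun x h => or_intror (or_intror h)).
have : 0 <= \sum_(x <- finmap.enum_fset (fset_set A)) (mm x)%:Z by apply: sumr_ge0.
under eq_bigr => x _ do rewrite mmE.
rewrite !big_split/= sumrN -!mulr_sumr sumV sumL sumN sumv; lia.
Qed.

(** * Critical values *)

Section Nondegenerate.
Variables (R : realType) (X : riemann_surface R) (L : vbundle X) (V : quadric_bundle L).

Lemma dim_fiber (E : vbundle X) (y : X) : \dim {:fiber E y} = rk E.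
Proof. by have [j /frame_basis/size_basis] := @triv_cover _ _ E y. Qed.

Lemma dim_sub_fiber (E : vbundle X) (S : subbundle E) y : \dim (sub_fiber S y) = rk S.
Proof. by rewrite /sub_fiber limg_dim_eq ?dim_fiber// incl_inj capv0. Qed.

Lemma dim_direct_sum (S T : subbundle V) (y : X) : is_direct_sum S T -> (rk S + rk T)%N = rk V.
Proof.
move=> /(_ y)[sum cap]; rewrite -(dim_sub_fiber S y) -(dim_sub_fiber T y) -(dim_fiber V y).
by rewrite -dimv_disjoint_sum// sum.
Qed.

(** With M_A, M_B the coordinates of bases of A and B, M_A G M_B^T = 0; G being invertible, M_A G
    still has rank dim A, and the ranks of two factors with product 0 add up to at most the inner
    dimension. *)
Lemma dim_perp (eL : 1%N = rk L) (j : triv_index V) (l : triv_index L) y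
    (A B : {vspace fiber V y}) :
  triv_dom j y -> triv_dom l y -> \rank (gram erefl eL j l y) = rk V ->
  (forall u v, u \in A -> v \in B -> qform V y u v = 0) -> (\dim A + \dim B <= rk V)%N.
Proof.
move=> yj yl rG AB.
have := row_free_cv (erefl (rk V)) A yj; have := row_free_cv (erefl (rk V)) B yj.
set MB := \matrix_(a < \dim B) _; set MA := \matrix_(a < \dim A) _ => fB fA.
have Gf : row_free (gram erefl eL j l y) by rewrite /row_free rG.
have M0 : MA *m gram erefl eL j l y *m MB^T = 0.
  apply/matrixP => a b; rewrite [RHS]mxE.
  have := gramE erefl eL l (tnth (vbasis A) a) (tnth (vbasis B) b) yj.
  rewrite AB ?vbasis_mem ?mem_tnth// => /(congr1 (fun M : 'M_1 => M 0 0)).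
  rewrite [LHS]mxE linear0 => ->; rewrite [LHS]mxE [RHS]mxE; apply: eq_bigr => c _.
  congr (_ * _); last by rewrite !mxE.
  by rewrite [LHS]mxE [RHS]mxE; apply: eq_bigr => c' _; rewrite !mxE.
have := mulmx0_rank_max M0; rewrite mxrankMfree// mxrank_tr.
by rewrite (eqP fA) (eqP fB).
Qed.

Lemma degP_le_lt_eq (E : vbundle X) (b : R) :
  degP E (fun e => e <= b) -> degP E (fun e => e < b) \/ degP E (fun e => e = b).
Proof.
by move=> [k Ek]; rewrite le_eqVlt => /orP[/eqP ?|?]; [right|left]; exists k.
Qed.

Variables (eL : 1%N = rk L) (j : triv_index V) (l : triv_index L) (y : X).
Hypotheses (yj : triv_dom j y) (yl : triv_dom l y).
Hypothesis nondeg : \rank (gram erefl eL j l y) = rk V.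

(** If V is not independent, each case of equality is contradictory, so that V is stable, against
    strictness. *)
Lemma nondegenerate_independent (d : int) (alpha : R) :
  strictly_polystable V d alpha -> independently_polystable V d.
Proof.
move=> [[ss ps1 ps2] nstable]; apply: contrapT => nind; apply: nstable.
split=> //; have [_ [ss1 ss2]] := ss.
have perp (S T : subbundle V) : in_perp S T -> (rk S + rk T <= rk V)%N.
  move=> ST; rewrite -(dim_sub_fiber S y) -(dim_sub_fiber T y).
  by apply: (dim_perp yj yl nondeg) => u v; exact: ST.
split.
  move=> S Sp; have [ssa ssb ssc] := ss1 S Sp; have [psa psb psc] := ps1 S Sp.
  have /andP[S0 SV] := Sp.
  split.
  - move=> nSS; have [//|e] := degP_le_lt_eq (ssa nSS); exfalso.
    have [T [ds ST TT _]] := psa nSS e.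
    have dimS := dim_direct_sum y ds.
    (* In a splitting of type (a), T is orthogonal to S and to itself, hence to all of V, and
       nondegeneracy gives T = 0 although S is proper. *)
    have TV : forall u v, u \in sub_fiber T y -> v \in {:fiber V y}%VS -> qform V y u v = 0.
      move=> u v uT _; have [sum _] := ds y.
      have : v \in (sub_fiber S y + sub_fiber T y)%VS by rewrite sum memvf.
      move=> /memv_addP[v1 v1S [v2 v2T ->]]; rewrite linearD /=.
      by rewrite (TT y u v2)// qform_sym (ST y v1 u)// addr0.
    have := dim_perp yj yl nondeg TV; rewrite dim_sub_fiber dim_fiber; lia.
  - move=> SS; have [//|e] := degP_le_lt_eq (ssb SS); exfalso; apply: nind; left.
    have [T sb] := psb SS e; have [ds _ TT _] := sb.
    (* S and T are complementary and isotropic, so both have rank n / 2; equality then reads deg S =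
       d / 2, and d is even. *)
    have dimS := dim_direct_sum y ds; have := perp _ _ SS; have := perp _ _ TT => tt s2.
    have rV : rk V = (rk S).*2 by lia.
    have rS : (rk S)%:R = (rk V)%:R / 2 :> R by rewrite rV -muln2 natrM; field.
    move: e => [k degS]; rewrite rS subrr mulr0 addr0 => ke.
    have d2k : d = 2 * k.
      by apply/eqP; rewrite -(eqr_int R) intrM; apply/eqP; rewrite ke; field.
    split; first by rewrite rV odd_double.
      by rewrite d2k dvdz_mulr.
    by exists S; split=> //; [exists k|exists T].
  - move=> kS; exfalso.
    have SVp : forall u v, u \in sub_fiber S y -> v \in {:fiber V y}%VS -> qform V y u v = 0.
      by move=> u v uS _; rewrite (kS y u uS) lfunE.
    have := dim_perp yj yl nondeg SVp; rewrite dim_sub_fiber dim_fiber; lia.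
move=> S T adm; have [k degS [k' degT]] := ss2 S T adm.
rewrite le_eqVlt => /orP[/eqP e|lt]; last by exists k => //; exists k'.
have eqf : ineq_filtration d alpha eq S T by exists k => //; exists k'.
have [A [B sf]] := ps2 S T adm eqf; exfalso; apply: nind; right.
have [sumT ds [SS SA AB BB] _] := sf; have [_ ST _] := adm.
have le1 := perp _ _ ST; have dimT := dim_direct_sum y ds.
have dimA : (rk S + rk A)%N = rk T.
  have [sum cap] := sumT y.
  by rewrite -(dim_sub_fiber S y) -(dim_sub_fiber A y) -(dim_sub_fiber T y) -dimv_disjoint_sum// sum.
(* A + B is orthogonal to B. As rk A = rk T - rk S and rk B = n - rk T, this gives n <= rk S + rk T,
   the converse of [le1]. *)
have le2 : (rk A + rk B + rk B <= rk V)%N.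
  have AB0 : (sub_fiber A y :&: sub_fiber B y = 0)%VS.
    apply/eqP; rewrite -subv0; have [_ <-] := ds y; apply: capvS => //.
    by have [<- _] := sumT y; exact: addvSr.
  rewrite -(dim_sub_fiber A y) -(dim_sub_fiber B y) -dimv_disjoint_sum//.
  apply: (dim_perp yj yl nondeg) => u v /memv_addP[u1 u1A [u2 u2B ->]] vB.
  by rewrite linearD lfunE/= (AB y u1 v)// (BB y u2 v)// addr0.
have rST : (rk S + rk T)%N = rk V by lia.
exists S, T; split=> //; last by exists A, B.
exists k => //; exists k' => //; rewrite e -natrD rST subrr mulr0 addr0.
by [].
Qed.

End Nondegenerate.

(** * The bound on critical values *)

Lemma kernel_slope_bound (K : realFieldType) (r q d k dL alpha : K) : 1 <= q ->
  d <= (r + q) / 2 * dL -> 2 * d - 2 * k <= r * dL -> k <= alpha * q ->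
  d - (r + q - 1) / 2 * dL <= alpha.
Proof.
move=> q1 d_le kd ka; have q0 : 0 < q by rewrite (lt_le_trans ltr01).
rewrite -(ler_pM2r q0); apply: le_trans ka.
have : 0 <= (q - 1) * ((r + q) / 2 * dL - d) by rewrite mulr_ge0 ?subr_ge0.
nra.
Qed.

Theorem proposition3p5 (R : realType) (X : riemann_surface R)
    (X_compact : compact [set: X]%classic)
    (g : nat) (X_genus : has_genus X g) (g_ge2 : (2 <= g)%N)
    (L : vbundle X) (dL : int) (L_line : rk L = 1%N) (L_deg : has_degree L dL)
    (n : nat) (d : int) (n_ge1 : (1 <= n)%N)
    (d_le : d%:~R <= n%:R / 2 * dL%:~R :> R)
    (alpha_c : R) (alpha_c_crit : critical_value L n d alpha_c) :
  let alpha_m : R := d%:~R - (n%:R - 1) / 2 * dL%:~R in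
  let alpha_M : R := d%:~R / n%:R in
  alpha_m <= alpha_c <= alpha_M.
Proof.
cbv zeta; have [alpha_le alpha_cases] := alpha_c_crit.
apply/andP; split; last exact: alpha_le.
have n1 : 1 <= n%:R :> R by rewrite ler1n.
case: alpha_cases => [->|[V [[rkV degV] sps nind]]].
  have n0 : 0 < n%:R :> R by rewrite ltr0n.
  rewrite ler_pdivlMr//.
  (* This product is n (d / n - alpha_m). *)
  have : 0 <= (n%:R - 1) * (n%:R / 2 * dL%:~R - d%:~R) :> R by rewrite mulr_ge0 ?subr_ge0.
  nra.
have [x0 _] := qform_neq0 V; have eL := esym L_line.
have [r rV okr] := generic_rank eL (erefl (rk V)) x0.
have r0 := generic_rank_gt0 okr.
have [rE|rneq] := eqVneq r (rk V).
  exfalso; apply: nind; apply: contrapT => nind.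
  (* Full rank is known off the centre x0 only, so a nearby point serves as the nondegenerate
     one. *)
  apply: (@punctured_ex _ X x0); have [D [oU Ux Udom _ UG]] := okr x0.
  have : \forall y \near x0, kd_U D y by apply: open_nbhs_nbhs.
  apply: filterS => y Uy yx; have [yj yl] := Udom y Uy; have [_ rG] := UG y Uy.
  by apply: nind; apply: (nondegenerate_independent yj yl _ sps); rewrite rG.
pose q := (rk V - r)%N.
have eV : (r + q)%N = rk V by rewrite subnKC.
have q0 : (0 < q)%N by rewrite subn_gt0 ltn_neqAle rneq.
have /choice[D okD] : forall x, exists D, kdata_ok eL eV r x D.
  by move=> x; have [D0 /(kdata_cast eV) ok] := okr x; eexists; exact: ok.
have [[[_ [ss1 _]] _ _] _] := sps.
(* The kernel is not V because 0 < r, and not 0 because r < n. *)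
have kp : Defs.proper (ksub okD) by rewrite /Defs.proper /= q0 -eV -{1}[q]add0n ltn_add2r.
have [_ _ ssc] := ss1 _ kp; have kker : in_kernel (ksub okD) by exact: ksub_in_kernel.
have [k degN k_le] := ssc kker.
have deg_le := kernel_degree X_compact degV L_deg degN.
rewrite -rkV -eV natrD; apply: (@kernel_slope_bound _ _ _ _ k%:~R) => //.
- by rewrite ler1n.
- by rewrite -natrD eV rkV.
- by move: deg_le; rewrite -(ler_int R) rmorphB !rmorphM.
Qed.
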